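(* Let $d\in\{2,3\}$, $M\ge1$, and consider the multi-emitter Poisson frame model described in the context, with average emitter intensity $I>0$, fixed intensity weights $\beta_m$, fixed point spread functions, fixed noise means $b(\boldsymbol k)$ and true parameter $\boldsymbol\theta_0\in\Theta$. Let $\mathbf F(I)$ be the one-frame Fisher information matrix at $\boldsymbol\theta_0$ and average intensity $I$. Assume that at $\boldsymbol\theta_0$ the model satisfies, at each intensity $I$ considered: (C1) $\Theta$ is compact and $\boldsymbol\theta_0\in\operatorname{int}\Theta$ (every emitter is strictly inside the field of view and all pairwise separations strictly exceed $\delta$). (C2) There exists $v_{\min}>0$ with $v(\boldsymbol k)\ge v_{\min}$ for all $\boldsymbol k\in\Omega$ and all $\boldsymbol\theta\in\Theta$; and $v(\boldsymbol k)\in C^3(\Theta)$ as a function of $\boldsymbol\theta$ (or, more weakly, the model is differentiable in quadratic mean). (C3) The Fisher information matrix of one frame at $\boldsymbol\theta_0$ is positive definite. (C4) The third-order partial derivatives of $\ell_1(\boldsymbol\theta)$ are bounded by an integrable envelope uniformly on a neighborhood of $\boldsymbol\theta_0$. Let $\hat{\boldsymbol\theta}^{\mathrm{GML}}\in\arg\max_{\boldsymbol\theta\in\Theta}\ell_N(\boldsymbol\theta)$ be the global maximum-likelihood estimator from $N$ i.i.d. frames at $\boldsymbol\theta_0$ with average intensity $I$, write $\mathbf F=N\,\mathbf F(I)$ for the total Fisher information, and let $\hat{\boldsymbol\theta}^{F}=\boldsymbol\theta_0+\mathbf F^{-1/2}\boldsymbol z$ with $\boldsymbol z\sim\mathcal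 N(\mathbf 0,\mathbf I_{dM})$ be the UGIA-F estimator. Then, as $N\to\infty$ and/or $I\to\infty$, $$\hat{\boldsymbol\theta}^{\mathrm{GML}}\ \xrightarrow{d}\ \mathcal N(\boldsymbol\theta_0,\mathbf F^{-1})\ \stackrel{d}{=}\ \hat{\boldsymbol\theta}^{F},$$ in the normalized sense that $$\mathbf F^{1/2}\bigl(\hat{\boldsymbol\theta}^{\mathrm{GML}}-\boldsymbol\theta_0\bigr)\xrightarrow{d}\mathcal N(\mathbf 0,\mathbf I_{dM})\stackrel{d}{=}\mathbf F^{1/2}\bigl(\hat{\boldsymbol\theta}^{F}-\boldsymbol\theta_0\bigr);$$ that is, the GML estimator and the UGIA-F estimator converge to the identical distribution.
   Context: Pixels. $\Omega=\{0,\dots,K_x-1\}\times\{0,\dots,K_y-1\}$ is the finite pixel set; pixel $\boldsymbol k=(k_x,k_y)$ occupies $p(\boldsymbol k)=[\Delta_xk_x,\Delta_x(k_x+1)]\times[\Delta_yk_y,\Delta_y(k_y+1)]$, with $\Delta_x,\Delta_y>0$; $\Delta_t>0$ is the exposure time; $L_x=K_x\Delta_x$, $L_y=K_y\Delta_y$. Parameter space. The field of view is $\mathcal F=[0,L_x]\times[0,L_y]$ if $d=2$ and $\mathcal F=[0,L_x]\times[0,L_y]\times[-L_z,L_z]$ if $d=3$, with $L_z>0$. For $\delta>0$, $$\Theta=\Bigl\{\boldsymbol\theta=(\boldsymbol\theta_1^\top,\dots,\boldsymbol\theta_M^\top)^\top\in\mathcal F^M:\ \min_{m\ne m'}\|\boldsymbol\theta_m-\boldsymbol\theta_{m'}\|\ge\delta\Bigr\}\subset\mathbb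 R^{dM},$$ where $\boldsymbol\theta_m\in\mathbb R^d$ is the position of emitter $m$. Point spread functions. For each emitter $m$, $q_m(\boldsymbol u)$, $\boldsymbol u\in\mathbb R^2$, is a probability density determined by $\boldsymbol\theta_m$ (it may differ between emitters), and its pixel average is $q_m(\boldsymbol k)=\frac1{\Delta_x\Delta_y}\int_{p(\boldsymbol k)}q_m(\boldsymbol u)\,d\boldsymbol u$. Intensities. The known emitter intensities are $I_m=\beta_mI>0$, where $I=M^{-1}\sum_{m=1}^MI_m$ is the average emitter intensity and $M^{-1}\sum_{m=1}^M\beta_m=1$. Put $Q(\boldsymbol k)=\sum_{m=1}^M\beta_mq_m(\boldsymbol k)$. Frame model. The noise means $b(\boldsymbol k)>0$ are known and do not depend on $\boldsymbol\theta$ or $I$. A frame is $V=(V(\boldsymbol k))_{\boldsymbol k\in\Omega}$ with independent entries $V(\boldsymbol k)\sim\mathrm{Poisson}(v(\boldsymbol k))$, where $v(\boldsymbol k)=\Delta_t\Delta_x\Delta_y\,I\,Q(\boldsymbol k)+b(\boldsymbol k)$ depends on $\boldsymbol\theta$ through $Q$. Log-likelihood and information. Up to a $\boldsymbol\theta$-independent constant, the per-frame log-likelihood is $\ell_1(\boldsymbol\theta)=\sum_{\boldsymbol k\in\Omega}[V(\boldsymbol k)\ln v(\boldsymbol k)-v(\boldsymbol k)]$; for $N$ i.i.d. frames $\ell_N(\boldsymbol\theta)=\sum_{n=1}^N\ell_1^{(n)}(\boldsymbol\theta)$, with $\ell_1^{(n)}$ the log-likelihood of the $n$-th frame. The per-frame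 Fisher information matrix is $$\mathbf F(\boldsymbol\theta)=\sum_{\boldsymbol k\in\Omega}\frac1{v(\boldsymbol k)}\frac{\partial v(\boldsymbol k)}{\partial\boldsymbol\theta}\frac{\partial v(\boldsymbol k)}{\partial\boldsymbol\theta}^{\top}\in\mathbb R^{dM\times dM};$$ $\mathbf F(I)$ denotes $\mathbf F(\boldsymbol\theta_0)$ at average intensity $I$. UGIA-F (''unbiased Gaussian information-achieving estimator for a frame'') is, by construction, a draw from the normal law centered at $\boldsymbol\theta_0$ with covariance equal to the inverse Fisher information; for $N$ frames it is drawn from $\mathcal N(\boldsymbol\theta_0,(N\mathbf F(I))^{-1})$. Standing convention: the one-to-one correspondence between the emitter indices of the estimated positions and those of the true positions is known (so estimates are not ambiguous up to relabeling of the emitters). Notation: $\mathbf I_{dM}$ is the identity matrix; $\xrightarrow{d}$ is convergence in distribution under $\boldsymbol\theta_0$; $\stackrel{d}{=}$ is equality in distribution.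
   Formalization: Added: within Θ the image determines the true positions up to a relabeling that preserves the model (else z/−z ambiguity breaks the claim); and for varying I, (C4) holds on a common neighborhood with envelope mean at most C·I (else pixels with zero signal at θ₀ break I→∞). *)

(* Defs.v *)
From HB Require Import structures.
From mathcomp Require Import all_boot all_order all_algebra all_fingroup.
From mathcomp Require Import all_classical all_reals all_analysis.

Set Implicit Arguments.
Unset Strict Implicit.
Unset Printing Implicit Defensive.

Import Order.TTheory GRing.Theory Num.Theory.
Import numFieldNormedType.Exports.

Local Open Scope classical_set_scope.
Local Open Scope ring_scope.

(* The library's norm on matrices is the sup norm, hence [eucl]. *)

Section linear_algebra.
Context {R : realType} {n : nat}.

Definition eucl (x : 'cV[R]_n) : R := Num.sqrt (\sum_i x i 0 ^+ 2).

Definition quad_form (A : 'M[R]_n) (u : 'cV[R]_n) : R := (u^T *m A *m u) 0 0.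

Definition posdef (A : 'M[R]_n) : Prop :=
  A^T = A /\ forall u, u != 0 -> 0 < quad_form A u.

Definition possemidef (A : 'M[R]_n) : Prop :=
  A^T = A /\ forall u, 0 <= quad_form A u.

(* The default 0 is never used on a positive semidefinite argument, for which
   the set below is a singleton.                                              *)
Definition sqrtmx (A : 'M[R]_n) : 'M[R]_n :=
  xget 0 [set B | possemidef B /\ B *m B = A].

End linear_algebra.

Section smoothness.
Context {R : realType} {n : nat}.

Definition basis_vec (i : 'I_n) : 'cV[R]_n := delta_mx i 0.

Definition partial (i : 'I_n) (f : 'cV[R]_n -> R) : 'cV[R]_n -> R :=
  fun x => 'D_(basis_vec i) f x.

Fixpoint Ck (k : nat) (U : set 'cV[R]_n) (f : 'cV[R]_n -> R) : Prop :=
  (forall x, U x -> {for x, continuous f}) /\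
  if k is k'.+1 then
    forall i, (forall x, U x -> derivable f x (basis_vec i)) /\
              Ck k' U (partial i f)
  else True.

(* C^k on an arbitrary set: restriction of a C^k function defined on an open
   neighbourhood of that set.                                                 *)
Definition Ck_on (k : nat) (A : set 'cV[R]_n) (f : 'cV[R]_n -> R) : Prop :=
  exists U g, [/\ open U, A `<=` U, Ck k U g & forall x, A x -> g x = f x].

End smoothness.

Section random_vectors.
Context {R : realType}.

Definition mutually_independent (d d' : measure_display) (T : measurableType d)
    (T' : measurableType d') (P : probability T R) (I : finType)
    (X : I -> {RV P >-> T'}) : Prop :=
  forall (S : {set I}) (A : I -> set T'), (forall i, measurable (A i)) ->
    fine (P (\bigcap_(i in [set i | i \in S]) (X i @^-1` A i))) =
    \prod_(i in S) fine (P (X i @^-1` A i)).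

Definition random_vector (d : measure_display) (T : measurableType d) (n : nat)
    (X : T -> 'cV[R]_n) : Prop :=
  forall i, measurable_fun [set: T] (fun w => X w i 0).

(* The library's [normal_prob m 0] is not the point mass at m, which is the
   degenerate normal law.                                                     *)
Definition normal1 (m var : R) (B : set R) : \bar R :=
  if var == 0 then \d_m B else normal_prob m (Num.sqrt var) B.

(* X ~ N(mu, Sigma): every linear functional u^T X has the univariate normal
   law N(u^T mu, u^T Sigma u).                                                *)
Definition normal_law (d : measure_display) (T : measurableType d)
    (P : probability T R) (n : nat) (X : T -> 'cV[R]_n)
    (mu : 'cV[R]_n) (Sigma : 'M[R]_n) : Prop :=
  random_vector X /\
  forall (u : 'cV[R]_n) (B : set R), measurable B ->
    P [set w | B ((u^T *m X w) 0 0)] =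
    normal1 ((u^T *m mu) 0 0) (quad_form Sigma u) B.

(* Weak convergence, along the filter G on the index type, of the laws of the
   X a to N(mu, Sigma).                                                       *)
Definition cvg_to_normal (idx : Type) (G : set_system idx)
    (d : measure_display) (T : idx -> measurableType d)
    (P : forall a, probability (T a) R) (n : nat)
    (X : forall a, T a -> 'cV[R]_n) (mu : 'cV[R]_n) (Sigma : 'M[R]_n) : Prop :=
  forall (d' : measure_display) (T' : measurableType d') (P' : probability T' R)
    (Z : T' -> 'cV[R]_n), normal_law P' Z mu Sigma ->
  forall f : 'cV[R]_n -> R, continuous f -> (exists B, forall x, `|f x| <= B) ->
    (fun a => \int[P a]_w (f (X a w))%:E)%E @ G -->
    (\int[P']_w (f (Z w))%:E)%E.

End random_vectors.

Section emitters.
Context {R : realType} {d M : nat}.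

Definition emitter (theta : 'cV[R]_(M * d)) (m : 'I_M) : 'cV[R]_d :=
  \col_i theta (mxvec_index m i) 0.

Definition relabel (s : 'S_M) (theta : 'cV[R]_(M * d)) : 'cV[R]_(M * d) :=
  (mxvec (\matrix_(m < M, i < d) emitter theta (s m) i 0))^T.

End emitters.

Notation pixel Kx Ky := ('I_Kx * 'I_Ky)%type.
Notation frame Kx Ky := {ffun pixel Kx Ky -> nat}.

Section field_of_view.
Context {R : realType}.

(* The three cases are the first, second and third coordinate; the third does
   not occur when d = 2.                                                      *)
Definition fov (d : nat) (Lx Ly Lz : R) : set 'cV[R]_d :=
  [set x | forall i : 'I_d,
     match val i with
     | 0 => 0 <= x i 0 <= Lx
     | 1 => 0 <= x i 0 <= Ly
     | _ => - Lz <= x i 0 <= Lz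
     end].

Definition is_density (q : R * R -> R) : Prop :=
  [/\ measurable_fun [set: R * R] q, (forall u, 0 <= q u) &
      (\int[(lebesgue_measure \x lebesgue_measure)%E]_u (q u)%:E = 1)%E].

End field_of_view.

Record frame_model (R : realType) (d M Kx Ky : nat) := FrameModel {
  Dx : R; Dy : R; Dt : R; Lz : R; sep : R;
  psf : 'I_M -> 'cV[R]_d -> R * R -> R;
  weight : 'I_M -> R;
  bg : pixel Kx Ky -> R;
  Dx_gt0 : 0 < Dx;
  Dy_gt0 : 0 < Dy;
  Dt_gt0 : 0 < Dt;
  Lz_gt0 : 0 < Lz;
  sep_gt0 : 0 < sep;
  psf_density : forall m x,
    fov (Kx%:R * Dx) (Ky%:R * Dy) Lz x -> is_density (psf m x);
  weight_gt0 : forall m, 0 < weight m;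
  weight_mean : M%:R^-1 * \sum_m weight m = 1;
  bg_gt0 : forall k, 0 < bg k
}.

Section model.
Context {R : realType} {d M Kx Ky : nat} (S : frame_model R d M Kx Ky).
Implicit Types (theta : 'cV[R]_(M * d)) (k : pixel Kx Ky) (I : R).

Definition Theta : set 'cV[R]_(M * d) :=
  [set theta |
     (forall m, fov (Kx%:R * Dx S) (Ky%:R * Dy S) (Lz S) (emitter theta m)) /\
     (forall m m', m != m' ->
        sep S <= eucl (emitter theta m - emitter theta m'))].

Definition pixel_area k : set (R * R) :=
  [set u | Dx S * k.1%:R <= u.1 <= Dx S * (k.1%:R + 1) /\
           Dy S * k.2%:R <= u.2 <= Dy S * (k.2%:R + 1)].

Definition pixel_psf (m : 'I_M) k theta : R :=
  (Dx S * Dy S)^-1 *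
  \int[(lebesgue_measure \x lebesgue_measure)%E]_(u in pixel_area k)
     psf S m (emitter theta m) u.

Definition signal k theta : R := \sum_m weight S m * pixel_psf m k theta.

Definition mean_count I k theta : R := Dt S * Dx S * Dy S * I * signal k theta + bg S k.

Definition loglik1 I (x : frame Kx Ky) theta : R :=
  \sum_k ((x k)%:R * ln (mean_count I k theta) - mean_count I k theta).

Definition loglik I (N : nat) (x : 'I_N -> frame Kx Ky) theta : R :=
  \sum_(j < N) loglik1 I (x j) theta.

Definition frame_pmf I theta (x : frame Kx Ky) : R :=
  \prod_k poisson_pmf (mean_count I k theta) (x k).

Definition fisher I theta : 'M[R]_(M * d) :=
  \matrix_(i, j) \sum_k (mean_count I k theta)^-1 *
     partial i (mean_count I k) theta * partial j (mean_count I k) theta.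

(* Differentiability in quadratic mean, at every point of Theta, of the family
   of laws of one frame (densities with respect to the counting measure).     *)
Definition quad_mean_differentiable I : Prop :=
  forall theta, Theta theta ->
  exists score : frame Kx Ky -> 'cV[R]_(M * d),
  forall e : R, 0 < e -> exists2 r : R, 0 < r &
  forall theta', Theta theta' -> eucl (theta' - theta) < r ->
    (\esum_(x in [set: frame Kx Ky])
       ((Num.sqrt (frame_pmf I theta' x) - Num.sqrt (frame_pmf I theta x)
         - 2^-1 * ((theta' - theta)^T *m score x) 0 0
             * Num.sqrt (frame_pmf I theta x)) ^+ 2)%:E
     <= (e * eucl (theta' - theta) ^+ 2)%:E)%E.

Definition regular_intensity I : Prop :=
  (exists2 vmin : R, 0 < vmin &
     forall k theta, Theta theta -> vmin <= mean_count I k theta) /\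
  ((forall k, Ck_on 3 Theta (mean_count I k)) \/ quad_mean_differentiable I).

Definition thrice_derivable_bounded (f : 'cV[R]_(M * d) -> R) theta (g : R) :=
  forall i j l,
    [/\ derivable f theta (basis_vec i),
        derivable (partial i f) theta (basis_vec j),
        derivable (partial j (partial i f)) theta (basis_vec l) &
        `|partial l (partial j (partial i f)) theta| <= g].

(* J is the set of intensities considered.  For each I in J the third-order
   partial derivatives of the log-likelihood of a frame x are bounded near
   theta0 by an envelope G x with finite mean.  The log-likelihood is of order
   I, so uniformity over J (void when J is a singleton) means: same
   neighbourhood, and mean of the envelope bounded by a multiple of I.        *)
Definition third_order_envelope (J : set R) theta0 : Prop :=
  exists r C : R, 0 < r /\
  forall I, J I -> exists G : frame Kx Ky -> R,
    (\esum_(x in [set: frame Kx Ky]) (frame_pmf I theta0 x * G x)%:E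
       <= (C * I)%:E)%E /\
    forall x theta, eucl (theta - theta0) < r ->
      thrice_derivable_bounded (loglik1 I x) theta (G x).

(* The image determines the true positions up to a relabeling of emitters
   that leaves the model unchanged.                                           *)
Definition identifiable_up_to_relabeling theta0 : Prop :=
  forall theta, Theta theta -> (forall k, signal k theta = signal k theta0) ->
  exists s : 'S_M,
    (forall theta', Theta theta' -> forall k, signal k (relabel s theta') = signal k theta')
    /\ theta = relabel s theta0.

Definition maximizer I (N : nat) (x : 'I_N -> frame Kx Ky) theta : Prop :=
  Theta theta /\ forall theta', Theta theta' ->
    loglik I x theta' <= loglik I x theta.

(* Known correspondence between the indices of estimated and true positions:
   among the relabelings of the estimate that are maximizers too, it is the
   one matched with theta0.                                                   *)
Definition correctly_labeled I (N : nat) (x : 'I_N -> frame Kx Ky) theta0 theta :=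
  forall s : 'S_M, maximizer I x (relabel s theta) ->
    eucl (theta - theta0) <= eucl (relabel s theta - theta0).

Section data.
Context {disp : measure_display} {T : measurableType disp}
  {P : probability T R} {N : nat}.

(* The second argument of [poisson_prob] is a dummy. *)
Definition poisson_frames I theta
    (V : 'I_N -> pixel Kx Ky -> {RV P >-> nat}) : Prop :=
  (forall j k (A : set nat),
     distribution P (V j k) A = poisson_prob (mean_count I k theta) 0%N A) /\
  mutually_independent (fun jk : 'I_N * pixel Kx Ky => V jk.1 jk.2).

Definition frames_at (V : 'I_N -> pixel Kx Ky -> {RV P >-> nat}) (w : T)
    : 'I_N -> frame Kx Ky :=
  fun j => [ffun k => V j k w].

Definition GML_estimator I theta0 (V : 'I_N -> pixel Kx Ky -> {RV P >-> nat})
    (X : T -> 'cV[R]_(M * d)) : Prop :=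
  random_vector X /\
  {ae P, forall w, maximizer I (frames_at V w) (X w) /\
                   correctly_labeled I (frames_at V w) theta0 (X w)}.

End data.

Definition total_fisher (N : nat) I theta : 'M[R]_(M * d) :=
  N%:R *: fisher I theta.

Definition UGIAF (disp : measure_display) (T : measurableType disp) (N : nat)
    I theta0 (z : T -> 'cV[R]_(M * d)) : T -> 'cV[R]_(M * d) :=
  fun w => theta0 + invmx (sqrtmx (total_fisher N I theta0)) *m z w.

Definition normalized (N : nat) I theta0 theta : 'cV[R]_(M * d) :=
  sqrtmx (total_fisher N I theta0) *m (theta - theta0).

End model.

(* N -> oo at a fixed intensity of J, or I -> +oo within J at a fixed number of
   frames, or both jointly.                                                   *)
Definition asymptotic_regime {R : realType} (J : set R)
    (G : set_system (nat * R)) : Prop :=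
  [\/ exists2 I, J I & G = (fun N : nat => (N, I)) @ \oo,
      exists2 N, (0 < N)%N & G = (fun I : R => (N, I)) @ within J (pinfty_nbhs R) |
      G = filter_prod \oo (within J (pinfty_nbhs R))].

(* Main.v *)
Require Import Defs.
From mathcomp Require spectral sesquilinear complex.
From HB Require Import structures.
From mathcomp Require Import all_boot all_order all_algebra all_fingroup.
From mathcomp Require Import all_classical all_reals all_analysis.
From mathcomp Require Import measurable_realfun.
From mathcomp Require Import ring lra.

Set Implicit Arguments.
Unset Strict Implicit.
Unset Printing Implicit Defensive.

Import Order.TTheory GRing.Theory Num.Theory.
Import numFieldNormedType.Exports.

Local Open Scope classical_set_scope.
Local Open Scope ring_scope.

Section euclidean_space.
Context {R : realType} {n : nat}.
Implicit Types (u x y : 'cV[R]_n).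

Definition dot u x : R := \sum_i u i 0 * x i 0.

Lemma dotE u x : (u^T *m x) 0 0 = dot u x.
Proof. by rewrite mxE; apply: eq_bigr => i _; rewrite mxE. Qed.

Lemma dotC u x : dot u x = dot x u.
Proof. by apply: eq_bigr => i _; rewrite mulrC. Qed.

Lemma dotDr u x y : dot u (x + y) = dot u x + dot u y.
Proof.
by rewrite -big_split; apply: eq_bigr => i _; rewrite mxE mulrDr.
Qed.

Lemma dotZr a u x : dot u (a *: x) = a * dot u x.
Proof. by rewrite mulr_sumr; apply: eq_bigr => i _; rewrite mxE mulrCA. Qed.

Lemma dotBr u x y : dot u (x - y) = dot u x - dot u y.
Proof. by rewrite dotDr -scaleN1r dotZr mulN1r. Qed.

Lemma dotDl u v x : dot (u + v) x = dot u x + dot v x.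
Proof. by rewrite dotC dotDr !(dotC x). Qed.

Lemma dotBl u v x : dot (u - v) x = dot u x - dot v x.
Proof. by rewrite dotC dotBr !(dotC x). Qed.

Lemma dotZl a u x : dot (a *: u) x = a * dot u x.
Proof. by rewrite dotC dotZr dotC. Qed.

Lemma dot0l x : dot 0 x = 0.
Proof. by rewrite -(scale0r x) dotZl mul0r. Qed.

Lemma dot0r x : dot x 0 = 0.
Proof. by rewrite dotC dot0l. Qed.

Lemma dot_sumr (I : finType) u (f : I -> 'cV[R]_n) :
  dot u (\sum_k f k) = \sum_k dot u (f k).
Proof. exact: (big_morph (dot u) (dotDr u) (dot0r u)). Qed.

Lemma dot_suml (I : finType) u (f : I -> 'cV[R]_n) :
  dot (\sum_k f k) u = \sum_k dot (f k) u.
Proof. by rewrite dotC dot_sumr; apply: eq_bigr => k _; rewrite dotC. Qed.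

Lemma dot_delta u i : dot u (delta_mx i 0) = u i 0.
Proof.
rewrite /dot (bigD1 i)//= mxE !eqxx mulr1 big1 ?addr0// => j ji.
by rewrite mxE (negbTE ji) mulr0.
Qed.

Lemma dot_mulmx (B : 'M[R]_n) u x : dot u (B *m x) = dot (B^T *m u) x.
Proof. by rewrite -!dotE trmx_mul trmxK mulmxA. Qed.

Lemma quad_form1 u : quad_form 1%:M u = dot u u.
Proof. by rewrite /quad_form mulmx1 dotE. Qed.

Lemma quad_formE (A : 'M[R]_n) u : quad_form A u = dot u (A *m u).
Proof. by rewrite /quad_form -mulmxA dotE. Qed.

Lemma dot_ge0 x : 0 <= dot x x.
Proof. by apply: sumr_ge0 => i _; rewrite -expr2 sqr_ge0. Qed.

Lemma eucl_ge0 x : 0 <= eucl x.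
Proof. exact: sqrtr_ge0. Qed.

Lemma sqr_eucl x : eucl x ^+ 2 = dot x x.
Proof.
rewrite sqr_sqrtr; first by apply: eq_bigr => i _; rewrite expr2.
by apply: sumr_ge0 => i _; rewrite sqr_ge0.
Qed.

Lemma euclE x : eucl x = Num.sqrt (dot x x).
Proof. by rewrite -sqr_eucl sqrtr_sqr ger0_norm ?eucl_ge0. Qed.

Lemma eucl0 : eucl (0 : 'cV[R]_n) = 0.
Proof. by rewrite euclE dot0l sqrtr0. Qed.

Lemma eucl_le x (a : R) : 0 <= a -> (eucl x <= a) = (dot x x <= a ^+ 2).
Proof.
move=> a0; rewrite -sqr_eucl; apply/idP/idP => h.
  by rewrite lerXn2r// nnegrE ?eucl_ge0.
by rewrite -(@ler_pXn2r _ 2)// ?nnegrE ?eucl_ge0.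
Qed.

Lemma eucl_entry x i : `|x i 0| <= eucl x.
Proof.
rewrite -(@ler_pXn2r _ 2)// ?nnegrE ?eucl_ge0// sqr_eucl real_normK ?num_real//.
rewrite /dot (bigD1 i)//= -expr2 lerDl sumr_ge0// => j _.
by rewrite -expr2 sqr_ge0.
Qed.

Lemma eucl_eq0 x : eucl x = 0 -> x = 0.
Proof.
move=> x0; apply/colP => i; rewrite mxE; apply/eqP; rewrite -normr_le0.
by rewrite -x0 eucl_entry.
Qed.

Lemma cauchy_schwarz u x : `|dot u x| <= eucl u * eucl x.
Proof.
have key : dot u x ^+ 2 <= dot u u * dot x x.
  have [/eqP u0|u0] := boolP (dot u u == 0).
    have -> : u = 0 by apply: eucl_eq0; rewrite euclE u0 sqrtr0.
    by rewrite !dot0l expr0n mul0r.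
  have u1 : 0 < dot u u by rewrite lt_def u0 dot_ge0.
  have := dot_ge0 (dot u u *: x - dot u x *: u).
  rewrite dotBr !dotBl !dotZl !dotZr (dotC x u) => h.
  have : 0 <= dot u u * (dot u u * dot x x - dot u x ^+ 2) by nra.
  by rewrite pmulr_rge0// subr_ge0.
rewrite -(@ler_pXn2r _ 2) ?nnegrE ?mulr_ge0 ?eucl_ge0//.
by rewrite exprMn !sqr_eucl real_normK ?num_real.
Qed.

Lemma euclZ a x : eucl (a *: x) = `|a| * eucl x.
Proof.
by rewrite !euclE dotZl dotZr mulrA -expr2 sqrtrM ?sqr_ge0// sqrtr_sqr.
Qed.

Lemma euclN x : eucl (- x) = eucl x.
Proof. by rewrite -scaleN1r euclZ normrN1 mul1r. Qed.

Lemma eucl_le_sum x : eucl x <= \sum_i `|x i 0|.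
Proof.
have S0 : 0 <= \sum_i `|x i 0| by apply: sumr_ge0.
rewrite eucl_le// expr2 mulr_suml; apply: ler_sum => i _.
apply: (le_trans (ler_norm _)); rewrite normrM; apply: ler_wpM2l => //.
by rewrite (bigD1 i)//= lerDl sumr_ge0.
Qed.

Lemma euclD x y : eucl (x + y) <= eucl x + eucl y.
Proof.
rewrite eucl_le ?addr_ge0 ?eucl_ge0// dotDr !dotDl sqrrD !sqr_eucl (dotC y x).
have := ler_norm (dot x y); have := cauchy_schwarz x y; lra.
Qed.

Lemma euclBC x y : eucl (x - y) = eucl (y - x).
Proof. by rewrite -euclN opprB. Qed.

Lemma normmx_le_eucl x : `|x| <= eucl x.
Proof.
rewrite /Num.norm/= mx_normrE; apply/bigmax_leP; split=> [|[i j] _].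
  exact: eucl_ge0.
by rewrite ord1 eucl_entry.
Qed.

Lemma entry_le_normmx x i : `|x i 0| <= `|x|.
Proof.
rewrite [leRHS]/Num.norm/= mx_normrE.
by apply: (@bigmax_sup _ _ _ _ (i, 0)).
Qed.

Lemma eucl_le_normmx x : eucl x <= n%:R * `|x|.
Proof.
apply: (le_trans (eucl_le_sum x)).
have -> : n%:R * `|x| = \sum_(i < n) `|x| by rewrite sumr_const card_ord mulr_natl.
by apply: ler_sum => i _; exact: entry_le_normmx.
Qed.

End euclidean_space.

Section square_root.
Context {R : realType}.

Lemma interpolation (s : seq R) (g : R -> R) :
  exists p : {poly R}, forall x, x \in s -> p.[x] = g x.
Proof.
elim: s => [|a s [p hp]]; first by exists 0.
case: (boolP (a \in s)) => [as_|nas].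
  by exists p => x; rewrite inE => /orP[/eqP->|]; [exact: hp|exact: hp].
have [w [w_s w_a]] : exists w : {poly R},
    (forall x, x \in s -> w.[x] = 0) /\ w.[a] != 0.
  exists (\prod_(y <- s) ('X - y%:P)); split => [x xs|].
    by apply/eqP; rewrite -/(root _ x) root_prod_XsubC.
  by rewrite -/(root _ a) root_prod_XsubC.
exists (p + ((g a - p.[a]) / w.[a]) *: w) => x; rewrite inE hornerD hornerZ.
case/orP => [/eqP->|xs]; first by rewrite divfK// addrC subrK.
by rewrite (w_s x xs) mulr0 addr0 hp.
Qed.

Import complex spectral sesquilinear.

Local Notation C := (complex R).
Local Notation toC := (real_complex R).

Lemma symmetric_diagonalizable n (A : 'M[R]_n) : A^T = A ->
  exists P : 'M[C]_n, exists d : 'rV[R]_n, P \in unitmx /\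
   map_mx toC A = invmx P *m diag_mx (map_mx toC d) *m P.
Proof.
move=> sA.
pose Ac := map_mx toC A.
have hA : Ac \is hermitianmx _ false Num.conj.
  apply: realsym_hermsym.
    apply/is_hermitianmxP; rewrite /= expr0 scale1r.
    by apply/matrixP => i j; rewrite !mxE -{1}sA mxE.
  by apply/mxOverP => i j; rewrite mxE; apply/CrealP; exact: conjc_real.
exists (spectralmx Ac), (map_mx (@complex.Re R) (spectral_diag Ac)); split.
  exact: spectral_unit.
rewrite -map_mx_comp map_mx_id_in.
  by move/hermitian_normalmx/orthomx_spectralP : hA.
move=> i j; have /mxOverP/(_ i j) := hermitian_spectral_diag_real hA.
by move/RRe_real.
Qed.

Lemma left_eigen_gt0 n (A : 'M[R]_n) (v : 'rV[C]_n) (l : R) :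
  posdef A -> v != 0 -> v *m map_mx toC A = toC l *: v -> 0 < l.
Proof.
move=> [_ pA] v0 vA.
have part (f : C -> R) : {morph f : x y / x + y} -> f 0 = 0 ->
    (forall x y, f (x * toC y) = f x * y) -> map_mx f v != 0 -> 0 < l.
  move=> fD f0 fM w0; set w := map_mx f v in w0.
  have wA : w *m A = l *: w.
    apply/rowP => j; move/rowP/(_ j)/(congr1 f) : vA; rewrite !mxE.
    rewrite [toC l * _]mulrC fM mulrC => <-; rewrite (big_morph f fD f0).
    by apply: eq_bigr => i _; rewrite !mxE fM.
  have := pA w^T; rewrite trmx_eq0 => /(_ w0).
  rewrite /quad_form trmxK wA -scalemxAl mxE.
  have : 0 <= (w *m w^T) 0 0.
    by rewrite mxE sumr_ge0// => i _; rewrite [w^T _ _]mxE -expr2 sqr_ge0.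
  by move=> ww; nra.
case: (eqVneq (map_mx (@complex.Re R) v) 0) => [re0|]; last first.
  by apply: part => // [[x1 x2] [y1 y2]|[x1 x2] y] //=; rewrite mulr0 subr0.
case: (eqVneq (map_mx (@complex.Im R) v) 0) => [im0|]; last first.
  by apply: part => // [[x1 x2] [y1 y2]|[x1 x2] y] //=; rewrite mulr0 add0r.
case/eqP: v0; apply/rowP => i.
move/rowP/(_ i): re0; move/rowP/(_ i): im0; rewrite !mxE.
by case: (v 0 i) => x y /= -> ->.
Qed.

Lemma trmx_horner n (A : 'M[R]_n.+1) (p : {poly R}) : A^T = A ->
  (horner_mx A p)^T = horner_mx A p.
Proof.
move=> sA; elim/poly_ind: p => [|p c IH]; first by rewrite raddf0 trmx0.
rewrite rmorphD rmorphM/= horner_mx_X horner_mx_C raddfD/= trmx_mul IH sA.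
rewrite tr_scalar_mx; congr (_ + _).
by rewrite -{1 4}(horner_mx_X A) mulmxE -!rmorphM/= mulrC.
Qed.

(** The square root is a polynomial in [A] that interpolates the square root
    on the spectrum, hence symmetric; interpolating the fourth root and
    squaring makes it positive as well. *)
Lemma posdef_sqrt_exists n (A : 'M[R]_n) : posdef A ->
  exists B, possemidef B /\ B *m B = A.
Proof.
case: n A => [|n] A pA.
  exists A; split; last by apply/matrixP => -[].
  by split=> [|u]; [exact: pA.1|rewrite /quad_form mxE big_ord0].
have [P [d [uP Ad]]] := symmetric_diagonalizable pA.1.
have d_gt0 i : 0 < d 0 i.
  apply: (@left_eigen_gt0 _ A (row i P)) => //.
    apply/negP => /eqP r0; have : row i (P *m invmx P) = 0.
      by rewrite row_mul r0 mul0mx.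
    rewrite mulmxV// => /rowP/(_ i); rewrite !mxE eqxx => /eqP.
    by rewrite oner_eq0.
  by rewrite -row_mul Ad !mulmxA mulmxV// mul1mx row_mul row_diag_mx
    -scalemxAl -rowE mxE.
have [q hq] := interpolation [seq d 0 i | i <- enum 'I_n.+1]
  (fun x => Num.sqrt (Num.sqrt x)).
pose W := horner_mx A q.
have symW : W^T = W by apply: trmx_horner; exact: pA.1.
exists (W *m W); split.
  split=> [|u]; first by rewrite trmx_mul symW.
  rewrite /quad_form mulmxA -mulmxA -{1}symW -trmx_mul mxE sumr_ge0// => i _.
  by rewrite mxE -expr2 sqr_ge0.
have -> : W *m W *m (W *m W) = horner_mx A (q ^+ 4).
  by rewrite !rmorphXn/= -/W !exprS expr0 mulr1 !mulmxE !mulrA.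
apply: (map_mx_inj (f := toC)).
rewrite map_horner_mx Ad horner_mx_uconjC// horner_mx_diag.
congr (_ *m diag_mx _ *m _); apply/rowP => i; rewrite !mxE horner_map/=.
congr (toC _); rewrite horner_exp hq; last first.
  by apply/mapP; exists i => //; rewrite mem_enum.
by rewrite -[4%N]/(2 * 2)%N exprM !sqr_sqrtr ?sqrtr_ge0// ltW.
Qed.

Lemma sqrtmxP n (A : 'M[R]_n) : posdef A ->
  [/\ (sqrtmx A)^T = sqrtmx A, sqrtmx A *m sqrtmx A = A & sqrtmx A \in unitmx].
Proof.
move=> pA; have [B0 hB0] := posdef_sqrt_exists pA.
have : [set B | possemidef B /\ B *m B = A] (sqrtmx A) by apply: xgetI hB0.
set B := sqrtmx A => -[[symB _] BB]; split=> //.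
rewrite -row_free_unit; apply/row_freeP.
have : A \in unitmx.
  rewrite -row_free_unit -kermx_eq0; apply/eqP/row_matrixP => i.
  rewrite row0; apply/eqP/negP => /negP nz.
  have := pA.2 (row i (kermx A))^T.
  rewrite trmx_eq0 => /(_ nz); rewrite /quad_form trmxK -mulmxA mulmxA.
  by rewrite -row_mul mulmx_ker row0 mul0mx mxE ltxx.
move=> uA; exists (B *m invmx A); rewrite mulmxA BB mulmxV//.
Qed.
End square_root.

Section elementary_estimates.
Context {R : realType}.
Implicit Types (x c r : R).

(** The mean value theorem between 0 and [x], for either sign of [x]. *)
Lemma mvt0 (f df : R -> R) x :
  (forall y : R, `|y| <= `|x| -> is_derive y 1 f (df y)) ->
  exists2 y, `|y| <= `|x| & f x - f 0 = df y * x.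
Proof.
move=> fdf.
have cont a b : (forall y, y \in `[a, b] -> `|y| <= `|x|) ->
    {within `[a, b], continuous f}.
  move=> h; apply: derivable_within_continuous => y /h yx.
  by have [] := fdf y yx.
have [x0|x0] := leP 0 x.
  have h y : y \in `[0, x] -> `|y| <= `|x|.
    by rewrite in_itv/= => /andP[y0 yx]; rewrite !ger0_norm.
  have [y yI ->] := MVT_segment x0 (fun y yI => fdf y (h y (subset_itv_oo_cc yI))) (cont _ _ h).
  by exists y; [exact: h|rewrite subr0].
have h y : y \in `[x, 0] -> `|y| <= `|x|.
  rewrite in_itv/= => /andP[xy y0]; rewrite !ler0_norm ?lerN2//.
  exact: le_trans xy y0.
have [y yI e] := MVT_segment (ltW x0) (fun y yI => fdf y (h y (subset_itv_oo_cc yI))) (cont _ _ h).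
exists y; first exact: h.
by rewrite -[LHS]opprB e sub0r mulrN opprK.
Qed.

Lemma norm_sin_le x : `|sin x| <= `|x|.
Proof.
have [y _] := @mvt0 sin cos x (fun y _ => is_derive_sin y).
rewrite sin0 subr0 => ->; rewrite normrM ler_piMl//; exact: cos_max.
Qed.

Lemma norm_cos1_le x : `|cos x - 1| <= x ^+ 2.
Proof.
have [y yx] := @mvt0 cos (fun y => - sin y) x (fun y _ => is_derive_cos y).
rewrite cos0 => ->; rewrite normrM normrN -(real_normK (num_real x)) expr2.
by rewrite ler_wpM2r// (le_trans (norm_sin_le _)).
Qed.

Lemma norm_sinB_le x : `|sin x - x| <= `|x| ^+ 3.
Proof.
have [y yx] := @mvt0 (fun y => sin y - y) (fun y => cos y - 1) x.
rewrite sin0 !subr0 => ->; rewrite normrM [leRHS]exprSr ler_wpM2r//.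
apply: (le_trans (norm_cos1_le y)); rewrite -(real_normK (num_real y)).
by rewrite lerXn2r ?nnegrE.
Qed.

Lemma norm_cosB_le x : `|cos x - 1 + x ^+ 2 / 2| <= `|x| ^+ 4.
Proof.
have [|y yx] := @mvt0 (fun y => cos y - 1 + y ^+ 2 / 2) (fun y => y - sin y) x.
  move=> y _; apply: is_derive_eq.
  by rewrite /GRing.scale/=; lra.
rewrite cos0 expr0n/= mul0r addr0 !subrr subr0 => ->.
rewrite normrM [leRHS]exprSr ler_wpM2r// distrC (le_trans (norm_sinB_le y))//.
by rewrite lerXn2r ?nnegrE.
Qed.

Lemma is_derive_addl (a y : R) : is_derive y 1 (fun y => a + y) 1.
Proof.
have := is_deriveD (is_derive_cst a y (1 : R)) (is_derive_id y (1 : R)).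
by rewrite add0r.
Qed.

Lemma is_derive_ln1D (y : R) : 0 < 1 + y ->
  is_derive y 1 (fun y => ln (1 + y)) (1 + y)^-1.
Proof.
move=> y1; rewrite -[X in is_derive _ _ _ X]mulr1.
apply: (@is_derive1_comp R (@ln R) (fun y => 1 + y)); first exact: is_derive1_ln.
exact: is_derive_addl.
Qed.

Lemma inv1D_le (y : R) : `|y| <= 2^-1 -> 0 < (1 + y)^-1 <= 2.
Proof.
rewrite ler_norml => /andP[y1 y2]; have y0 : 0 < 1 + y by lra.
by rewrite invr_gt0 y0/= -[leRHS]invrK lef_pV2 ?posrE ?invr_gt0//; lra.
Qed.

Lemma norm_ln1DB_le r : `|r| <= 2^-1 -> `|ln (1 + r) - r| <= 2 * `|r| ^+ 2.
Proof.
move=> r1.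
have [|y yr] := @mvt0 (fun y => ln (1 + y) - y) (fun y => - (y * (1 + y)^-1)) r.
  move=> y yr; have /inv1D_le/andP[y0 y1] := le_trans yr r1.
  have := y0; rewrite invr_gt0 => y2.
  have -> : - (y * (1 + y)^-1) = (1 + y)^-1 - 1.
    by field; rewrite gt_eqF.
  apply: is_deriveB; exact: is_derive_ln1D.
rewrite addr0 ln1 !subr0 => ->.
have /inv1D_le/andP[y0 y1] := le_trans yr r1.
rewrite normrM normrN normrM (gtr0_norm y0) expr2 mulrA ler_wpM2r//.
by rewrite mulrC ler_pM// ltW.
Qed.

Lemma norm_ln1DBD_le r : `|r| <= 2^-1 ->
  `|ln (1 + r) - r + r ^+ 2 / 2| <= 2 * `|r| ^+ 3.
Proof.
move=> r1.
have [|y yr] := @mvt0 (fun y => ln (1 + y) - y + y ^+ 2 / 2)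
    (fun y => y ^+ 2 * (1 + y)^-1) r.
  move=> y yr; have /inv1D_le/andP[y0 y1] := le_trans yr r1.
  have := y0; rewrite invr_gt0 => y2.
  have -> : y ^+ 2 * (1 + y)^-1 = ((1 + y)^-1 - 1) + y.
    by field; rewrite gt_eqF.
  apply: is_deriveD; first by apply: is_deriveB; exact: is_derive_ln1D.
  by apply: is_derive_eq; rewrite /GRing.scale/=; lra.
rewrite addr0 ln1 !subr0 expr0n/= mul0r addr0 subr0 => ->.
have /inv1D_le/andP[y0 y1] := le_trans yr r1.
rewrite normrM normrM (gtr0_norm y0) [_ ^+ 3]exprSr mulrA ler_wpM2r//.
rewrite mulrC ler_pM ?(ltW y0)// normrX lerXn2r ?nnegrE//.
Qed.

Lemma ln_le_sqrt r : 0 < r -> ln r <= 2 * (Num.sqrt r - 1).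
Proof.
move=> r0; have s0 : 0 < Num.sqrt r by rewrite sqrtr_gt0.
have -> : ln r = 2 * ln (Num.sqrt r).
  by rewrite mulr_natl -lnXn// sqr_sqrtr// ltW.
rewrite ler_pM2l//.
have := @le_ln1Dx R (Num.sqrt r - 1); rewrite (addrC 1) subrK; apply; lra.
Qed.

Lemma expR_sub1_le c : `|expR c - 1| <= `|c| * expR `|c|.
Proof.
have [y yc] := @mvt0 expR expR c (fun y _ => is_derive_expR y).
rewrite expR0 => ->; rewrite normrM mulrC ler_wpM2l// ger0_norm ?expR_ge0//.
by rewrite ler_expR (le_trans _ yc)// ler_norm.
Qed.

Lemma norm_expR1DB_le c : `|expR c - 1 - c| <= c ^+ 2 * expR `|c|.
Proof.
have [|y yc] := @mvt0 (fun y => expR y - 1 - y) (fun y => expR y - 1) c.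
  by move=> y _; apply: is_derive_eq; rewrite subr0.
rewrite expR0 !subrr !subr0 => ->; rewrite normrM.
rewrite -(real_normK (num_real c)) expr2 mulrAC ler_wpM2r//.
by rewrite (le_trans (expR_sub1_le _))// ler_pM// ?expR_ge0// ler_expR.
Qed.

Lemma cos_lip (x y : R) : `|cos x - cos y| <= `|x - y|.
Proof.
have [|z _] := @mvt0 (fun z => cos (y + z)) (fun z => - sin (y + z)) (x - y).
  move=> z _; rewrite -[X in is_derive _ _ _ X]mulr1.
  apply: (@is_derive1_comp R (@cos R) (fun z => y + z)).
  exact: is_derive_addl.
rewrite addr0 (addrC y) subrK => ->.
by rewrite normrM normrN ler_piMl// sin_max.
Qed.

Lemma sin_expand (x y : R) : `|x| <= 2^-1 -> `|y| <= 2^-1 ->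
  `|x - y| <= 2 * `|sin x - sin y|.
Proof.
wlog xy : x y / x <= y => [h|].
  have [/h|/ltW yx hx hy] := leP x y; first exact.
  by rewrite distrC (distrC (sin x)) h.
rewrite ler_norml => /andP[x1 x2]; rewrite ler_norml => /andP[y1 y2].
have [|z] := @MVT_segment R sin cos x y xy (fun z _ => is_derive_sin z).
  by apply: continuous_subspaceT => z; exact: continuous_sin.
rewrite in_itv/= => /andP[xz zy] e.
rewrite distrC (distrC (sin x)) e normrM mulrA ler_peMl//.
have : `|cos z - 1| <= (2^-1) ^+ 2.
  apply: (le_trans (norm_cos1_le z)); rewrite -(real_normK (num_real z)).
  by rewrite lerXn2r ?nnegrE// ler_norml; lra.
by have := ler_norm (cos z); rewrite ler_norml => ? /andP[]; lra.
Qed.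

End elementary_estimates.

Section bernoulli_weights.
Context {R : realType}.

Definition bernoulli_weight (E : finType) (th : E -> R) (g : {ffun E -> bool}) :=
  \prod_e (if g e then th e else 1 - th e).

Lemma bernoulli_weight_prod (E : finType) (th : E -> R) (phi : E -> bool -> R) :
  \sum_g bernoulli_weight th g * \prod_e phi e (g e) =
  \prod_e (th e * phi e true + (1 - th e) * phi e false).
Proof.
transitivity (\prod_e \sum_(b : bool) (if b then th e else 1 - th e) * phi e b).
  by rewrite bigA_distr_bigA; apply: eq_bigr => g _; rewrite big_split.
by apply: eq_bigr => e _; rewrite big_bool.
Qed.

Lemma sum_bernoulli_weight (E : finType) (th : E -> R) :
  \sum_g bernoulli_weight th g = 1.
Proof.
transitivity (\sum_g bernoulli_weight th g * \prod_(e : E) 1).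
  by apply: eq_bigr => g _; rewrite big1_eq mulr1.
rewrite (bernoulli_weight_prod th (fun _ _ => 1)).
by rewrite big1// => e _; rewrite !mulr1 addrC subrK.
Qed.

Lemma bernoulli_weight_ge0 (E : finType) (th : E -> R) g :
  (forall e, 0 <= th e <= 1) -> 0 <= bernoulli_weight th g.
Proof.
move=> h; apply: prodr_ge0 => e _; have /andP[h0 h1] := h e.
by case: ifP => // _; rewrite subr_ge0.
Qed.

Lemma bernoulli_weight_cov (E : finType) (th : E -> R) (e1 e2 : E) :
  (forall e, 0 <= th e <= 1) ->
  \sum_g bernoulli_weight th g *
     (((g e1)%:R - th e1) * ((g e2)%:R - th e2)) <= (e1 == e2)%:R.
Proof.
move=> h01.
pose phi (e : E) (b : bool) := (if e == e1 then b%:R - th e else 1) *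
  (if e == e2 then b%:R - th e else 1).
have phiE (g : {ffun E -> bool}) : \prod_e phi e (g e) = ((g e1)%:R - th e1) * ((g e2)%:R - th e2).
  by rewrite big_split/= -!big_mkcond/= !big_pred1_eq.
under eq_bigr do rewrite -phiE.
rewrite bernoulli_weight_prod (bigD1 e1)//= {1 2}/phi eqxx.
case: (eqVneq e1 e2) => [e12|e12].
  rewrite big1 => [|e ne].
    by rewrite mulr1/= mulr1n mulr0n; have /andP[h0 h1] := h01 e1; nra.
  by rewrite /phi -e12 (negbTE ne) !mulr1 addrC subrK.
by rewrite [X in X * _](_ : _ = 0) ?mul0r//= mulr1n mulr0n; ring.
Qed.

Lemma bernoulli_weight_var (I : finType) (m : nat) (th : I -> R) (i : I) :
  (forall i, 0 <= th i <= 1) ->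
  \sum_g bernoulli_weight (fun e : I * 'I_m => th e.1) g *
    (\sum_(l < m) ((g (i, l))%:R - th i)) ^+ 2 <= m%:R.
Proof.
move=> h01.
have -> : m%:R = \sum_(l < m) \sum_(l' < m) (((i, l) == (i, l')))%:R :> R.
  rewrite -[m in LHS]card_ord -sumr_const; apply: eq_bigr => l _.
  rewrite (bigD1 l)//= eqxx big1 ?addr0// => l' ne.
  by rewrite xpair_eqE eqxx/= eq_sym (negbTE ne).
under eq_bigr => g _.
  rewrite expr2 mulr_suml mulr_sumr.
  under eq_bigr => l _ do rewrite mulr_sumr mulr_sumr.
  over.
rewrite exchange_big/=; apply: ler_sum => l _.
rewrite exchange_big/=; apply: ler_sum => l' _.
exact: (@bernoulli_weight_cov _ (fun e : I * 'I_m => th e.1)).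
Qed.

End bernoulli_weights.

Section trigonometric_approximation.
Context {R : realType} {n : nat}.
Implicit Types (p q f : 'cV[R]_n -> R) (x y : 'cV[R]_n).

Definition trigpoly p := exists s : seq (R * R * 'cV[R]_n),
  forall x, p x = \sum_(t <- s) t.1.1 * cos (t.1.2 + dot t.2 x).

Lemma trigpoly_ext p q : (forall x, p x = q x) -> trigpoly p -> trigpoly q.
Proof. by move=> pq [s hs]; exists s => x; rewrite -pq. Qed.

Lemma trigpoly_cos a al u : trigpoly (fun x => a * cos (al + dot u x)).
Proof. by exists [:: (a, al, u)] => x; rewrite big_seq1. Qed.

Lemma trigpoly_cst a : trigpoly (fun=> a).
Proof.
apply: trigpoly_ext (trigpoly_cos a 0 0) => x.
by rewrite dot0l addr0 cos0 mulr1.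
Qed.

Lemma trigpolyD p q : trigpoly p -> trigpoly q -> trigpoly (fun x => p x + q x).
Proof.
by move=> [s hs] [t ht]; exists (s ++ t) => x; rewrite big_cat hs ht.
Qed.

Lemma trigpoly_sum (I : Type) (r : seq I) (F : I -> 'cV[R]_n -> R) :
  (forall i, trigpoly (F i)) -> trigpoly (fun x => \sum_(i <- r) F i x).
Proof.
move=> hF; elim: r => [|i r IH].
  by apply: trigpoly_ext (trigpoly_cst 0) => x; rewrite big_nil.
by apply: trigpoly_ext (trigpolyD (hF i) IH) => x; rewrite big_cons.
Qed.

(** Product-to-sum formula. *)
Lemma trigpolyM p q : trigpoly p -> trigpoly q -> trigpoly (fun x => p x * q x).
Proof.
move=> [s hs] [t ht].
pose F (i j : R * R * 'cV[R]_n) x : R :=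
  (i.1.1 * j.1.1 / 2) * cos (i.1.2 + j.1.2 + dot (i.2 + j.2) x) +
  (i.1.1 * j.1.1 / 2) * cos (i.1.2 - j.1.2 + dot (i.2 - j.2) x).
have tF i j : trigpoly (F i j) by apply: trigpolyD; exact: trigpoly_cos.
have := trigpoly_sum s (fun i => trigpoly_sum t (tF i)).
apply: trigpoly_ext => x; rewrite hs ht mulr_suml; apply: eq_bigr => i _.
rewrite mulr_sumr; apply: eq_bigr => j _; rewrite /F dotDl dotBl.
have -> : i.1.2 + j.1.2 + (dot i.2 x + dot j.2 x) =
  (i.1.2 + dot i.2 x) + (j.1.2 + dot j.2 x) by ring.
have -> : i.1.2 - j.1.2 + (dot i.2 x - dot j.2 x) =
  (i.1.2 + dot i.2 x) - (j.1.2 + dot j.2 x) by ring.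
by rewrite cosD cosB; field; rewrite ?pnatr_eq0.
Qed.

Lemma trigpoly_prod (I : finType) (F : I -> 'cV[R]_n -> R) :
  (forall i, trigpoly (F i)) -> trigpoly (fun x => \prod_i F i x).
Proof.
move=> hF; suff h r : trigpoly (fun x => \prod_(i <- r) F i x) by exact: h.
elim: r => [|i r IH].
  by apply: trigpoly_ext (trigpoly_cst 1) => x; rewrite big_nil.
by apply: trigpoly_ext (trigpolyM (hF i) IH) => x; rewrite big_cons.
Qed.

Lemma cube_uniform_continuity f (B eta : R) : continuous f -> 0 < eta ->
  exists2 del : R, 0 < del & forall x y : 'cV[R]_n, (forall i, `|x i 0| <= B) ->
    (forall i, `|x i 0 - y i 0| <= del) -> `|f x - f y| <= eta.
Proof.
move=> cf eta0.
have cK : compact [set v : 'rV[R]_n | forall i, `[- B, B]%classic (v ord0 i)].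
  by apply: (rV_compact (A := fun=> `[- B, B]%classic)) => i; exact: segment_compact.
have e_near : \forall d \near (0^'+ : set_system R),
    [set v : 'rV[R]_n | forall i, `[- B, B]%classic (v ord0 i)] `<=`
    [set v : 'rV[R]_n | forall y : 'cV[R]_n, (forall i, `|v ord0 i - y i 0| <= d) ->
             `|f v^T - f y| <= eta].
  have /compact_near_coveringP := cK; apply.
  move=> v _.
  have /cvg_ballP/(_ (eta / 2)) : f x @[x --> v^T] --> f v^T by exact: cf.
  rewrite divr_gt0// => /(_ isT)/nbhs_ballP[e /= e0 he].
  near=> w d => y /= hy.
  have near_e (z : 'cV[R]_n) : (forall i, `|v ord0 i - z i 0| < e) ->
      `|f v^T - f z| < eta / 2.
    move=> h; apply: he; split=> // i j.
    by rewrite ord1 /ball/= mxE.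
  have wv i : `|v ord0 i - w ord0 i| < e / 2.
    have : ball v (e / 2) w by near: w; apply: nbhsx_ballx; rewrite divr_gt0.
    by move=> [_ h]; exact: h.
  have dE : d < e / 2 by near: d; apply: nbhs_right_lt; rewrite divr_gt0.
  have h1 : `|f v^T - f w^T| < eta / 2.
    by apply: near_e => i; rewrite mxE (lt_trans (wv i))//; lra.
  have h2 : `|f v^T - f y| < eta / 2.
    apply: near_e => i; rewrite -(subrKA (w ord0 i)).
    apply: (le_lt_trans (ler_normD _ _)).
    have := wv i; have := hy i; lra.
  rewrite -(subrKA (f v^T)) (le_trans (ler_normD _ _))// distrC.
  by move: h1 h2; lra.
have : \forall d \near 0^'+ , 0 < d :> R by exact: nbhs_right_gt.
move=> d_near.
have [d [d0 hd]] := @filter_ex _ (0^'+ : set_system R) _ _ (filterI d_near e_near).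
exists d => // x y xB xy; rewrite -(trmxK x); apply: hd.
  by move=> i /=; rewrite mxE in_itv/= -ler_norml.
by move=> i; rewrite mxE.
Unshelve. all: by end_near. Qed.

(** A probabilistic version of Bernstein's argument.  With
    [th_i x = (1 + sin (x_i / 2B)) / 2], draw [m] independent Bernoulli
    variables of parameter [th_i x] for each coordinate; their frequencies are
    close to [th_i x], and [x] is a continuous function of [th x] on the cube.
    The expectation of [f] at a point of the cube recovered from the
    frequencies is therefore close to [f x]; it is a trigonometric polynomial
    in [x] because each weight is a polynomial in the [th_i x]. *)
Lemma trigpoly_approx f (B M0 eta : R) :
  continuous f -> (forall x, `|f x| <= M0) -> 0 < B -> 0 < eta ->
  exists p, [/\ trigpoly p, forall x, `|p x| <= M0 &
    forall x, (forall i, `|x i 0| <= B) -> `|p x - f x| <= eta].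
Proof.
move=> cf fM B0 eta0.
have [del del0 hdel] := cube_uniform_continuity B cf (divr_gt0 eta0 (ltr0Sn R 1)).
pose c : R := (2 * B)^-1.
pose th (i : 'I_n) x : R := (1 + sin (c * x i 0)) / 2.
have th01 x i : 0 <= th i x <= 1.
  by rewrite /th; have := sin_geN1 (c * x i 0); have := sin_le1 (c * x i 0); lra.
have th_trig i : trigpoly (th i).
  apply: trigpoly_ext (trigpolyD (trigpoly_cst 2^-1)
    (trigpoly_cos 2^-1 (- (pi / 2)) (c *: delta_mx i 0))) => x.
  by rewrite dotZl dotC dot_delta (addrC (- _)) cosBpihalf /th mulrDl mul1r (mulrC (sin _)).
have th_inj x y i : `|x i 0| <= B -> `|y i 0| <= B ->
    `|x i 0 - y i 0| <= 8 * B * `|th i x - th i y|.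
  have c0 : 0 < c by rewrite invr_gt0 mulr_gt0.
  have cB : c * B = 2^-1 by rewrite /c invfM mulfVK// gt_eqF.
  have small z : `|z| <= B -> `|c * z| <= 2^-1.
    by move=> zB; rewrite -cB normrM (gtr0_norm c0) ler_pM2l.
  move=> /small xB /small yB; have := sin_expand xB yB.
  rewrite -mulrBr normrM (gtr0_norm c0) => h.
  have -> : th i x - th i y = 2^-1 * (sin (c * x i 0) - sin (c * y i 0)).
    by rewrite /th; lra.
  rewrite normrM ger0_norm//.
  have -> : `|x i 0 - y i 0| = 2 * B * (c * `|x i 0 - y i 0|).
    by rewrite mulrA -(mulrA 2) (mulrC B) cB mulfV ?mul1r.
  by have := ler_wpM2l (mulr_ge0 (ler0n R 2) (ltW B0)) h; lra.
have [e e0 eE] : exists2 e, 0 < e & 16 * B * e = del.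
  have B16 : 0 < 16 * B by rewrite mulr_gt0.
  by exists (del / (16 * B)); [rewrite divr_gt0|rewrite mulrC divfK ?gt_eqF].
pose m := (Num.truncn (4 * M0 * n%:R / (e ^+ 2 * eta))).+1.
pose t (g : {ffun 'I_n * 'I_m -> bool}) i : R := m%:R^-1 * \sum_l (g (i, l))%:R.
(* points of the cube with prescribed approximate frequencies *)
have pick (g : {ffun 'I_n * 'I_m -> bool}) : exists y : 'cV[R]_n,
    forall x, (forall i, `|x i 0| <= B) -> (forall i, `|t g i - th i x| <= e) ->
    (forall i, `|y i 0| <= B) /\ (forall i, `|t g i - th i y| <= e).
  have [[y hy]|no] := pselect (exists y : 'cV[R]_n,
    (forall i, `|y i 0| <= B) /\ (forall i, `|t g i - th i y| <= e)).
    by exists y.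
  by exists 0 => x h1 h2; case: no; exists x.
have [Y hY] := choice pick.
pose w x := bernoulli_weight (fun j : 'I_n * 'I_m => th j.1 x).
exists (fun x => \sum_g w x g * f (Y g)); split.
- apply: trigpoly_sum => g; apply: trigpolyM; last exact: trigpoly_cst.
  apply: trigpoly_prod => j; case: (g j); first exact: th_trig.
  apply: trigpoly_ext (trigpolyD (trigpoly_cst 1)
    (trigpolyM (trigpoly_cst (-1)) (th_trig j.1))) => x.
  by rewrite mulN1r.
- move=> x; apply: (le_trans (ler_norm_sum _ _ _)).
  rewrite -[leRHS]mul1r -(sum_bernoulli_weight (fun j : 'I_n * 'I_m => th j.1 x)).
  rewrite mulr_suml; apply: ler_sum => g _.
  rewrite normrM ger0_norm ?ler_wpM2l// ?bernoulli_weight_ge0//.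
move=> x xB.
have var i : \sum_g w x g * (t g i - th i x) ^+ 2 <= m%:R^-1.
  have m0 : 0 < m%:R :> R by rewrite ltr0n.
  have := bernoulli_weight_var m i (th01 x).
  rewrite -(@ler_pM2l _ (m%:R^-1 ^+ 2)) ?exprn_gt0 ?invr_gt0//.
  rewrite expr2 -[X in _ <= X]mulrA mulVf ?gt_eqF// mulr1; apply: le_trans.
  rewrite -expr2 mulr_sumr; apply: ler_sum => g _.
  rewrite [leRHS]mulrCA ler_wpM2l ?bernoulli_weight_ge0// -exprMn sumrB sumr_const.
  by rewrite card_ord mulrBr -(mulr_natl (th i x)) mulKf ?gt_eqF.
have M00 : 0 <= M0 by rewrite (le_trans _ (fM x)).
have C0 : 0 <= 2 * M0 / e ^+ 2 by apply: divr_ge0; [exact: mulr_ge0|exact: sqr_ge0].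
have near g : `|f (Y g) - f x| <=
    eta / 2 + 2 * M0 / e ^+ 2 * \sum_i (t g i - th i x) ^+ 2.
  have S0 : 0 <= \sum_i (t g i - th i x) ^+ 2 by apply: sumr_ge0 => i _; exact: sqr_ge0.
  have [ok|] := boolP [forall i, `|t g i - th i x| <= e].
    have [Yc Yt] := hY g x xB (fun i => forallP ok i).
    rewrite -[leLHS]addr0 lerD// ?(mulr_ge0 C0)//.
    rewrite distrC hdel// => i; rewrite (le_trans (th_inj _ _ i (xB i) (Yc i)))//.
    have : `|th i x - th i (Y g)| <= 2 * e.
      rewrite -(subrKA (t g i)) (le_trans (ler_normD _ _))// distrC.
      by have := forallP ok i; have := Yt i; move=> /=; lra.
    rewrite -(@ler_pM2l _ (8 * B)) ?mulr_gt0// => /le_trans; apply.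
    by rewrite -eE; lra.
  rewrite negb_forall => /existsP[i]; rewrite -ltNge => ti.
  apply: (@le_trans _ _ (2 * M0)).
    by rewrite (le_trans (ler_normB _ _))//; have := fM (Y g); have := fM x; lra.
  rewrite -[leLHS]add0r lerD//; first by rewrite divr_ge0// ltW.
  rewrite -mulrA ler_peMr ?mulr_ge0//.
  rewrite mulrC ler_pdivlMr ?exprn_gt0// mul1r (bigD1 i)//=.
  rewrite -[leLHS]addr0 lerD//; last by apply: sumr_ge0 => j _; exact: sqr_ge0.
  by rewrite -[leRHS](real_normK (num_real _)) lerXn2r// ?nnegrE// ltW.
have -> : f x = \sum_g w x g * f x.
  by rewrite -mulr_suml sum_bernoulli_weight mul1r.
rewrite -sumrB (le_trans (ler_norm_sum _ _ _))//.
apply: (@le_trans _ _ (\sum_g w x g *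
    (eta / 2 + 2 * M0 / e ^+ 2 * \sum_i (t g i - th i x) ^+ 2))).
  apply: ler_sum => g _; rewrite -mulrBr normrM ger0_norm ?ler_wpM2l//;
  exact: bernoulli_weight_ge0.
under eq_bigr do rewrite mulrDr.
rewrite big_split/= -mulr_suml sum_bernoulli_weight mul1r.
have -> : \sum_g w x g * (2 * M0 / e ^+ 2 * \sum_i (t g i - th i x) ^+ 2) =
    2 * M0 / e ^+ 2 * \sum_i \sum_g w x g * (t g i - th i x) ^+ 2.
  rewrite exchange_big/= mulr_sumr; apply: eq_bigr => g _.
  by rewrite mulrCA mulr_sumr.
have S : \sum_i \sum_g w x g * (t g i - th i x) ^+ 2 <= n%:R / m%:R.
  rewrite mulr_natl -[n in leRHS]card_ord -sumr_const; apply: ler_sum => i _.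
  exact: var.
have m1 : 4 * M0 * n%:R / (e ^+ 2 * eta) <= m%:R.
  by rewrite ltW// truncnS_gt.
have m0 : 0 < m%:R :> R by rewrite ltr0n.
have : 2 * M0 / e ^+ 2 * (n%:R / m%:R) <= eta / 2.
  move: m1; rewrite ler_pdivrMr ?mulr_gt0 ?exprn_gt0// => m1.
  have -> : 2 * M0 / e ^+ 2 * (n%:R / m%:R) = 2 * M0 * n%:R / (e ^+ 2 * m%:R).
    by field; rewrite !gt_eqF.
  by rewrite ler_pdivrMr ?mulr_gt0 ?exprn_gt0//; lra.
have := ler_wpM2l C0 S; lra.
Qed.

End trigonometric_approximation.

Section expectation.
Context {R : realType} {d : measure_display} {T : measurableType d}
  (P : probability T R).
Implicit Types (F G : T -> R) (A : set T).

Definition bounded_rv F :=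
  measurable_fun [set: T] F /\ exists B, forall w, `|F w| <= B.

Lemma bounded_rv_integrable F : bounded_rv F -> P.-integrable [set: T] (EFin \o F).
Proof.
move=> [mF [B hB]]; apply: measurable_bounded_integrable => //.
  by apply: (le_lt_trans (probability_le1 P measurableT)); rewrite ltry.
exists B; split; first exact: num_real.
by move=> x Bx w _ /=; rewrite (le_trans (hB w))// ltW.
Qed.

Lemma EFin_Rintegral F : bounded_rv F ->
  (\int[P]_w (F w)%:E = (\int[P]_w F w)%R%:E)%E.
Proof.
by move=> /bounded_rv_integrable/integrable_fin_num h; rewrite /Rintegral fineK// h.
Qed.

Lemma bounded_rvD F G : bounded_rv F -> bounded_rv G -> bounded_rv (fun w => F w + G w).
Proof.
move=> [mF [B hB]] [mG [C hC]]; split; first exact: measurable_funD.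
by exists (B + C) => w; rewrite (le_trans (ler_normD _ _))// lerD.
Qed.

Lemma bounded_rvZ a F : bounded_rv F -> bounded_rv (fun w => a * F w).
Proof.
move=> [mF [B hB]]; split; first exact: measurable_funM.
by exists (`|a| * B) => w; rewrite normrM ler_wpM2l.
Qed.

Lemma bounded_rv_cst a : bounded_rv (fun=> a).
Proof. by split => //; exists `|a|. Qed.

Lemma bounded_rvM F G : bounded_rv F -> bounded_rv G -> bounded_rv (fun w => F w * G w).
Proof.
move=> [mF [B hB]] [mG [C hC]]; split; first exact: measurable_funM.
by exists (B * C) => w; rewrite normrM ler_pM.
Qed.

Lemma bounded_rv_indic A : measurable A -> bounded_rv (\1_A : T -> R).
Proof.
move=> mA; split; first exact: measurable_indic.
by exists 1 => w; rewrite indicE; case: (w \in A); rewrite ?normr1 ?normr0.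
Qed.

Lemma Rintegral_indic A : measurable A -> \int[P]_w (\1_A w : R) = fine (P A).
Proof. by move=> mA; rewrite /Rintegral integral_indic// setIT. Qed.

Lemma RintegralDb F G : bounded_rv F -> bounded_rv G ->
  \int[P]_w (F w + G w) = \int[P]_w F w + \int[P]_w G w.
Proof. by move=> bF bG; rewrite RintegralD//; exact: bounded_rv_integrable. Qed.

Lemma RintegralZb a F : bounded_rv F ->
  \int[P]_w (a * F w) = a * \int[P]_w F w.
Proof. by move=> bF; rewrite RintegralZl//; exact: bounded_rv_integrable. Qed.

Lemma Rintegral_prob_cst a : \int[P]_w (a : R) = a.
Proof. by rewrite Rintegral_cst// (congr1 fine (probability_setT P)) mulr1. Qed.

Lemma Rintegral_sum (I : Type) (s : seq I) (F : I -> T -> R) :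
  (forall i, bounded_rv (F i)) ->
  bounded_rv (fun w => \sum_(i <- s) F i w) /\
  \int[P]_w (\sum_(i <- s) F i w) = \sum_(i <- s) \int[P]_w F i w.
Proof.
move=> bF; elim: s => [|i s [IHb IH]].
  have -> : (fun w => \sum_(i <- [::]) F i w) = (fun=> 0).
    by apply/funext => w; rewrite big_nil.
  by rewrite big_nil Rintegral_prob_cst; split=> //; exact: bounded_rv_cst.
have -> : (fun w => \sum_(j <- i :: s) F j w) =
    (fun w => F i w + \sum_(j <- s) F j w).
  by apply/funext => w; rewrite big_cons.
by rewrite RintegralDb// big_cons IH; split=> //; exact: bounded_rvD.
Qed.

(** Two bounded variables that are close off an event of small probability
    have close expectations. *)
Lemma Rintegral_close F G (e M0 : R) A : bounded_rv F -> bounded_rv G ->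
  measurable A -> (forall w, ~ A w -> `|F w - G w| <= e) ->
  (forall w, `|F w - G w| <= M0) -> 0 <= e ->
  `|\int[P]_w F w - \int[P]_w G w| <= e + M0 * fine (P A).
Proof.
move=> bF bG mA hA hM e0.
have bFG : bounded_rv (fun w => F w - G w).
  have := bounded_rvD bF (bounded_rvZ (-1) bG).
  by under [X in bounded_rv X]eq_fun do rewrite mulN1r.
have bD : bounded_rv (fun w => e + M0 * \1_A w).
  apply: bounded_rvD; first exact: bounded_rv_cst.
  exact/bounded_rvZ/bounded_rv_indic.
have -> : e + M0 * fine (P A) = \int[P]_w (e + M0 * \1_A w).
  rewrite RintegralDb ?RintegralZb ?Rintegral_prob_cst ?Rintegral_indic//.
  - exact: bounded_rv_indic.
  - exact: bounded_rv_cst.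
  - exact/bounded_rvZ/bounded_rv_indic.
rewrite -RintegralB//; [|exact: bounded_rv_integrable|exact: bounded_rv_integrable].
apply: (le_trans (le_normr_Rintegral _ (bounded_rv_integrable bFG))) => //.
apply: le_Rintegral => //.
- by apply: bounded_rv_integrable; case: bFG => m [B hB]; split;
    [exact: measurableT_comp|exists B => w; rewrite normr_id].
- exact: bounded_rv_integrable.
move=> w _; rewrite indicE; have [wA|/negP wA] := boolP (w \in A).
  by rewrite mulr1 -[leLHS]add0r lerD.
by rewrite mulr0 addr0 hA// => Aw; apply: wA; rewrite inE.
Qed.

End expectation.

Section random_vector_functions.
Context {R : realType} {d : measure_display} {T : measurableType d} {n : nat}.
Implicit Types (X : T -> 'cV[R]_n) (f p : 'cV[R]_n -> R).

Lemma measurable_dot u X : random_vector X ->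
  measurable_fun [set: T] (fun w => dot u (X w)).
Proof.
by move=> mX; apply: measurable_sum => i; apply: measurable_funM.
Qed.

Lemma measurable_cos_dot al u X : random_vector X ->
  measurable_fun [set: T] (fun w => cos (al + dot u (X w))).
Proof.
move=> mX; apply: measurableT_comp.
  by apply: continuous_measurable_fun; exact: continuous_cos.
by apply: measurable_funD => //; exact: measurable_dot.
Qed.

Lemma bounded_rv_cos_dot al u X : random_vector X ->
  bounded_rv (fun w => cos (al + dot u (X w))).
Proof.
move=> mX; split; first exact: measurable_cos_dot.
by exists 1 => w; exact: cos_max.
Qed.

Lemma bounded_rv_trigpoly p X : trigpoly p -> random_vector X ->
  bounded_rv (fun w => p (X w)).
Proof.
move=> [s hs] mX; under [X in bounded_rv X]eq_fun do rewrite hs.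
split.
  by apply: measurable_sum => t; apply: measurable_funM => //; exact: measurable_cos_dot.
exists (\sum_(t <- s) `|t.1.1|) => w; apply: (le_trans (ler_norm_sum _ _ _)).
by apply: ler_sum => t _; rewrite normrM ler_piMr// cos_max.
Qed.

(** A bounded continuous function of a random vector is a limit of
    trigonometric polynomials in it. *)
Lemma bounded_rv_continuous f X : continuous f -> (exists B, forall x, `|f x| <= B) ->
  random_vector X -> bounded_rv (fun w => f (X w)).
Proof.
move=> cf [B fB] mX; split; last by exists B.
have /choice[p hp] : forall k : nat, exists p, [/\ trigpoly p,
    forall x, `|p x| <= B & forall x : 'cV[R]_n, (forall i, `|x i 0| <= k.+1%:R) ->
    `|p x - f x| <= k.+1%:R^-1].
  by move=> k; apply: trigpoly_approx.
apply/measurable_EFinP.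
apply: (emeasurable_fun_cvg (fun k w => (p k (X w))%:E)) => //.
  move=> k; apply/measurable_EFinP; have [tp _ _] := hp k.
  by case: (bounded_rv_trigpoly tp mX).
move=> w _; apply: cvg_EFin; first by near=> k.
apply/cvgrPdist_le => e e0; near=> k; rewrite distrC.
have [_ _ h] := hp k; apply: (le_trans (h _ _)).
  move=> i; apply: (le_trans (entry_le_normmx _ _)).
  apply: (@le_trans _ _ k%:R); last by rewrite ler_nat.
  by near: k; exact: nbhs_infty_ger.
by near: k; apply: filterS (near_infty_natSinv_lt (PosNum e0)) => k0; exact: ltW.
Unshelve. all: by end_near. Qed.

Definition outside_cube X (B : R) : set T := [set w | exists i, B < `|X w i 0|].

Lemma measurable_outside_cube X B : random_vector X ->
  measurable (outside_cube X B).
Proof.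
move=> mX.
rewrite (_ : outside_cube X B = \bigcup_(i in [set: 'I_n]) [set w | B < `|X w i 0|]).
  apply: fin_bigcup_measurable => [|i _]; first exact: finite_finset.
  have : measurable_fun [set: T] (fun w => `|X w i 0|) by exact: measurableT_comp.
  move=> /(_ measurableT `]B, +oo[%classic (measurable_itv _)); rewrite setTI.
  by congr measurable; apply/seteqP; split=> w; rewrite /= in_itv/= andbT.
by apply/seteqP; split=> w [i]; [exists i|move=> _; exists i].
Qed.

Lemma random_vector_tight (P : probability T R) X : random_vector X ->
  forall eta : R, 0 < eta ->
  exists2 B : R, 0 < B & (P (outside_cube X B) <= eta%:E)%E.
Proof.
move=> mX eta eta0; pose F k := outside_cube X k.+1%:R.
have mF k : measurable (F k) by exact: measurable_outside_cube.
have F0 : \bigcap_k F k = set0.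
  apply/seteqP; split=> // w Fw.
  have [N _ hN] := @nbhs_infty_ger R `|X w|.
  have [i] := Fw N I; rewrite ltNge => /negP; apply.
  apply: (le_trans (entry_le_normmx _ _)); apply: (le_trans (hN N _)) => //=.
  by rewrite ler_nat.
have : P \o F @ \oo --> P (\bigcap_k F k).
  apply: nonincreasing_cvg_mu => //.
  - by apply: (le_lt_trans (probability_le1 P (mF 0%N))); rewrite ltry.
  - by rewrite F0.
  move=> k l kl; apply/subsetPset => w [i h]; exists i.
  by apply: le_lt_trans h; rewrite ler_nat.
rewrite F0 measure0 => /fine_cvgP[_ /cvgrPdist_le/(_ eta eta0)[N _ hN]].
exists N.+1%:R => //; have := hN N (leqnn N); rewrite /= sub0r normrN.
rewrite ger0_norm ?fine_ge0// -lee_fin fineK// fin_num_measure//; exact: mF.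
Qed.

End random_vector_functions.

Section convergence_in_law.
Context {R : realType} {n : nat}.

Lemma Rintegral_approx (d : measure_display) (T : measurableType d)
    (P : probability T R) (X : T -> 'cV[R]_n) (f p : 'cV[R]_n -> R) (B e M0 : R) :
  bounded_rv (fun w => f (X w)) -> bounded_rv (fun w => p (X w)) ->
  random_vector X -> 0 <= e ->
  (forall x, `|f x| <= M0) -> (forall x, `|p x| <= M0) ->
  (forall x : 'cV[R]_n, (forall i, `|x i 0| <= B) -> `|p x - f x| <= e) ->
  (P (outside_cube X B) <= e%:E)%E ->
  `|\int[P]_w f (X w) - \int[P]_w p (X w)| <= e + 2 * M0 * e.
Proof.
move=> bf bp mX e0 fM pM pf PB.
have mB := measurable_outside_cube B mX.
have M0_ge0 : 0 <= M0 by rewrite (le_trans _ (fM 0)).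
apply: (le_trans (@Rintegral_close _ _ _ P _ _ e (2 * M0) _ bf bp mB _ _ e0)).
- move=> w nB; rewrite distrC pf// => i; rewrite leNgt; apply/negP => h.
  by apply: nB; exists i.
- by move=> w; rewrite (le_trans (ler_normB _ _))//; have := fM (X w); have := pM (X w); lra.
rewrite lerD2l ler_wpM2l ?mulr_ge0// -lee_fin fineK//.
by rewrite fin_num_measure.
Qed.

(** Convergence of characteristic functions and tightness imply weak
    convergence: a continuous bounded function is uniformly close, on a cube
    carrying most of the mass, to a trigonometric polynomial with the same
    bound. *)
Lemma cvg_law_of_cvg_cos (idx : Type) (G : set_system idx) {FG : Filter G}
    (d : measure_display) (T : idx -> measurableType d)
    (P : forall a, probability (T a) R) (X : forall a, T a -> 'cV[R]_n)
    (d' : measure_display) (T' : measurableType d') (P' : probability T' R)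
    (Z : T' -> 'cV[R]_n) (f : 'cV[R]_n -> R) :
  random_vector Z -> (\forall a \near G, random_vector (X a)) ->
  (forall eta : R, 0 < eta -> exists2 B : R, 0 < B &
     \forall a \near G, (P a (outside_cube (X a) B) <= eta%:E)%E) ->
  (forall al u, \int[P a]_w cos (al + dot u (X a w)) @[a --> G] -->
     \int[P']_w cos (al + dot u (Z w))) ->
  continuous f -> (exists B, forall x, `|f x| <= B) ->
  (fun a => \int[P a]_w (f (X a w))%:E)%E @ G --> (\int[P']_w (f (Z w))%:E)%E.
Proof.
move=> mZ mX tX cX cf bf.
have bZ := bounded_rv_continuous cf bf mZ.
rewrite (EFin_Rintegral P' bZ).
apply: cvg_EFin.
  near=> a; have mXa : random_vector (X a) by near: a.
  by rewrite (EFin_Rintegral _ (bounded_rv_continuous cf bf mXa)).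
apply/cvgrPdist_le => e e0.
have [M0 fM] := bf.
have M0_ge0 : 0 <= M0 by rewrite (le_trans _ (fM 0)).
pose eta := e / (3 * (1 + 2 * M0)).
have D0 : 0 < 3 * (1 + 2 * M0) by rewrite mulr_gt0// ltr_wpDr// mulr_ge0.
have eta0 : 0 < eta by rewrite divr_gt0.
have etaE : eta + 2 * M0 * eta = e / 3.
  have := divfK (lt0r_neq0 D0) e; rewrite -/eta; lra.
have [BX BX0 hX] := tX eta eta0.
have [BZ BZ0 hZ] := random_vector_tight P' mZ eta0.
have outS (T0 : Type) (Y : T0 -> 'cV[R]_n) (B C : R) : B <= C ->
    [set w | exists i, C < `|Y w i 0|] `<=` [set w | exists i, B < `|Y w i 0|].
  by move=> BC w [i h]; exists i; exact: le_lt_trans h.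
pose B := Num.max BX BZ.
have B0 : 0 < B by rewrite lt_max BX0.
have [p [tp pM pf]] := trigpoly_approx cf fM B0 eta0.
have cp : \int[P a]_w p (X a w) @[a --> G] --> \int[P']_w p (Z w).
  have [s hs] := tp.
  have lin (d0 : measure_display) (T0 : measurableType d0) (P0 : probability T0 R)
      (Y : T0 -> 'cV[R]_n) : random_vector Y -> \int[P0]_w p (Y w) =
      \sum_(t <- s) t.1.1 * \int[P0]_w cos (t.1.2 + dot t.2 (Y w)).
    move=> mY; under eq_Rintegral do rewrite hs.
    have [|_ ->] := @Rintegral_sum _ _ _ P0 _ s (fun t w => t.1.1 * cos (t.1.2 + dot t.2 (Y w))).
      by move=> t; apply: bounded_rvZ; exact: bounded_rv_cos_dot.
    by apply: eq_bigr => t _; rewrite RintegralZb//; exact: bounded_rv_cos_dot.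
  rewrite (lin _ _ _ _ mZ).
  apply: (@cvg_trans _ (\sum_(t <- s) t.1.1 * \int[P a]_w cos (t.1.2 + dot t.2 (X a w)) @[a --> G])).
    apply: near_eq_cvg; near=> a; rewrite (lin _ _ (P a) (X a))//.
    by near: a.
  apply: cvg_big => [|t _]; first exact: add_continuous.
  by apply: cvgMr; exact: cX.
have := cp; move/cvgrPdist_le => /(_ (e / 3)); rewrite divr_gt0// => /(_ isT) cpe.
near=> a.
have mXa : random_vector (X a) by near: a.
have h1 : `|\int[P a]_w f (X a w) - \int[P a]_w p (X a w)| <= e / 3.
  rewrite -etaE; apply: (@Rintegral_approx _ _ _ _ _ _ B) => //.
  - exact: bounded_rv_continuous.
  - exact: bounded_rv_trigpoly.
  - exact: ltW.
  apply: (@le_trans _ _ (P a (outside_cube (X a) BX))); last by near: a.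
  apply: le_measure; rewrite ?inE; try exact: measurable_outside_cube.
  by apply: outS; rewrite le_max lexx.
have h2 : `|\int[P']_w f (Z w) - \int[P']_w p (Z w)| <= e / 3.
  rewrite -etaE; apply: (@Rintegral_approx _ _ _ _ _ _ B) => //.
  - exact: bounded_rv_trigpoly.
  - exact: ltW.
  apply: (le_trans _ hZ).
  apply: le_measure; rewrite ?inE; try exact: measurable_outside_cube.
  by apply: outS; rewrite le_max lexx orbT.
have h3 : `|\int[P']_w p (Z w) - \int[P a]_w p (X a w)| <= e / 3 by near: a.
rewrite [X in `|_ - X|](_ : _ = \int[P a]_w f (X a w))//.
move: h1 h2 h3; rewrite !ler_norml => /andP[? ?] /andP[? ?] /andP[? ?].
by apply/andP; split; lra.
Unshelve. all: by end_near. Qed.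

End convergence_in_law.

Section gaussian_characteristic_function.
Context {R : realType} (s : R) (s_gt0 : 0 < s) (al : R).
Notation mu := (@lebesgue_measure R).
Local Notation g := (normal_pdf 0 s).

Lemma centered_normal_pdfE (r x : R) : 0 < r ->
  normal_pdf 0 r x = normal_peak r * expR (- (x ^+ 2 / (r ^+ 2 *+ 2))).
Proof.
by move=> r0; rewrite normal_pdfE ?gt_eqF// /normal_fun subr0 mulNr.
Qed.

Lemma is_derive_centered_normal_pdf (x : R) :
  is_derive x 1 g (- (x / s ^+ 2) * g x).
Proof.
rewrite [X in is_derive _ _ X _](_ : _ =
    (fun x => normal_peak s * expR (- (x ^+ 2 / (s ^+ 2 *+ 2))))); last first.
  by apply/funext => y; rewrite centered_normal_pdfE.
rewrite centered_normal_pdfE//.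
have h : is_derive x 1 (fun x : R => - (x ^+ 2 / (s ^+ 2 *+ 2))) (- (x / s ^+ 2)).
  apply: is_derive_eq; rewrite /GRing.scale/=; field.
  by rewrite gt_eqF.
have h2 := @is_derive1_comp R expR _ x _ _ (is_derive_expR _) h.
apply: (is_derive_eq (is_deriveZ (normal_peak s) h2)).
by rewrite /GRing.scale/=; ring.
Qed.

Lemma integrable_absM_normal_pdf :
  mu.-integrable [set: R] (fun x => (`|x| * g x)%:E).
Proof.
have s2 : 0 < Num.sqrt 2 * s by rewrite mulr_gt0// sqrtr_gt0.
pose C := s * (normal_peak s / normal_peak (Num.sqrt 2 * s)).
have iC : mu.-integrable [set: R]
    (fun x => (C%:E * (normal_pdf 0 (Num.sqrt 2 * s) x)%:E)%E).
  exact: (integrableZl measurableT C (integrable_normal_pdf 0 _)).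
apply: (le_integrable measurableT _ _ iC) => [|x _].
  apply/measurable_EFinP; apply: measurable_funM; first by apply: measurableT_comp; [exact: normr_measurable|exact: measurable_id].
  exact: measurable_normal_pdf.
rewrite /= lee_fin ger0_norm ?mulr_ge0 ?normal_pdf_ge0//.
rewrite ler_normr; apply/orP; left.
rewrite !centered_normal_pdfE// exprMn sqr_sqrtr//.
have -> : C * (normal_peak (Num.sqrt 2 * s) * expR (- (x ^+ 2 / (2 * s ^+ 2 *+ 2)))) =
    normal_peak s * (s * expR (- (x ^+ 2 / (2 * s ^+ 2 *+ 2)))).
  by rewrite /C; field; rewrite gt_eqF// normal_peak_gt0// gt_eqF.
rewrite mulrCA ler_wpM2l ?normal_peak_ge0//.
have -> : - (x ^+ 2 / (s ^+ 2 *+ 2)) =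
    - (x ^+ 2 / (2 * s ^+ 2 *+ 2)) - (x ^+ 2 / (2 * s ^+ 2 *+ 2)).
  by field; rewrite gt_eqF.
rewrite expRD mulrA ler_wpM2r ?expR_ge0//.
rewrite expRN ler_pdivrMr ?expR_gt0//.
apply: (@le_trans _ _ (s * (1 + x ^+ 2 / (2 * s ^+ 2 *+ 2)))); last first.
  by rewrite ler_wpM2l ?(ltW s_gt0)// expR_ge1Dx.
have -> : s * (1 + x ^+ 2 / (2 * s ^+ 2 *+ 2)) = (4 * s ^+ 2 + x ^+ 2) / (4 * s).
  by field; rewrite gt_eqF.
rewrite ler_pdivlMr ?mulr_gt0//.
rewrite -(real_normK (num_real x)).
have := sqr_ge0 (2 * s - `|x|); rewrite sqrrB; nra.
Qed.

Lemma integrable_bounded_normal_pdf (f : R -> R) : measurable_fun [set: R] f ->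
  (forall x, `|f x| <= 1) -> mu.-integrable [set: R] (fun x => (f x * g x)%:E).
Proof.
move=> mf f1.
apply: (le_integrable measurableT _ _ (integrable_normal_pdf 0 s)).
  apply/measurable_EFinP; apply: measurable_funM => //.
  exact: measurable_normal_pdf.
move=> x _; rewrite /= lee_fin normrM ler_piMl//.
Qed.

Lemma measurable_affine_comp (f : R -> R) (t : R) : continuous f ->
  measurable_fun [set: R] (fun x => f (al + t * x)).
Proof.
move=> cf; apply: measurableT_comp; first exact: continuous_measurable_fun.
by apply: measurable_funD => //; apply: measurable_funM.
Qed.

Definition gauss_cos (t : R) : R := \int[mu]_x (cos (al + t * x) * g x).

Definition gauss_xsin (t : R) : R := \int[mu]_x (x * sin (al + t * x) * g x).

Lemma integrable_xsin t :
  mu.-integrable [set: R] (fun x => (x * sin (al + t * x) * g x)%:E).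
Proof.
apply: (le_integrable measurableT _ _ integrable_absM_normal_pdf).
  apply/measurable_EFinP; apply: measurable_funM; last exact: measurable_normal_pdf.
  apply: measurable_funM => //; apply: measurable_affine_comp; exact: continuous_sin.
move=> x _; rewrite /= lee_fin normrM [leRHS]ger0_norm ?mulr_ge0 ?normal_pdf_ge0//.
rewrite (ger0_norm (normal_pdf_ge0 _ _ _)) ler_wpM2r ?normal_pdf_ge0//.
by rewrite normrM ler_piMr// sin_max.
Qed.

Lemma is_derive_affine_cos (t x : R) :
  is_derive t 1 (fun t : R => cos (al + t * x)) (- (x * sin (al + t * x))).
Proof.
have h : is_derive t 1 (fun t : R => al + t * x) x.
  by apply: is_derive_eq; rewrite /GRing.scale/=; ring.
apply: (is_derive_eq (@is_derive1_comp R (@cos R) _ t _ _ (is_derive_cos _) h)).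
by rewrite mulNr mulrC.
Qed.

Lemma is_derive_gauss_cos (t : R) : is_derive t 1 gauss_cos (- gauss_xsin t).
Proof.
pose f (t x : R) := cos (al + t * x) * g x.
have df (t' x : R) : is_derive t' 1 (f^~ x) (- (x * sin (al + t' * x)) * g x).
  apply: (is_derive_eq (is_deriveM (is_derive_affine_cos t' x)
      (is_derive_cst (g x) t' 1))).
  by rewrite scaler0 add0r /GRing.scale/= mulrC.
have d1 (t' x : R) : partial1of2 f t' x = - (x * sin (al + t' * x)) * g x.
  by rewrite partial1of2E; have [] := df t' x.
have It : `]t - 1, t + 1[%classic t by rewrite /= in_itv/=; lra.
have i1 (t' : R) : `]t - 1, t + 1[%classic t' -> mu.-integrable [set: R] (EFin \o f t').
  move=> _; apply: integrable_bounded_normal_pdf => [|x]; last exact: cos_max.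
  by apply: measurable_affine_comp; exact: continuous_cos.
have i2 (t' x : R) : `]t - 1, t + 1[%classic t' -> [set: R] x -> derivable (f ^~ x) t' 1.
  by move=> _ _; have [] := df t' x.
have G0 (x : R) : 0 <= `|x| * g x by rewrite mulr_ge0 ?normal_pdf_ge0.
have i3 (t' x : R) : `]t - 1, t + 1[%classic t' -> [set: R] x ->
    `|partial1of2 f t' x| <= `|x| * g x.
  move=> _ _; rewrite d1 normrM normrN (ger0_norm (normal_pdf_ge0 _ _ _)).
  by rewrite ler_wpM2r ?normal_pdf_ge0// normrM ler_piMr// sin_max.
have D := derivable_under_integral measurableT It i1 i2 G0 integrable_absM_normal_pdf i3.
have E := differentiation_under_integral measurableT It i1 i2 G0 integrable_absM_normal_pdf i3.
apply: DeriveDef; first exact: D.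
rewrite -derive1E E -mulN1r -RintegralZl//; last exact: integrable_xsin.
by apply: eq_Rintegral => x _; rewrite d1 mulN1r mulNr.
Qed.

(** Stein's identity, obtained by integrating the derivative of
    [s^2 sin (al + t x) g x] over [-n, n]. *)
Lemma gauss_xsinE t : gauss_xsin t = s ^+ 2 * t * gauss_cos t.
Proof.
pose H x := s ^+ 2 * (sin (al + t * x) * g x).
pose h x := s ^+ 2 * t * (cos (al + t * x) * g x) - x * sin (al + t * x) * g x.
have icos : mu.-integrable [set: R] (fun x => (cos (al + t * x) * g x)%:E).
  apply: integrable_bounded_normal_pdf => [|x]; last exact: cos_max.
  by apply: measurable_affine_comp; exact: continuous_cos.
have ih : mu.-integrable [set: R] (EFin \o h).
  have h1 := integrableZl measurableT (s ^+ 2 * t) icos.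
  have := integrableB measurableT h1 (integrable_xsin t).
  by apply: eq_integrable => // x _; rewrite /h/= EFinB EFinM.
have dH (x : R) : is_derive x 1 H (h x).
  have h1 : is_derive x 1 (fun x : R => al + t * x) t.
    by apply: is_derive_eq; rewrite /GRing.scale/=; ring.
  have h2 := @is_derive1_comp R (@sin R) _ x _ _ (is_derive_sin _) h1.
  apply: (is_derive_eq (is_deriveZ (s ^+ 2) (is_deriveM h2 (is_derive_centered_normal_pdf x)))).
  by rewrite /h /GRing.scale/=; field; rewrite gt_eqF.
have cH x : {for x, continuous H}.
  by apply/differentiable_continuous/derivable1_diffP; have [] := dH x.
have ch : continuous h.
  move=> x; apply: cvgB.
    apply: cvgM; first exact: cvg_cst.
    apply: cvgM; last by apply: continuous_normal_pdf; rewrite gt_eqF.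
    apply: continuous_comp; last exact: continuous_cos.
    by apply: cvgD; [exact: cvg_cst|apply: cvgM; [exact: cvg_cst|exact: cvg_id]].
  apply: cvgM; last by apply: continuous_normal_pdf; rewrite gt_eqF.
  apply: cvgM; first exact: cvg_id.
  apply: continuous_comp; last exact: continuous_sin.
  by apply: cvgD; [exact: cvg_cst|apply: cvgM; [exact: cvg_cst|exact: cvg_id]].
pose f_ n (x : R) := (h x * \1_(`[- n%:R, n%:R]) x)%:E.
have ftc n : (\int[mu]_x f_ n.+1 x = (H n.+1%:R - H (- n.+1%:R))%:E)%E.
  rewrite EFinB -(@continuous_FTC2 R h H).
  - rewrite [RHS]integral_mkcond; apply: eq_integral => x _.
    rewrite /f_ patchE indicE; case: (x \in _); by rewrite ?mulr1 ?mulr0.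
  - by rewrite gtrN.
  - by apply: continuous_subspaceT => x; exact: ch.
  - split=> [x _||]; first by have [] := dH x.
      exact: cvg_at_right_filter (cH _).
    exact: cvg_at_left_filter (cH _).
  - by move=> x _; rewrite derive1E; have [] := dH x.
have mind n : measurable_fun [set: R] (f_ n).
  apply/measurable_EFinP; apply: measurable_funM; last exact: measurable_indic.
  exact: continuous_measurable_fun.
have abs_ih : mu.-integrable [set: R] (fun x => `|(h x)%:E|)%E by exact: integrable_abse.
have mh := measurable_int mu ih.
have cvg_f : {ae mu, forall x, [set: R] x -> f_ ^~ x @ \oo --> (EFin \o h) x}.
  apply: aeW => x _; apply: cvg_near_cst; near=> n.
  rewrite /f_ indicE mem_set ?mulr1//= in_itv/= -ler_norml.
  by near: n; exact: nbhs_infty_ger.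
have dom_f : {ae mu, forall x n, [set: R] x -> (`|f_ n x| <= `|(h x)%:E|)%E}.
  apply: aeW => x n _; rewrite /f_ indicE.
  by case: (x \in _); rewrite ?mulr1 ?mulr0 ?abse0 ?abse_ge0.
have [_ _ lim1] := @dominated_convergence _ _ _ mu _ measurableT f_ _ _ mind mh cvg_f abs_ih dom_f.
have lim2 : (fun n => (\int[mu]_x f_ n x)%E) @ \oo --> 0%E.
  rewrite -cvg_shiftS /=; under eq_fun do rewrite ftc.
  apply: cvg_EFin; first exact: nearW.
  pose C := s ^+ 2 * (normal_peak s * (s ^+ 2 *+ 2)).
  have C0 : 0 <= C.
    apply: mulr_ge0; first exact: sqr_ge0.
    apply: mulr_ge0; first exact: normal_peak_ge0.
    by rewrite mulrn_wge0// sqr_ge0.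
  have Hle x : 1 <= `|x| -> `|H x| <= C / `|x|.
    move=> x1; have x0 : 0 < `|x| by rewrite (lt_le_trans _ x1).
    rewrite /H normrM ger0_norm ?sqr_ge0// /C -mulrA ler_wpM2l ?sqr_ge0//.
    rewrite normrM (@le_trans _ _ `|g x|) ?ler_piMl ?sin_max//.
    rewrite ger0_norm ?normal_pdf_ge0// centered_normal_pdfE// -[leRHS]mulrA.
    rewrite ler_wpM2l ?normal_peak_ge0//.
    have y0 : 0 < x ^+ 2 / (s ^+ 2 *+ 2).
      have x2 : 0 < x ^+ 2 by rewrite -(real_normK (num_real x)) exprn_gt0.
      by rewrite divr_gt0// pmulrn_lgt0// exprn_gt0.
    rewrite expRN; apply: (@le_trans _ _ (x ^+ 2 / (s ^+ 2 *+ 2))^-1).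
      rewrite lef_pV2 ?posrE ?expR_gt0// (le_trans _ (expR_ge1Dx _))// lerDr.
      exact: ler01.
    rewrite invf_div ler_wpM2l ?mulrn_wge0 ?sqr_ge0// -(real_normK (num_real x)).
    by rewrite lef_pV2 ?posrE ?exprn_gt0// expr2 ler_peMr.
  have Hcvg (e : R) : 0 < e -> \forall n \near \oo, C / n.+1%:R <= e.
    move=> e0; near=> n; rewrite ler_pdivrMr ?ltr0n// -ler_pdivrMl//.
    apply: (@le_trans _ _ n%:R); last by rewrite ler_nat.
    by near: n; exact: nbhs_infty_ger.
  apply/cvgrPdist_le => e e0.
  have := Hcvg (e / 2); rewrite divr_gt0// => /(_ isT).
  apply: filterS => n hn; rewrite /= sub0r normrN.
  have n1 : 1 <= n.+1%:R :> R by rewrite ler1n.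
  have n0 : `|n.+1%:R| = n.+1%:R :> R by rewrite ger0_norm.
  apply: (le_trans (ler_normB _ _)).
  have := Hle n.+1%:R; have := Hle (- n.+1%:R); rewrite normrN n0 => /(_ n1) h1 /(_ n1) h2.
  by rewrite (le_trans (lerD h2 h1))// [leRHS]splitr lerD.
have h0 : (\int[mu]_x (h x)%:E = 0)%E by exact: (cvg_unique _ lim1 lim2).
have : \int[mu]_x h x = s ^+ 2 * t * gauss_cos t - gauss_xsin t.
  rewrite /h RintegralB//.
  - by rewrite RintegralZl.
  - exact: (integrableZl measurableT (s ^+ 2 * t) icos).
  - exact: integrable_xsin.
by rewrite /Rintegral h0/= => /esym/eqP; rewrite subr_eq0 => /eqP.
Unshelve. all: by end_near. Qed.

Lemma gauss_cosE (t : R) : gauss_cos t = cos al * expR (- (s ^+ 2 * t ^+ 2 / 2)).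
Proof.
pose K (t : R) := gauss_cos t * expR (s ^+ 2 * t ^+ 2 / 2).
have dK (u : R) : is_derive u 1 K 0.
  have h1 : is_derive u 1 (fun u : R => s ^+ 2 * u ^+ 2 / 2) (s ^+ 2 * u).
    by apply: is_derive_eq; rewrite /GRing.scale/=; field.
  have h2 := @is_derive1_comp R expR _ u _ _ (is_derive_expR _) h1.
  apply: (is_derive_eq (is_deriveM (is_derive_gauss_cos u) h2)).
  by rewrite gauss_xsinE /GRing.scale/=; ring.
have := is_derive_0_is_cst t 0 dK.
have -> : K 0 = cos al.
  rewrite /K expr0n/= mulr0 mul0r expR0 mulr1 /gauss_cos.
  under eq_Rintegral do rewrite mul0r addr0.
  rewrite RintegralZl//; last exact: integrable_normal_pdf.
  by rewrite /Rintegral integral_normal_pdf/= mulr1.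
move=> <-; rewrite /K -mulrA -expRD subrr expR0 mulr1//.
Qed.

End gaussian_characteristic_function.

Lemma integral_normal_prob {R : realType} (m s : R) (f : R -> \bar R) :
  measurable_fun [set: R] f -> (\int[normal_prob m s]_x `|f x| < +oo)%E ->
  (\int[normal_prob m s]_x f x =
   \int[lebesgue_measure]_x (f x * (normal_pdf m s x)%:E))%E.
Proof.
move=> mf finf.
rewrite -(Radon_Nikodym_change_of_variables (normal_prob_dominates m s))//=; last first.
  by apply/integrableP; split.
apply: ae_eq_integral => //.
- apply: emeasurable_funM => //; apply: (measurable_int lebesgue_measure).
  by apply: Radon_Nikodym_integrable; exact: normal_prob_dominates.
- apply: emeasurable_funM => //=; apply/measurableT_comp => //=.
  exact: measurable_normal_pdf.
- apply: ae_eqe_mul2l => /=.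
  rewrite Radon_NikodymE//=; first exact: normal_prob_dominates.
  move=> dom; case: cid => /= h [h1 h2 h3].
  apply: integral_ae_eq => //=.
  + by apply/measurableT_comp => //; exact: measurable_normal_pdf.
  + by move=> E _ mE; rewrite -h3.
Qed.

(** The characteristic function of a standard normal vector. *)
Lemma normal_law_cos {R : realType} (d : measure_display) (T : measurableType d)
    (P : probability T R) (n : nat) (Z : T -> 'cV[R]_n) al u :
  normal_law P Z 0 1%:M ->
  \int[P]_w cos (al + dot u (Z w)) = cos al * expR (- (dot u u / 2)).
Proof.
move=> [mZ lawZ].
have [u0|u0] := eqVneq u 0.
  transitivity (\int[P]_w cos al).
    by apply: eq_Rintegral => w _; rewrite u0 dot0l addr0.
  by rewrite Rintegral_prob_cst u0 dot0l mul0r oppr0 expR0 mulr1.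
have uu : 0 < dot u u.
  rewrite lt_def dot_ge0 andbT; apply: contra u0 => /eqP h.
  by apply/eqP/eucl_eq0; rewrite euclE h sqrtr0.
pose s := Num.sqrt (dot u u).
have s0 : 0 < s by rewrite sqrtr_gt0.
pose Y w := dot u (Z w).
have mY : measurable_fun [set: T] (Y : T -> measurableTypeR R) by exact: measurable_dot.
have lawY B : measurable B -> P (Y @^-1` B) = normal_prob 0 s B.
  move=> mB; have := lawZ u B mB.
  rewrite /Defs.normal1 (dotE u 0) dot0r quad_form1 (gt_eqF uu) => <-.
  by congr (P _); apply/seteqP; split=> w; rewrite /= dotE.
pose f (x : R) := (cos (al + x))%:E.
have mf : measurable_fun [set: R] f.
  apply/measurable_EFinP; apply: measurableT_comp.
    by apply: continuous_measurable_fun; exact: continuous_cos.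
  by apply: measurable_funD.
have bc := bounded_rv_cos_dot al u mZ.
have fin : (\int[normal_prob 0 s]_x `|f x| < +oo)%E.
  have : (normal_prob 0 s).-integrable [set: R] f.
    apply: (@bounded_rv_integrable _ _ _ (normal_prob 0 s) (fun x => cos (al + x))).
    split; first exact/measurable_EFinP.
    by exists 1 => x; exact: cos_max.
  by case/integrableP.
pose YM := isMeasurableFun.Build _ _ _ (measurableTypeR R) Y mY.
pose YY : {RV P >-> measurableTypeR R} := HB.pack Y YM.
have -> : \int[P]_w cos (al + dot u (Z w)) = fine (\int[distribution P YY]_x f x)%E.
  rewrite (integral_distribution (X := YY) mf)//.
  exact: (bounded_rv_integrable P bc).
have -> : (\int[distribution P YY]_x f x = \int[normal_prob 0 s]_x f x)%E.
  by apply: eq_measure_integral => A mA _; exact: lawY.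
rewrite integral_normal_prob//.
have := gauss_cosE s0 al 1; rewrite /gauss_cos /Rintegral.
under eq_integral do rewrite mul1r EFinM.
by move=> ->; rewrite expr1n mulr1 sqr_sqrtr ?ltW.
Qed.

Section cosine_power_series.
Context {R : realType} (c : R).

Definition cos_coeffs (al : R) (n : nat) : R := cos (al + c * n%:R) / n`!%:R.

Lemma is_cvg_cos_series (al x : R) : cvgn (pseries (cos_coeffs al) x).
Proof.
apply: normed_cvg; apply: (@series_le_cvg _ _ (exp_coeff `|x|)) => [n|n|n|].
- exact: normr_ge0.
- by rewrite exp_coeff_ge0.
- rewrite /cos_coeffs /exp_coeff /= normrM normrX normrM.
  rewrite (ger0_norm (_ : 0 <= n`!%:R^-1)) ?invr_ge0// mulrAC mulrC [leRHS]mulrC.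
  by rewrite ler_wpM2l ?invr_ge0// ler_piMl ?exprn_ge0// cos_max.
- exact: is_cvg_series_exp_coeff.
Qed.

Definition cos_series (al x : R) : R := limn (pseries (cos_coeffs al) x).

Lemma cos_series_diffs al : pseries_diffs (cos_coeffs al) = cos_coeffs (al + c).
Proof.
apply/funext => n; rewrite /pseries_diffs /cos_coeffs factS natrM -natr1.
rewrite (_ : al + c * (n%:R + 1) = al + c + c * n%:R); last by ring.
by field; rewrite pnatr_eq0 -lt0n fact_gt0/= natr1 pnatr_eq0.
Qed.

Lemma is_derive_cos_series (al x : R) :
  is_derive x 1 (cos_series al) (cos_series (al + c) x).
Proof.
have := @pseries_snd_diffs R (cos_coeffs al) (`|x| + 1) x.
rewrite !cos_series_diffs; apply; try exact: is_cvg_cos_series.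
by rewrite [ltRHS]ger0_norm ?addr_ge0// ltrDl.
Qed.

Lemma cos_series_lin (al be x a b : R) (ga : R) :
  (forall n, cos (ga + c * n%:R) = a * cos (al + c * n%:R) + b * cos (be + c * n%:R)) ->
  cos_series ga x = a * cos_series al x + b * cos_series be x.
Proof.
move=> h; apply/cvg_lim => //.
have -> : pseries (cos_coeffs ga) x =
    (fun n => a * pseries (cos_coeffs al) x n + b * pseries (cos_coeffs be) x n).
  apply/funext => n; rewrite /pseries /series/= !mulr_sumr -big_split/=.
  by apply: eq_bigr => i _; rewrite /cos_coeffs h; ring.
by apply: cvgD; apply: cvgMr; exact: is_cvg_cos_series.
Qed.

Lemma cos_series0 al : cos_series al 0 = cos al.
Proof.
apply/cvg_lim => //; apply: cvg_near_cst; near=> n.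
rewrite /pseries /series/= -(@prednK n); last by near: n; exact: nbhs_infty_gt.
rewrite big_nat_recl// expr0 /cos_coeffs mulr0 addr0 fact0 divr1 mulr1.
by rewrite big1 ?addr0// => i _; rewrite exprS mul0r mulr0.
Unshelve. all: by end_near. Qed.

(** The real part of [exp (i al) * sum_n (x exp (i c))^n / n!].  Both sides
    solve the same linear differential system in [x]. *)
Lemma cos_seriesE (al x : R) :
  cos_series al x = expR (x * cos c) * cos (al + x * sin c).
Proof.
pose be := al - pi / 2.
pose A := cos_series al; pose B := cos_series be.
have EA (y : R) : cos_series (al + c) y = cos c * A y + (- sin c) * B y.
  apply: cos_series_lin => n; rewrite /be (addrAC al (- _)) cosBpihalf.
  by rewrite (addrAC al c) (cosD (al + _) c); ring.
have EB (y : R) : cos_series (be + c) y = sin c * A y + cos c * B y.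
  apply: cos_series_lin => n; rewrite /be !(addrAC _ (- (pi / 2))) !cosBpihalf.
  by rewrite (addrAC al c) (sinD (al + _) c); ring.
have dA (y : R) : is_derive y 1 A (cos_series (al + c) y) by exact: is_derive_cos_series.
have dB (y : R) : is_derive y 1 B (cos_series (be + c) y) by exact: is_derive_cos_series.
have dE (y : R) : is_derive y 1 (fun y => expR (- (y * cos c))) (- cos c * expR (- (y * cos c))).
  have h : is_derive y 1 (fun y : R => - (y * cos c)) (- cos c).
    by apply: is_derive_eq; rewrite /GRing.scale/=; ring.
  apply: (is_derive_eq (@is_derive1_comp R expR _ y _ _ (is_derive_expR _) h)).
  by rewrite mulrC.
have hs (y : R) : is_derive y 1 (fun y : R => y * sin c) (sin c).
  by apply: is_derive_eq; rewrite /GRing.scale/=; ring.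
have dC (y : R) : is_derive y 1 (fun y => cos (y * sin c)) (- sin (y * sin c) * sin c).
  exact: (@is_derive1_comp R (@cos R) _ y _ _ (is_derive_cos _) (hs y)).
have dS (y : R) : is_derive y 1 (fun y => sin (y * sin c)) (cos (y * sin c) * sin c).
  exact: (@is_derive1_comp R (@sin R) _ y _ _ (is_derive_sin _) (hs y)).
pose H1 (y : R) := expR (- (y * cos c)) * (cos (y * sin c) * A y + sin (y * sin c) * B y).
pose H2 (y : R) := expR (- (y * cos c)) * (cos (y * sin c) * B y - sin (y * sin c) * A y).
have dH1 (y : R) : is_derive y 1 H1 0.
  apply: (is_derive_eq (is_deriveM (dE y) (is_deriveD (is_deriveM (dC y) (dA y))
    (is_deriveM (dS y) (dB y))))).
  by rewrite EA EB /GRing.scale/= !fctE; ring.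
have dH2 (y : R) : is_derive y 1 H2 0.
  apply: (is_derive_eq (is_deriveM (dE y) (is_deriveB (is_deriveM (dC y) (dB y))
    (is_deriveM (dS y) (dA y))))).
  by rewrite EA EB /GRing.scale/= !fctE; ring.
have e1 := is_derive_0_is_cst x 0 dH1; have e2 := is_derive_0_is_cst x 0 dH2.
rewrite /H1 !mul0r oppr0 expR0 cos0 sin0 mul1r mul0r mul1r addr0 /A cos_series0 in e1.
rewrite /H2 !mul0r oppr0 expR0 cos0 sin0 mul1r mul0r mul1r subr0 /B cos_series0 in e2.
have EE : expR (x * cos c) * expR (- (x * cos c)) = 1.
  by rewrite -expRD subrr expR0.
have sE : sin al = cos be by rewrite cosBpihalf.
rewrite cosD -e1 sE -e2 -/(A x) -/(B x).
set E := expR _ in EE *; set E' := expR _ in EE *.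
set C := cos _; set S := sin _.
have CS : C ^+ 2 + S ^+ 2 = 1 by exact: cos2Dsin2.
transitivity ((E * E') * (C ^+ 2 + S ^+ 2) * A x); last by ring.
by rewrite EE CS !mul1r.
Qed.

End cosine_power_series.

Section functions_of_counts.
Context {R : realType} {d : measure_display} {T : measurableType d}
  (P : probability T R).

Definition bounded_seq (h : nat -> R) := exists B, forall n, `|h n| <= B.

Lemma measurable_nat_comp (h : nat -> R) (X : T -> nat) :
  measurable_fun [set: T] X -> measurable_fun [set: T] (fun w => h (X w)).
Proof. by move=> mX; apply: (measurableT_comp (f := h)). Qed.

Lemma bounded_rv_nat (h : nat -> R) (X : T -> nat) : bounded_seq h ->
  measurable_fun [set: T] X -> bounded_rv (fun w => h (X w)).
Proof.
by move=> [B hB] mX; split; [exact: measurable_nat_comp|exists B].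
Qed.

Lemma bounded_seq_eq n : bounded_seq (fun m => (m == n)%:R).
Proof. by exists 1 => m; case: (m == n); rewrite ?normr1 ?normr0. Qed.

Lemma cvg_series_count (X : T -> nat) (H : T -> R) (h : nat -> R) :
  measurable_fun [set: T] X -> bounded_rv H -> bounded_seq h ->
  series (fun n => h n * \int[P]_w ((X w == n)%:R * H w)) @ \oo -->
  \int[P]_w (h (X w) * H w).
Proof.
move=> mX bH bh.
have bhX := bounded_rv_nat bh mX.
have bhH := bounded_rvM bhX bH.
have bterm n : bounded_rv (fun w => h n * ((X w == n)%:R * H w)).
  by apply: bounded_rvZ; apply: bounded_rvM => //;
    exact: (bounded_rv_nat (bounded_seq_eq n)).
pose f_ n (w : T) : R := \sum_(0 <= k < n) h k * ((X w == k)%:R * H w).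
have f_E n w : f_ n w = if (X w < n)%N then h (X w) * H w else 0.
  rewrite /f_ big_mkord; case: ifPn => [Xn|Xn].
    rewrite (bigD1 (Ordinal Xn))//= eqxx mul1r big1 ?addr0// => k kX.
    have -> : (X w == k) = false.
      by apply/negP => /eqP e; case/eqP: kX; apply/val_inj; rewrite /= e.
    by rewrite mul0r mulr0.
  rewrite big1// => k _; have -> : (X w == k) = false.
    by apply/negP => /eqP e; move: Xn; rewrite e ltn_ord.
  by rewrite mul0r mulr0.
have fsum n : bounded_rv (f_ n) /\ \int[P]_w f_ n w =
    series (fun n => h n * \int[P]_w ((X w == n)%:R * H w)) n.
  have [b1 b2] := @Rintegral_sum _ _ _ P _ (index_iota 0 n)
    (fun k w => h k * ((X w == k)%:R * H w)) bterm.
  split=> //; rewrite b2 /series/=; apply: eq_bigr => k _.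
  rewrite RintegralZb//; apply: bounded_rvM => //.
  exact: (bounded_rv_nat (bounded_seq_eq k)).
have [mhH [B hB]] := bhH.
have mf n : measurable_fun [set: T] (fun w => (f_ n w)%:E).
  by apply/measurable_EFinP; have [[]] := fsum n.
have mlim : measurable_fun [set: T] (fun w => (h (X w) * H w)%:E).
  exact/measurable_EFinP.
have B0 : P.-integrable [set: T] (EFin \o (fun=> B)).
  by apply: bounded_rv_integrable; exact: bounded_rv_cst.
have cvgf : {ae P, forall w, [set: T] w -> (fun n => (f_ n w)%:E) @ \oo --> (h (X w) * H w)%:E}.
  apply: aeW => w _; apply: cvg_near_cst; near=> n.
  by rewrite f_E (_ : (X w < n)%N)//; near: n; exact: nbhs_infty_gt.
have domf : {ae P, forall w n, [set: T] w -> (`|(f_ n w)%:E| <= (EFin \o (fun=> B)) w)%E}.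
  apply: aeW => w n _ /=; rewrite lee_fin f_E; case: ifP => _; first exact: hB.
  by rewrite normr0 (le_trans _ (hB w)).
have [_ _] := @dominated_convergence _ _ _ P _ measurableT
  (fun n w => (f_ n w)%:E) _ _ mf mlim cvgf B0 domf.
rewrite (EFin_Rintegral P bhH) => /fine_cvgP[_].
by apply: cvg_trans; apply: near_eq_cvg; near=> n; rewrite /= -(fsum n).2.
Unshelve. all: by end_near. Qed.

(** A product formula for the events [X = n] extends to bounded functions. *)
Lemma count_product (X : T -> nat) (H : T -> R) (C : R) (h : nat -> R) :
  measurable_fun [set: T] X -> bounded_rv H -> bounded_seq h ->
  (forall n, \int[P]_w ((X w == n)%:R * H w) = \int[P]_w (X w == n)%:R * C) ->
  \int[P]_w (h (X w) * H w) = \int[P]_w h (X w) * C.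
Proof.
move=> mX bH bh hC; have l1 := cvg_series_count mX bH bh.
have l2 := cvg_series_count mX (bounded_rv_cst 1) bh.
rewrite (_ : (fun w : T => h (X w) * 1) = (fun w => h (X w))) in l2; last first.
  by apply/funext => w; rewrite mulr1.
have l3 := cvgM l2 (cvg_cst C).
have l4 : series (fun n => h n * \int[P]_w ((X w == n)%:R * H w)) @ \oo -->
    \int[P]_w h (X w) * C.
  rewrite [X in X @ _ --> _](_ : _ = (fun n =>
    series (fun n => h n * \int[P]_w ((X w == n)%:R * 1)) n * C)); first exact: l3.
  apply/funext => n.
  rewrite /series/= mulr_suml; apply: eq_bigr => k _; rewrite hC -mulrA.
  by congr (_ * (_ * _)); apply: eq_Rintegral => w _; rewrite mulr1.
exact: (cvg_unique _ l1 l4).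
Qed.

Lemma Rintegral_count_eq (X : T -> nat) (A : set nat) :
  measurable_fun [set: T] X ->
  \int[P]_w (\1_A (X w) : R) = fine (P (X @^-1` A)).
Proof.
move=> mX; rewrite -Rintegral_indic//.
by rewrite -[X @^-1` A]setTI; exact: mX.
Qed.

Lemma indic1_seqE (n : nat) : (fun m => (m == n)%:R : R) = \1_[set n].
Proof. by apply/funext => m; rewrite indicE in_set1. Qed.

Section independent_family.
Context {I : finType} (V : I -> {RV P >-> nat}) (indep : mutually_independent V).

Lemma bounded_rv_prod (g : I -> nat -> R) (Q : pred I) :
  (forall i, bounded_seq (g i)) ->
  bounded_rv (fun w => \prod_(i | Q i) g i (V i w)).
Proof.
move=> bg; elim: (index_enum I) => [|i s IH].
  under [X in bounded_rv X]eq_fun do rewrite big_nil; exact: bounded_rv_cst.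
under [X in bounded_rv X]eq_fun do rewrite big_cons.
by case: (Q i) => //; apply: bounded_rvM => //; exact: bounded_rv_nat.
Qed.

(** The product formula holds for indicators by definition; bounded functions
    replace the indicators one index at a time. *)
Lemma Rintegral_prod (g : I -> nat -> R) : (forall i, bounded_seq (g i)) ->
  \int[P]_w (\prod_i g i (V i w)) = \prod_i \int[P]_w g i (V i w).
Proof.
move=> bg.
suff H (s : seq I) : forall g : I -> nat -> R, (forall i, bounded_seq (g i)) ->
    (forall i, i \notin s -> exists A : set nat, g i = \1_A) ->
    \int[P]_w (\prod_i g i (V i w)) = \prod_i \int[P]_w g i (V i w).
  by apply: (H (enum I)) => // i; rewrite mem_enum.
elim: s => [|i0 s IH] {bg}g bg gA.
  have /choice[A hA] : forall i, exists A : set nat, g i = \1_A by move=> i; exact: gA.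
  have mA i : measurable (A i) by [].
  have := indep [set: I]%SET mA.
  transitivity (fine (P (\bigcap_(i in [set i | i \in [set: I]%SET]) V i @^-1` A i))).
    rewrite -Rintegral_indic; last first.
      apply: fin_bigcap_measurable => [|i _]; first exact: finite_finset.
      by rewrite -[_ @^-1` _]setTI; exact: measurable_funP.
    apply: eq_Rintegral => w _; rewrite indicE.
    case: (boolP (w \in _)) => [|/negP]; rewrite inE => h.
      by rewrite big1// => i _; rewrite hA indicE mem_set//; apply: h; rewrite /= inE.
    have [i /negP Ai] : exists i, V i w \notin A i.
      apply: contrapT => /forallNP all; apply: h => i _ /=.
      by have /negP := all i; rewrite negbK inE.
    by rewrite (bigD1 i)//= hA indicE (negbTE (introN idP Ai)) mul0r.
  rewrite indep// big_mkcond/=; apply: eq_bigr => i _; rewrite inE hA.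
  by rewrite Rintegral_count_eq.
have [|i0s] := boolP (i0 \in s).
  move=> i0s; apply: IH => // i /negP nis; apply: gA; apply/negP.
  by rewrite inE => /orP[/eqP e|//]; apply: nis; rewrite e.
rewrite (bigD1 i0)//=.
transitivity (\int[P]_w (g i0 (V i0 w) * \prod_(i | i != i0) g i (V i w))).
  by apply: eq_Rintegral => w _; rewrite (bigD1 i0).
apply: count_product => //; first exact: bounded_rv_prod.
move=> n.
pose g' i := if i == i0 then (fun m => (m == n)%:R : R) else g i.
have g'0 : g' i0 = (fun m => (m == n)%:R) by rewrite /g' eqxx.
have bg' i : bounded_seq (g' i).
  by rewrite /g'; case: ifP => // _; exact: bounded_seq_eq.
have gA' i : i \notin s -> exists A : set nat, g' i = \1_A.
  move=> nis; rewrite /g'; case: ifPn => [_|ne].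
    by exists [set n]; rewrite indic1_seqE.
  by apply: gA; rewrite inE negb_or ne.
have := IH g' bg' gA'; rewrite [in RHS](bigD1 i0)//= g'0.
have -> : \prod_(i | i != i0) \int[P]_w g' i (V i w) =
    \prod_(i | i != i0) \int[P]_w g i (V i w).
  by apply: eq_bigr => i /negbTE ne; rewrite /g' ne.
move=> <-; apply: eq_Rintegral => w _.
rewrite [in RHS](bigD1 i0)//= g'0; congr (_ * _).
by apply: eq_bigr => i /negbTE ne; rewrite /g' ne.
Qed.

End independent_family.

End functions_of_counts.

Section poisson_family.
Context {R : realType} {d : measure_display} {T : measurableType d}
  (P : probability T R) {I : finType} (V : I -> {RV P >-> nat}) (lam : I -> R).
Hypothesis lam_gt0 : forall i, 0 < lam i.
Hypothesis lawV : forall i (A : set nat),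
  distribution P (V i) A = poisson_prob (lam i) 0%N A.
Hypothesis indep : mutually_independent V.

Lemma poisson_pmfE i n :
  poisson_pmf (lam i) n = lam i ^+ n / n`!%:R * expR (- lam i).
Proof. by rewrite /poisson_pmf lam_gt0. Qed.

Lemma Rintegral_poisson_eq i n :
  \int[P]_w (V i w == n)%:R = poisson_pmf (lam i) n.
Proof.
transitivity (\int[P]_w (\1_[set n] (V i w) : R)).
  by apply: eq_Rintegral => w _; rewrite -indic1_seqE.
rewrite Rintegral_count_eq// -[P _]/(distribution P (V i) [set n]) lawV.
by rewrite /poisson_prob lam_gt0 esum_set1// lee_fin poisson_pmf_ge0.
Qed.

Lemma cvg_series_poisson i (h : nat -> R) : bounded_seq h ->
  series (fun n => h n * poisson_pmf (lam i) n) @ \oo --> \int[P]_w h (V i w).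
Proof.
move=> bh.
have mV : measurable_fun [set: T] (V i) by [].
have := cvg_series_count (P := P) mV (bounded_rv_cst 1) bh.
under eq_fun do under eq_Rintegral do rewrite mulr1.
under eq_fun do rewrite Rintegral_poisson_eq.
by under eq_Rintegral do rewrite mulr1.
Qed.

Lemma poisson_cos i al c :
  \int[P]_w cos (al + c * (V i w)%:R) =
  expR (lam i * (cos c - 1)) * cos (al + lam i * sin c).
Proof.
have bh : bounded_seq (fun n => cos (al + c * n%:R)) by exists 1 => n; exact: cos_max.
have l1 := cvg_series_poisson (i := i) bh.
have l2 : expR (- lam i) * pseries (cos_coeffs c al) (lam i) n @[n --> \oo] -->
    expR (- lam i) * cos_series c al (lam i).
  by apply: cvgMr; exact: is_cvg_cos_series.
have E : series (fun n => cos (al + c * n%:R) * poisson_pmf (lam i) n) =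
    (fun n => expR (- lam i) * pseries (cos_coeffs c al) (lam i) n).
  apply/funext => n; rewrite /pseries /series/= mulr_sumr; apply: eq_bigr => k _.
  by rewrite poisson_pmfE /cos_coeffs; ring.
rewrite E in l1.
rewrite (cvg_unique _ l1 l2)// cos_seriesE mulrA -expRD.
by congr (expR _ * _); ring.
Qed.

(** The angle-addition formula moves one index at a time from the argument of
    the cosine to the product. *)
Lemma poisson_family_cos al (c : I -> R) :
  \int[P]_w cos (al + \sum_i c i * (V i w)%:R) =
  expR (\sum_i lam i * (cos (c i) - 1)) * cos (al + \sum_i lam i * sin (c i)).
Proof.
pose rho i := expR (lam i * (cos (c i) - 1)).
have H (s : seq I) : uniq s -> forall al (g : I -> nat -> R), (forall i, bounded_seq (g i)) ->
    \int[P]_w (cos (al + \sum_(i <- s) c i * (V i w)%:R) *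
               \prod_(i | i \notin s) g i (V i w)) =
    (\prod_(i <- s) rho i) * cos (al + \sum_(i <- s) lam i * sin (c i)) *
      \prod_(i | i \notin s) \int[P]_w g i (V i w).
  elim: s => [_|i0 s IH /= /andP[i0s us]] {}al g bg.
    transitivity (\int[P]_w (cos al * \prod_i g i (V i w))).
      by apply: eq_Rintegral => w _; rewrite big_nil addr0.
    rewrite RintegralZb; last exact: bounded_rv_prod.
    by rewrite Rintegral_prod// !big_nil addr0 mul1r.
  pose gc (h : nat -> R) i := if i == i0 then h else g i.
  have bgc h : bounded_seq h -> forall i, bounded_seq (gc h i).
    by move=> bh i; rewrite /gc; case: ifP.
  have prodE (F : (nat -> R) -> I -> R) h : (forall i, i != i0 -> F (gc h i) i = F (g i) i) ->
      \prod_(i | i \notin s) F (gc h i) i =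
      F h i0 * \prod_(i | i \notin i0 :: s) F (g i) i.
    move=> hF; rewrite (bigD1 i0)//=; congr (_ * _); first by rewrite /gc eqxx.
    apply: eq_big => [i|i /andP[_ ne]]; last exact: hF.
    by rewrite inE negb_or andbC.
  have gcE h i : i != i0 -> gc h i = g i by rewrite /gc => /negbTE ->.
  pose hc n : R := cos (c i0 * n%:R); pose hs n : R := sin (c i0 * n%:R).
  have bhc : bounded_seq hc by exists 1 => n; exact: cos_max.
  have bhs : bounded_seq hs by exists 1 => n; exact: sin_max.
  have e1 := IH us al (gc hc) (bgc _ bhc).
  have e2 := IH us (al - pi / 2) (gc hs) (bgc _ bhs).
  have bterm a h : bounded_seq h -> bounded_rv (fun w =>
      cos (a + \sum_(i <- s) c i * (V i w)%:R) *
      \prod_(i | i \notin s) gc h i (V i w)).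
    move=> bh; apply: bounded_rvM; last by apply: bounded_rv_prod; exact: bgc.
    split; last by exists 1 => w; exact: cos_max.
    apply: measurableT_comp.
      by apply: continuous_measurable_fun; exact: continuous_cos.
    apply: measurable_funD => //; apply: measurable_sum => i.
    apply: measurable_funM => //.
    by apply: (measurable_nat_comp (fun n => n%:R)).
  transitivity (\int[P]_w (cos (al + \sum_(i <- s) c i * (V i w)%:R) *
      \prod_(i | i \notin s) gc hc i (V i w)) -
      \int[P]_w (cos (al - pi / 2 + \sum_(i <- s) c i * (V i w)%:R) *
      \prod_(i | i \notin s) gc hs i (V i w))).
    rewrite -RintegralB//; try by apply: bounded_rv_integrable; exact: bterm.
    apply: eq_Rintegral => w _; rewrite big_cons.
    rewrite !(prodE (fun f i => f (V i w))); try by move=> i /gcE ->.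
    rewrite (addrAC al) cosBpihalf /hc /hs.
    rewrite [c i0 * _ + _]addrC addrA (cosD (al + _)); ring.
  rewrite e1 e2 !(prodE (fun f i => \int[P]_w f (V i w))); try by move=> i /gcE ->.
  have -> : \int[P]_w hc (V i0 w) = rho i0 * cos (lam i0 * sin (c i0)).
    have := poisson_cos i0 0 (c i0).
    by under eq_Rintegral do rewrite add0r; rewrite add0r.
  have -> : \int[P]_w hs (V i0 w) = rho i0 * sin (lam i0 * sin (c i0)).
    have := poisson_cos i0 (- (pi / 2)) (c i0).
    under eq_Rintegral do rewrite (addrC (- _)) cosBpihalf.
    by rewrite (addrC (- _)) cosBpihalf.
  rewrite !big_cons (addrAC al) cosBpihalf.
  rewrite [lam i0 * _ + _]addrC addrA (cosD (al + _)); ring.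
have b1 : bounded_seq (fun=> 1 : R) by exists 1 => n; rewrite normr1.
have := H (index_enum I) (index_enum_uniq I) al (fun _ _ => 1) (fun=> b1).
have e0 (F : I -> R) : \prod_(i | i \notin index_enum I) F i = 1.
  by apply: big_pred0 => i; rewrite mem_index_enum.
rewrite !e0 mulr1 (big_morph expR (@expRD R) (@expR0 R)) => <-.
by apply: eq_Rintegral => w _; rewrite ?e0 mulr1.
Qed.

Lemma partial_expR_le (x : R) n : 0 <= x ->
  \sum_(0 <= k < n) x ^+ k / k`!%:R <= expR x.
Proof.
move=> x0; have := @is_cvg_series_exp_coeff R x.
move=> /nondecreasing_cvgn_le -/(_ _ n); apply.
apply/nondecreasing_seqP => k; rewrite /series/= big_nat_recr//= lerDl.
exact: exp_coeff_ge0.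
Qed.

Lemma poisson_truncated_exp i (c : R) n :
  \int[P]_w (expR (c * (V i w)%:R) * (V i w < n)%N%:R) <=
  expR (lam i * (expR c - 1)).
Proof.
pose h m : R := expR (c * m%:R) * (m < n)%N%:R.
have h0 m : 0 <= h m <= expR (c * m%:R).
  by rewrite /h; case: (m < n)%N; rewrite ?mulr1 ?mulr0 ?lexx ?expR_ge0.
have bh : bounded_seq h.
  exists (\sum_(m < n) expR (c * m%:R)) => m; rewrite /h.
  case: (ltnP m n) => mn; last by rewrite mulr0 normr0 sumr_ge0// => k _; exact: expR_ge0.
  rewrite mulr1 ger0_norm ?expR_ge0// (bigD1 (Ordinal mn))//= lerDl.
  by apply: sumr_ge0 => k _; exact: expR_ge0.
have l := cvg_series_poisson (i := i) bh.
rewrite -(cvg_lim _ l)//; apply: limr_le; first exact: (cvgP _ l).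
apply: nearW => N; rewrite /series/=.
apply: (@le_trans _ _ (expR (- lam i) * \sum_(0 <= k < N) (lam i * expR c) ^+ k / k`!%:R)).
  rewrite mulr_sumr; apply: ler_sum => k _; rewrite poisson_pmfE exprMn -expRM_natr.
  have /andP[_ hk] := h0 k.
  rewrite [leRHS](_ : _ = expR (c * k%:R) * (lam i ^+ k / k`!%:R * expR (- lam i))).
    by rewrite ler_wpM2r// mulr_ge0 ?expR_ge0// divr_ge0// exprn_ge0// ltW.
  by ring.
rewrite mulrBr mulr1 addrC expRD ler_wpM2l ?expR_ge0//.
by apply: partial_expR_le; rewrite mulr_ge0 ?expR_ge0// ltW.
Qed.

(** Chernoff's bound.  The exponential is truncated to counts below [n], which
    keeps every expectation a sum over bounded variables, and [n] tends to
    infinity in the probability only. *)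
Lemma poisson_chernoff (c : I -> R) (B : R) :
  (P [set w | (B < \sum_i c i * ((V i w)%:R - lam i))%R] <=
   (expR (\sum_i lam i * (expR (c i) - 1 - c i) - B))%:E)%E.
Proof.
pose S w := \sum_i c i * ((V i w)%:R - lam i).
pose A := [set w | B < S w].
pose F n := A `&` [set w | forall i, (V i w < n)%N].
have mS : measurable_fun [set: T] S.
  apply: measurable_sum => i; apply: measurable_funM => //.
  apply: measurable_funB => //.
  by apply: (measurable_nat_comp (fun n => n%:R)).
have mA : measurable A.
  have := mS measurableT `]B, +oo[%classic (measurable_itv _); rewrite setTI.
  by congr measurable; apply/seteqP; split=> w; rewrite /A/= in_itv/= andbT.
have mF n : measurable (F n).
  apply: measurableI => //.
  rewrite (_ : mkset _ = \bigcap_(i in [set: I]) V i @^-1` [set m | (m < n)%N]).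
    apply: fin_bigcap_measurable => [|i _]; first exact: finite_finset.
    by rewrite -[_ @^-1` _]setTI; exact: measurable_funP.
  by apply/seteqP; split=> w h i; [move=> _; exact: h|exact: h].
have FA : \bigcup_n F n = A.
  apply/seteqP; split=> w; first by case=> n _ [].
  move=> Aw; exists (\max_i V i w).+1 => //; split => // i.
  by rewrite ltnS leq_bigmax.
have cvgF : P \o F @ \oo --> P A.
  rewrite -FA; apply: nondecreasing_cvg_mu => //; first by rewrite FA.
  move=> m n mn; apply/subsetPset => w [Aw hw]; split=> // i.
  exact: leq_trans (hw i) mn.
pose E := expR (\sum_i lam i * (expR (c i) - 1 - c i) - B).
suff bd n : (P (F n) <= E%:E)%E.
  rewrite -(cvg_lim _ cvgF)//; apply: lime_le; first exact: (cvgP _ cvgF).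
  exact: nearW.
pose g i m : R := expR (c i * m%:R) * (m < n)%N%:R.
have bg i : bounded_seq (g i).
  exists (\sum_(m < n) expR (c i * m%:R)) => m; rewrite /g.
  case: (ltnP m n) => mn; last by rewrite mulr0 normr0 sumr_ge0// => k _; exact: expR_ge0.
  rewrite mulr1 ger0_norm ?expR_ge0// (bigD1 (Ordinal mn))//= lerDl.
  by apply: sumr_ge0 => k _; exact: expR_ge0.
have bprod : bounded_rv (fun w => \prod_i g i (V i w)) by exact: bounded_rv_prod.
pose K := expR (- (\sum_i c i * lam i) - B).
have PF : fine (P (F n)) <= K * \int[P]_w (\prod_i g i (V i w)).
  rewrite -Rintegral_indic// -RintegralZb//; apply: le_Rintegral => //.
  - exact/bounded_rv_integrable/bounded_rv_indic.
  - exact/bounded_rv_integrable/bounded_rvZ.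
  move=> w _; rewrite indicE; have [|] := boolP (w \in F n); last first.
    move=> _; rewrite mulr_ge0 ?expR_ge0// prodr_ge0// => i _.
    by rewrite mulr_ge0 ?expR_ge0.
  rewrite inE => -[Aw hw].
  have -> : \prod_i g i (V i w) = expR (\sum_i c i * (V i w)%:R).
    rewrite (big_morph expR (@expRD R) (@expR0 R)); apply: eq_bigr => i _.
    by rewrite /g hw mulr1.
  rewrite -expRD -[leLHS]expR0 ler_expR.
  have SE : S w = \sum_i c i * (V i w)%:R - \sum_i c i * lam i.
    by rewrite /S -sumrB; apply: eq_bigr => i _; rewrite mulrBr.
  by have : B < S w := Aw; rewrite SE; lra.
rewrite -[P (F n)]fineK ?fin_num_measure// lee_fin (le_trans PF)//.
rewrite Rintegral_prod//.
apply: (@le_trans _ _ (K * \prod_i expR (lam i * (expR (c i) - 1)))).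
  rewrite ler_wpM2l ?expR_ge0//; apply: ler_prod => i _.
  rewrite poisson_truncated_exp andbT; apply: Rintegral_ge0 => w _.
  by rewrite mulr_ge0 ?expR_ge0.
rewrite -(big_morph expR (@expRD R) (@expR0 R)) -expRD ler_expR.
have -> : \sum_i lam i * (expR (c i) - 1 - c i) =
    \sum_i lam i * (expR (c i) - 1) - \sum_i c i * lam i.
  by rewrite -sumrB; apply: eq_bigr => i _; ring.
lra.
Qed.

End poisson_family.

Section taylor.
Context {R : realType} {n : nat}.
Implicit Types (f g : 'cV[R]_n -> R) (x h : 'cV[R]_n).

(** The broken line from 0 to [h] that follows the coordinate axes: its [i]-th
    edge is parametrized by [t] between 0 and [h i 0]. *)
Definition edge h (i : 'I_n) (t : R) : 'cV[R]_n :=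
  \col_j (if (j < i)%N then h j 0 else if j == i then t else 0).

Lemma edge_shift h i t : edge h i t = t *: basis_vec i + edge h i 0.
Proof.
apply/colP => j; rewrite !mxE !eqxx andbT.
have [->|ne] := eqVneq j i; first by rewrite ltnn mulr1 addr0.
by rewrite mulr0 add0r.
Qed.

Lemma eucl_edge h i t : `|t| <= `|h i 0| -> eucl (edge h i t) <= eucl h.
Proof.
move=> th; rewrite eucl_le ?eucl_ge0// sqr_eucl; apply: ler_sum => j _.
rewrite !mxE; case: ifP => // _; case: eqP => [->|_].
  by rewrite -!expr2 -(real_normK (num_real t)) -(real_normK (num_real (h i 0)))
    lerXn2r// nnegrE.
by rewrite mul0r -expr2 sqr_ge0.
Qed.

Lemma edge_telescope f x h (a : 'I_n -> R) (e : R) :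
  (forall i, `|f (x + edge h i (h i 0)) - f (x + edge h i 0) - a i| <= e) ->
  `|f (x + h) - f x - \sum_i a i| <= n%:R * e.
Proof.
move=> he.
pose v m : 'cV[R]_n := \col_j (if (j < m)%N then h j 0 else 0).
have v0 : v 0%N = 0 by apply/colP => j; rewrite !mxE ltn0.
have vn : v n = h by apply/colP => j; rewrite !mxE ltn_ord.
have e0 (i : 'I_n) : edge h i 0 = v i.
  by apply/colP => j; rewrite !mxE; case: ifP => // _; case: eqP.
have e1 (i : 'I_n) : edge h i (h i 0) = v i.+1.
  apply/colP => j; rewrite !mxE ltnS [(j <= i)%N]leq_eqVlt.
  have [->|ne] := eqVneq j i; first by rewrite ltnn eqxx.
  by rewrite (_ : (j == i :> nat) = false)//; exact: negbTE ne.
have -> : f (x + h) - f x = \sum_(i < n) (f (x + v i.+1) - f (x + v i)).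
  rewrite -(big_mkord xpredT (fun i => f (x + v i.+1) - f (x + v i))).
  by rewrite telescope_sumr// vn v0 addr0.
rewrite -sumrB (le_trans (ler_norm_sum _ _ _))//.
rewrite mulr_natl -[n in leRHS]card_ord -sumr_const; apply: ler_sum => i _.
by rewrite -e0 -e1.
Qed.

Lemma is_derive_line f x v (t : R) : derivable f (t *: v + x) v ->
  is_derive t 1 (fun t : R => f (t *: v + x)) ('D_v f (t *: v + x)).
Proof.
move=> df.
have E : (fun s : R => s^-1 *: ((fun t => f (t *: v + x)) (s *: 1 + t) - f (t *: v + x))) =
    (fun s : R => s^-1 *: (f (s *: v + (t *: v + x)) - f (t *: v + x))).
  by apply/funext => s; rewrite scalerDl [_ *: 1]mulr1 addrA.
apply: DeriveDef.
  by rewrite /derivable; move: df; rewrite /derivable -E.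
by rewrite /derive -E.
Qed.

Lemma edge_mvt f x h i (p : R -> R) (dp : R -> R) (e : R) :
  (forall t : R, is_derive t 1 p (dp t)) ->
  (forall t, `|t| <= `|h i 0| -> derivable f (x + edge h i t) (basis_vec i)) ->
  (forall t, `|t| <= `|h i 0| -> `|partial i f (x + edge h i t) - dp t| <= e) ->
  `|f (x + edge h i (h i 0)) - f (x + edge h i 0) - (p (h i 0) - p 0)|
    <= eucl h * e.
Proof.
move=> hp df hd.
have shift t : x + edge h i t = t *: basis_vec i + (x + edge h i 0).
  by rewrite edge_shift addrCA.
have [|t th] := @mvt0 R (fun t => f (t *: basis_vec i + (x + edge h i 0)) - p t)
    (fun t => partial i f (x + edge h i t) - dp t) (h i 0).
  move=> t th.
  have D := @is_derive_line f (x + edge h i 0) (basis_vec i) t.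
  rewrite -(shift t) in D; apply: is_deriveB; exact: D (df t th).
rewrite -!shift => e1.
have -> : f (x + edge h i (h i 0)) - f (x + edge h i 0) - (p (h i 0) - p 0) =
    f (x + edge h i (h i 0)) - p (h i 0) - (f (x + edge h i 0) - p 0) by ring.
rewrite e1 normrM mulrC ler_pM//; [exact: eucl_entry|exact: hd].
Qed.

Section third_order.
Variables (f : 'cV[R]_n -> R) (x : 'cV[R]_n) (r G : R).
Hypothesis fG : forall h, eucl h < r -> forall i j l,
  [/\ derivable f (x + h) (basis_vec i),
      derivable (partial i f) (x + h) (basis_vec j),
      derivable (partial j (partial i f)) (x + h) (basis_vec l) &
      `|partial l (partial j (partial i f)) (x + h)| <= G].

Lemma taylor0 h i j : eucl h < r ->
  `|partial j (partial i f) (x + h) - partial j (partial i f) x|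
    <= n%:R * (eucl h * G).
Proof.
move=> hr; have tel := @edge_telescope (partial j (partial i f)) x h (fun=> 0) (eucl h * G).
suff : `|partial j (partial i f) (x + h) - partial j (partial i f) x - \sum_(l < n) 0|
    <= n%:R * (eucl h * G) by rewrite [\sum_(l < n) 0]big1_eq subr0.
apply: tel => l.
have inr t : `|t| <= `|h l 0| -> eucl (edge h l t) < r.
  by move=> /eucl_edge/le_lt_trans; apply.
have := @edge_mvt (partial j (partial i f)) x h l (fun=> 0) (fun=> 0) G.
rewrite [0 - 0]subr0; apply.
- by move=> t /inr/fG-/(_ i j l)[].
- by move=> t /inr/fG-/(_ i j l)[]; rewrite subr0.
Qed.

Lemma taylor1 h i : eucl h < r ->
  `|partial i f (x + h) - partial i f x -
    \sum_l h l 0 * partial l (partial i f) x|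
    <= n%:R * (eucl h * (n%:R * (eucl h * G))).
Proof.
move=> hr; apply: edge_telescope => l.
have inr t : `|t| <= `|h l 0| -> eucl (edge h l t) < r.
  by move=> /eucl_edge/le_lt_trans; apply.
have G0 : 0 <= G.
  by have [_ _ _ /(le_trans (normr_ge0 _))] := fG hr i i i.
have := @edge_mvt (partial i f) x h l (fun t => t * partial l (partial i f) x)
  (fun=> partial l (partial i f) x) (n%:R * (eucl h * G)).
rewrite mul0r subr0; apply.
- by move=> t; apply: is_derive_eq; rewrite /GRing.scale/=; ring.
- by move=> t /inr/fG-/(_ i l l)[].
move=> t th; apply: (le_trans (taylor0 i l (inr _ th))).
by rewrite ler_wpM2l// ler_wpM2r// eucl_edge.
Qed.

Definition taylor_quad h : R := \sum_(i < n)
  (\sum_(l < n | (l < i)%N) h l 0 * h i 0 * partial l (partial i f) x +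
   2^-1 * h i 0 ^+ 2 * partial i (partial i f) x).

(** Third-order expansion under separate differentiability in the coordinate
    directions only.  The mixed second derivatives enter in the order in which
    the broken line meets the axes, so that they need not be symmetric. *)
Lemma taylor2 h : eucl h < r ->
  `|f (x + h) - f x - (\sum_i h i 0 * partial i f x + taylor_quad h)|
    <= n%:R ^+ 3 * G * eucl h ^+ 3.
Proof.
move=> hr; rewrite -big_split/=.
have -> : n%:R ^+ 3 * G * eucl h ^+ 3 =
  n%:R * (eucl h * (n%:R * (eucl h * (n%:R * (eucl h * G))))) by ring.
apply: edge_telescope => i.
have inr t : `|t| <= `|h i 0| -> eucl (edge h i t) < r.
  by move=> /eucl_edge/le_lt_trans; apply.
have G0 : 0 <= G.
  by have [_ _ _ /(le_trans (normr_ge0 _))] := fG hr i i i.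
pose A := partial i f x + \sum_(l < n | (l < i)%N) h l 0 * partial l (partial i f) x.
pose c := partial i (partial i f) x.
have := @edge_mvt f x h i (fun t => t * A + 2^-1 * t ^+ 2 * c) (fun t => A + t * c)
  (n%:R * (eucl h * (n%:R * (eucl h * G)))).
have -> : h i 0 * A + 2^-1 * h i 0 ^+ 2 * c - (0 * A + 2^-1 * 0 ^+ 2 * c) =
    h i 0 * partial i f x +
    (\sum_(l < n | (l < i)%N) h l 0 * h i 0 * partial l (partial i f) x +
     2^-1 * h i 0 ^+ 2 * partial i (partial i f) x).
  rewrite expr0n/= mulr0 !mul0r addr0 subr0 /A mulrDr -addrA mulr_sumr.
  congr (_ + (_ + _)); apply: eq_bigr => l _; by ring.
apply.
- by move=> t; apply: is_derive_eq; rewrite /GRing.scale/=; field.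
- by move=> t /inr/fG-/(_ i i i)[].
move=> t th; have := taylor1 i (inr _ th).
have -> : \sum_l edge h i t l 0 * partial l (partial i f) x =
    \sum_(l < n | (l < i)%N) h l 0 * partial l (partial i f) x + t * c.
  rewrite (bigID (fun l : 'I_n => (l < i)%N))/=; congr (_ + _).
    by apply: eq_bigr => l li; rewrite mxE li.
  rewrite (bigD1 i) ?ltnn//= big1 ?addr0 => [|l /andP[li ne]].
    by rewrite mxE ltnn eqxx.
  by rewrite mxE (negbTE li) (negbTE ne) mul0r.
rewrite /A opprD addrA -[X in `|X|]addrA -opprD => h1.
have -> : partial i f (x + edge h i t) -
    (partial i f x + \sum_(l < n | (l < i)%N) h l 0 * partial l (partial i f) x + t * c) =
    partial i f (x + edge h i t) - partial i f x -
    (\sum_(l < n | (l < i)%N) h l 0 * partial l (partial i f) x + t * c) by ring.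
apply: (le_trans h1).
by rewrite ler_wpM2l// ler_pM ?eucl_edge ?mulr_ge0 ?eucl_ge0// ler_wpM2l// ler_wpM2r// eucl_edge.
Qed.

End third_order.

Lemma taylor_quadZ f x (t : R) h : taylor_quad f x (t *: h) = t ^+ 2 * taylor_quad f x h.
Proof.
rewrite mulr_sumr; apply: eq_bigr => i _; rewrite mulrDr mulr_sumr !mxE.
congr (_ + _); last by ring.
by apply: eq_bigr => l _; rewrite !mxE; ring.
Qed.

Lemma taylor_quad_bound f x : exists2 C : R, 0 <= C &
  forall h, `|taylor_quad f x h| <= C * eucl h ^+ 2.
Proof.
exists (\sum_(i < n) (\sum_(l < n | (l < i)%N) `|partial l (partial i f) x| +
                `|partial i (partial i f) x|)).
  by apply: sumr_ge0 => i _; rewrite addr_ge0// sumr_ge0.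
move=> h; rewrite mulr_suml (le_trans (ler_norm_sum _ _ _))//.
apply: ler_sum => i _; rewrite mulrDl (le_trans (ler_normD _ _))// lerD//.
  rewrite mulr_suml (le_trans (ler_norm_sum _ _ _))//; apply: ler_sum => l _.
  by rewrite !normrM mulrC ler_wpM2l// expr2 ler_pM// eucl_entry.
have -> : `|2^-1 * h i 0 ^+ 2 * partial i (partial i f) x| =
    2^-1 * `|h i 0| ^+ 2 * `|partial i (partial i f) x|.
  by rewrite 2!normrM normrX (ger0_norm (_ : 0 <= 2^-1 :> R)).
rewrite mulrC ler_wpM2l//.
have : `|h i 0| ^+ 2 <= eucl h ^+ 2 by rewrite lerXn2r ?nnegrE ?eucl_ge0 ?eucl_entry.
by have := sqr_ge0 `|h i 0|; lra.
Qed.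

End taylor.

Section euclidean_topology.
Context {R : realType} {n : nat}.
Implicit Types (x y : 'cV[R]_n).

Lemma nbhs_eucl x (A : set 'cV[R]_n) :
  nbhs x A <-> exists2 r : R, 0 < r & forall y, eucl (y - x) < r -> A y.
Proof.
split=> [/nbhs_ballP[r /= r0 h]|[r r0 h]].
  exists r => // y yr; apply: h; rewrite -ball_normE /ball_/=.
  by rewrite (le_lt_trans (normmx_le_eucl _))// euclBC.
have n0 : 0 < n.+1%:R :> R by rewrite ltr0n.
apply/nbhs_ballP; exists (r / n.+1%:R) => /=; first by rewrite divr_gt0.
move=> y; rewrite -ball_normE /ball_/= distrC ltr_pdivlMr// => yr.
apply: h; apply: le_lt_trans yr; rewrite mulrC.
by rewrite (le_trans (eucl_le_normmx _))// ler_wpM2r// ler_nat.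
Qed.

Lemma nbhs_eucl_ball x (r : R) : 0 < r -> nbhs x [set y | eucl (y - x) < r].
Proof. by move=> r0; apply/nbhs_eucl; exists r. Qed.

End euclidean_topology.

Lemma esum_ge_seq {R : realType} (T : choiceType) (a : T -> R) (s : seq T) :
  uniq s -> ((\sum_(x <- s) a x)%:E <= \esum_(x in [set: T]) (a x)%:E)%E.
Proof.
move=> us; apply: esum_ge; exists [set` s].
  by split=> //; exact: finite_seq.
by rewrite -sumEFin (fsbig_seq _ _ us).
Qed.

Lemma esum_ge_term {R : realType} (T : choiceType) (a : T -> R) (x : T) :
  ((a x)%:E <= \esum_(y in [set: T]) (a y)%:E)%E.
Proof. by rewrite -[a x](big_seq1 +%R x a); exact: esum_ge_seq. Qed.

Section signal.
Context {R : realType} {d M Kx Ky : nat} (S : frame_model R d M Kx Ky).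
Implicit Types (theta : 'cV[R]_(M * d)) (k : pixel Kx Ky) (I : R).

(** Locked so that positivity conditions on it are not split into conditions on
    its three factors. *)
Definition area_time : R := locked (Dt S * Dx S * Dy S).

Lemma area_time_gt0 : 0 < area_time.
Proof. by rewrite /area_time -lock !mulr_gt0 ?Dx_gt0 ?Dy_gt0 ?Dt_gt0. Qed.

Lemma mean_countE I k theta :
  mean_count S I k theta = area_time * I * signal S k theta + bg S k.
Proof. by rewrite /area_time -lock. Qed.

Lemma signal_ge0 k theta : Theta S theta -> 0 <= signal S k theta.
Proof.
move=> [fovT _]; apply: sumr_ge0 => m _.
rewrite mulr_ge0 ?(ltW (weight_gt0 _ _))// mulr_ge0//.
  by rewrite invr_ge0 mulr_ge0// ltW ?Dx_gt0 ?Dy_gt0.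
by apply: Rintegral_ge0 => u _; have [_ q0 _] := psf_density m (fovT m).
Qed.

Lemma mean_count_ge_bg I k theta : 0 < I -> Theta S theta ->
  bg S k <= mean_count S I k theta.
Proof.
move=> I0 Tt; rewrite mean_countE lerDr; apply: mulr_ge0; last exact: signal_ge0.
by rewrite ltW// mulr_gt0// area_time_gt0.
Qed.

Lemma mean_count_gt0 I k theta : 0 < I -> Theta S theta ->
  0 < mean_count S I k theta.
Proof.
by move=> I0 Tt; rewrite (lt_le_trans (bg_gt0 S k))// mean_count_ge_bg.
Qed.

Definition zero_frame : frame Kx Ky := [ffun=> 0%N].

Definition add_photon k (x : frame Kx Ky) : frame Kx Ky :=
  [ffun k' => (x k' + (k' == k))%N].

(** Adding one photon to pixel [k] multiplies the probability of a frame by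
    [v_k / (x_k + 1)]. *)
Lemma frame_pmf_add_photon I theta k (x : frame Kx Ky) : 0 < I -> Theta S theta -> x k = 0%N ->
  frame_pmf S I theta (add_photon k x) =
  mean_count S I k theta * frame_pmf S I theta x.
Proof.
move=> I0 Tt xk; rewrite /frame_pmf (bigD1 k)//= [in RHS](bigD1 k)//= mulrA.
congr (_ * _).
  rewrite ffunE eqxx xk /poisson_pmf mean_count_gt0// addn1.
  by rewrite expr1 expr0 !fact0 !factS fact0 muln1 invr1 !mulr1 mul1r.
by apply: eq_bigr => k' ne; rewrite ffunE (negbTE ne) addn0.
Qed.

Lemma frame_pmf_gt0 I theta (x : frame Kx Ky) : 0 < I -> Theta S theta ->
  0 < frame_pmf S I theta x.
Proof.
move=> I0 Tt; apply: prodr_gt0 => k _; rewrite /poisson_pmf mean_count_gt0//.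
by rewrite !mulr_gt0 ?expR_gt0 ?exprn_gt0 ?mean_count_gt0// invr_gt0 ltr0n fact_gt0.
Qed.

Lemma cvg_of_linear_remainder (A : set 'cV[R]_(M * d)) (g : 'cV[R]_(M * d) -> R)
    theta (c : 'cV[R]_(M * d)) (r : R) : 0 < r -> 0 <= g theta ->
  (forall t, A t -> eucl (t - theta) < r ->
     (g t - g theta - 2^-1 * dot (t - theta) c * g theta) ^+ 2 <= eucl (t - theta) ^+ 2) ->
  g t @[t --> within A (nbhs theta)] --> g theta.
Proof.
move=> r0 g0 hg; pose C := 1 + 2^-1 * eucl c * g theta.
have C0 : 0 < C by rewrite ltr_wpDr// !mulr_ge0 ?eucl_ge0.
apply/cvgrPdist_le => e e0.
apply/nbhs_eucl; exists (Num.min r (e / C)); first by rewrite lt_min r0 divr_gt0.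
move=> t; rewrite lt_min => /andP[tr te] At.
have h1 : `|g t - g theta - 2^-1 * dot (t - theta) c * g theta| <= eucl (t - theta).
  by rewrite -(@ler_pXn2r _ 2) ?nnegrE ?eucl_ge0// real_normK ?num_real ?hg.
rewrite distrC.
have -> : g t - g theta = (g t - g theta - 2^-1 * dot (t - theta) c * g theta) +
   2^-1 * dot (t - theta) c * g theta by ring.
apply: (le_trans (ler_normD _ _)).
have h2 : `|2^-1 * dot (t - theta) c * g theta| <=
    eucl (t - theta) * (2^-1 * eucl c * g theta).
  have s00 : 0 <= 2^-1 * g theta by rewrite mulr_ge0.
  rewrite 2!normrM (ger0_norm g0) (ger0_norm (_ : 0 <= 2^-1 :> R))//.
  by have := ler_wpM2r s00 (cauchy_schwarz (t - theta) c); lra.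
apply: (le_trans (lerD h1 h2)).
rewrite -[X in X + _]mulr1 -mulrDr -/C.
by rewrite -ler_pdivlMr// ltW.
Qed.

(** Differentiability in quadratic mean makes the square root of each
    probability continuous on the parameter set. *)
Lemma sqrt_pmf_continuous I theta (x : frame Kx Ky) : quad_mean_differentiable S I ->
  Theta S theta ->
  Num.sqrt (frame_pmf S I t x) @[t --> within (Theta S) (nbhs theta)] -->
  Num.sqrt (frame_pmf S I theta x).
Proof.
move=> qmd Tt; have [score hs] := qmd theta Tt.
have [r r0 hr] := hs 1 ltr01.
apply: (@cvg_of_linear_remainder _ (fun t => Num.sqrt (frame_pmf S I t x)) theta (score x) r r0).
  exact: sqrtr_ge0.
move=> t Tt' tr; rewrite -dotE -[leRHS]mul1r -lee_fin.
apply: le_trans (hr t Tt' tr).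
exact: (@esum_ge_term R (frame Kx Ky) (fun y => (Num.sqrt (frame_pmf S I t y) -
  Num.sqrt (frame_pmf S I theta y) - 2^-1 * ((t - theta)^T *m score y) 0 0 *
  Num.sqrt (frame_pmf S I theta y)) ^+ 2) x).
Qed.

Lemma signal_continuous I k theta : 0 < I -> regular_intensity S I ->
  Theta S theta ->
  signal S k t @[t --> within (Theta S) (nbhs theta)] --> signal S k theta.
Proof.
move=> I0 [_ reg] Tt.
have AI0 : 0 < area_time * I by rewrite mulr_gt0 ?area_time_gt0.
have sE t : signal S k t = (area_time * I)^-1 * (mean_count S I k t - bg S k).
  by rewrite mean_countE addrK mulKf ?gt_eqF.
suff : mean_count S I k t @[t --> within (Theta S) (nbhs theta)] --> mean_count S I k theta.
  move=> h; under eq_fun do rewrite sE; rewrite (sE theta).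
  by apply: cvgMr; apply: cvgB => //; exact: cvg_cst.
case: reg => [ck|qmd].
  have [U [g [oU TU [cg _] gE]]] := ck k.
  rewrite -gE//; apply: (@cvg_trans _ (g t @[t --> within (Theta S) (nbhs theta)])).
    by apply: near_eq_cvg; apply/nbhs_eucl; exists 1 => // t _ /gE ->.
  by apply: cvg_within_filter; apply: cg; exact: TU.
pose q t := Num.sqrt (frame_pmf S I t (add_photon k zero_frame)) *
     (Num.sqrt (frame_pmf S I t zero_frame))^-1.
have mcE t : Theta S t -> mean_count S I k t = q t * q t.
  move=> Tt'; have p0 := frame_pmf_gt0 zero_frame I0 Tt'.
  rewrite -expr2 exprMn exprVn !sqr_sqrtr ?(ltW p0)//.
    by rewrite frame_pmf_add_photon ?ffunE// mulfK// gt_eqF.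
  by rewrite ltW// frame_pmf_gt0.
have cq : q t @[t --> within (Theta S) (nbhs theta)] --> q theta.
  apply: cvgM; first exact: sqrt_pmf_continuous.
  apply: cvgV; last exact: sqrt_pmf_continuous.
  by rewrite gt_eqF// sqrtr_gt0 frame_pmf_gt0.
rewrite mcE//.
apply: (@cvg_trans _ (q t * q t @[t --> within (Theta S) (nbhs theta)])).
  by apply: near_eq_cvg; apply/nbhs_eucl; exists 1 => // t _ /mcE ->.
exact: cvgM.
Qed.

End signal.

Section regularity.
Context {R : realType} {d M Kx Ky : nat} (S : frame_model R d M Kx Ky).
Local Notation n := (M * d)%N.
Local Notation A0 := (area_time S).
Variable theta0 : 'cV[R]_n.
Implicit Types (h : 'cV[R]_n) (k : pixel Kx Ky) (x : frame Kx Ky) (I : R).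

Lemma loglik1_add_photon I k x theta :
  loglik1 S I (add_photon k x) theta =
  loglik1 S I x theta + ln (mean_count S I k theta).
Proof.
rewrite /loglik1 (bigD1 k)//= [in RHS](bigD1 k)//= ffunE eqxx natrD mulrDl mul1r.
rewrite (eq_bigr (fun k' => (x k')%:R * ln (mean_count S I k' theta) -
  mean_count S I k' theta)); last by move=> k' ne; rewrite ffunE (negbTE ne) addn0.
by ring.
Qed.

(** Third-order expansion at [theta0] of the logarithm of the mean count of
    pixel [k]. *)
Definition log_expansion I k (r B : R) := exists l : 'cV[R]_n, exists q : 'cV[R]_n -> R,
  [/\ forall (t : R) h, q (t *: h) = t ^+ 2 * q h,
      exists2 C : R, 0 <= C & forall h, `|q h| <= C * eucl h ^+ 2 &
      forall h, eucl h < r ->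
        `|ln (mean_count S I k (theta0 + h)) - ln (mean_count S I k theta0) -
          (dot l h + q h)| <= B * eucl h ^+ 3].

(** The log-likelihoods of two frames that differ by one photon in pixel [k]
    differ by the logarithm of the mean count of that pixel. *)
Lemma log_expansion_of_envelope I (G : frame Kx Ky -> R) (r : R) k x :
  (forall x theta, eucl (theta - theta0) < r ->
     thrice_derivable_bounded (loglik1 S I x) theta (G x)) ->
  log_expansion I k r (n%:R ^+ 3 * (G x + G (add_photon k x))).
Proof.
move=> hG.
have ft y h : eucl h < r -> forall i j l,
   [/\ derivable (loglik1 S I y) (theta0 + h) (basis_vec i),
      derivable (partial i (loglik1 S I y)) (theta0 + h) (basis_vec j),
      derivable (partial j (partial i (loglik1 S I y))) (theta0 + h) (basis_vec l) &
      `|partial l (partial j (partial i (loglik1 S I y))) (theta0 + h)| <= G y].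
  by move=> hr; apply: hG; rewrite addrC addKr.
pose f := loglik1 S I x; pose g := loglik1 S I (add_photon k x).
exists (\col_i (partial i g theta0 - partial i f theta0)).
exists (fun h => taylor_quad g theta0 h - taylor_quad f theta0 h); split.
- by move=> t h; rewrite !taylor_quadZ mulrBr.
- have [C1 C10 h1] := taylor_quad_bound g theta0.
  have [C2 C20 h2] := taylor_quad_bound f theta0.
  exists (C1 + C2) => [|h]; first exact: addr_ge0.
  by rewrite (le_trans (ler_normB _ _))// mulrDl lerD.
move=> h hr.
have t1 := taylor2 (ft (add_photon k x)) hr; have t2 := taylor2 (ft x) hr.
have lnE t : ln (mean_count S I k t) = g t - f t.
  by rewrite /g loglik1_add_photon addrC addKr.
rewrite !lnE.
have -> : dot (\col_i (partial i g theta0 - partial i f theta0)) h =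
  \sum_i h i 0 * partial i g theta0 - \sum_i h i 0 * partial i f theta0.
  by rewrite -sumrB; apply: eq_bigr => i _; rewrite mxE; ring.
rewrite -/g -/f in t1 t2; clearbody f g.
have aux (g1 g0 gl gq f1 f0 fl fq A B : R) :
    `|g1 - g0 - (gl + gq)| <= A -> `|f1 - f0 - (fl + fq)| <= B ->
    `|g1 - f1 - (g0 - f0) - (gl - fl + (gq - fq))| <= B + A.
  move=> hA hB; have -> : g1 - f1 - (g0 - f0) - (gl - fl + (gq - fq)) =
     (g1 - g0 - (gl + gq)) - (f1 - f0 - (fl + fq)) by ring.
  by rewrite (le_trans (ler_normB _ _))// addrC lerD.
rewrite mulrDr mulrDl; exact: aux t1 t2.
Qed.

Hypothesis int0 : exists2 r : R, 0 < r & forall h, eucl h < r -> Theta S (theta0 + h).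

Lemma signal_expansion I k (r B : R) : 0 < I -> 0 < r -> log_expansion I k r B ->
  exists m : 'cV[R]_n, exists C r' : R, [/\ 0 <= C, 0 < r' &
    forall h, eucl h < r' ->
      `|signal S k (theta0 + h) - signal S k theta0 - dot m h| <= C * eucl h ^+ 2].
Proof.
move=> I0 r0 [l [q [_ [Cq Cq0 hq] hlog]]].
have [rT rT0 hT] := int0.
have T0 : Theta S theta0 by rewrite -(addr0 theta0); apply: hT; rewrite eucl0.
pose v h := mean_count S I k (theta0 + h); pose v0 := mean_count S I k theta0.
have v00 : 0 < v0 by exact: mean_count_gt0.
pose B' := Num.max B 0.
have B'0 : 0 <= B' by rewrite le_max lexx orbT.
pose C1 := Cq + B'; pose C2 := eucl l + C1.
have C10 : 0 <= C1 by rewrite addr_ge0.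
have C20 : 0 <= C2 by rewrite addr_ge0 ?eucl_ge0.
have AI : 0 < A0 * I by rewrite mulr_gt0 ?area_time_gt0.
have W0 : 0 <= v0 / (A0 * I) by apply: divr_ge0; exact: ltW.
exists ((v0 / (A0 * I)) *: l), (v0 * (C1 + C2 ^+ 2 * expR C2) / (A0 * I)),
  (Num.min 1 (Num.min r rT)); split.
- apply: divr_ge0; last exact: ltW.
  apply: mulr_ge0; first exact: ltW.
  by rewrite addr_ge0// mulr_ge0 ?expR_ge0// exprn_ge0.
- by rewrite !lt_min ltr01 r0 rT0.
move=> h; rewrite !lt_min => /and3P[h1 hr hrT].
have e0 := eucl_ge0 h.
have vh0 : 0 < v h by apply: mean_count_gt0 => //; exact: hT.
pose u := ln (v h) - ln v0.
have vE : v h = v0 * expR u.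
  by rewrite /u expRB !lnK ?posrE// mulrC divfK// gt_eqF.
have u1 : `|u - dot l h| <= C1 * eucl h ^+ 2.
  have := hlog h hr; rewrite -/(v h) -/v0 -/u => h2.
  have -> : u - dot l h = (u - (dot l h + q h)) + q h by ring.
  rewrite (le_trans (ler_normD _ _))// /C1 mulrDl addrC lerD//.
  apply: (le_trans h2); apply: (@le_trans _ _ (B' * eucl h ^+ 3)).
    by rewrite ler_wpM2r ?exprn_ge0// le_max lexx.
  by rewrite ler_wpM2l// exprS ler_piMl ?sqr_ge0// ltW.
have u2 : `|u| <= C2 * eucl h.
  have -> : u = (u - dot l h) + dot l h by ring.
  rewrite (le_trans (ler_normD _ _))// /C2 mulrDl addrC lerD//.
    exact: cauchy_schwarz.
  by rewrite (le_trans u1)// ler_wpM2l// expr2 ler_piMl// ltW.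
have u3 : `|u| <= C2 by rewrite (le_trans u2)// ler_piMr// ltW.
have sE t : signal S k t = (mean_count S I k t - bg S k) / (A0 * I).
  by rewrite mean_countE addrK mulrC mulKf// gt_eqF.
rewrite !sE dotZl -/(v h) -/v0 vE.
have -> : (v0 * expR u - bg S k) / (A0 * I) - (v0 - bg S k) / (A0 * I) -
    v0 / (A0 * I) * dot l h =
    v0 / (A0 * I) * ((expR u - 1 - u) + (u - dot l h)) by field; rewrite ?gt_eqF ?area_time_gt0.
rewrite normrM (ger0_norm W0).
have -> : v0 * (C1 + C2 ^+ 2 * expR C2) / (A0 * I) * eucl h ^+ 2 =
   v0 / (A0 * I) * (C1 * eucl h ^+ 2 + C2 ^+ 2 * expR C2 * eucl h ^+ 2) by ring.
rewrite ler_wpM2l// (le_trans (ler_normD _ _))// addrC lerD//.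
apply: (le_trans (norm_expR1DB_le u)).
have -> : C2 ^+ 2 * expR C2 * eucl h ^+ 2 = (C2 * eucl h) ^+ 2 * expR C2 by ring.
rewrite -(real_normK (num_real u)) ler_pM ?expR_ge0 ?sqr_ge0 ?ler_expR//.
by rewrite lerXn2r ?nnegrE ?mulr_ge0.
Qed.

Lemma linear_small_eq0 (a C t0 : R) : 0 < t0 ->
  (forall t, 0 < t -> t <= t0 -> `|a| * t <= C * t ^+ 2) -> a = 0.
Proof.
move=> t00 h; apply/eqP; rewrite -normr_le0; apply/ler_addgt0Pl => e e0.
rewrite addr0; pose t := Num.min t0 (e / (`|C| + 1)).
have C1 : 0 < `|C| + 1 by rewrite ltr_wpDl.
have t1 : 0 < t by rewrite lt_min t00 divr_gt0.
have := h t t1; rewrite ge_min lexx => /(_ isT).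
rewrite expr2 mulrA ler_pM2r// => /le_trans; apply.
have te : t <= e / (`|C| + 1) by rewrite ge_min lexx orbT.
rewrite ler_pdivlMr// mulrDr mulr1 in te.
have : C * t <= `|C| * t by rewrite ler_wpM2r ?ler_norm// ltW.
by rewrite mulrC (mulrC `|C|); lra.
Qed.

Lemma gradient_eq0 (s : 'cV[R]_n -> R) (m : 'cV[R]_n) (C r : R) : 0 < r ->
  (forall h, eucl h < r -> 0 <= s h) ->
  (forall h, eucl h < r -> `|s h - dot m h| <= C * eucl h ^+ 2) -> m = 0.
Proof.
move=> r0 s0 hs; apply: eucl_eq0.
suff : eucl m ^+ 2 = 0 by move/eqP; rewrite expf_eq0 => /andP[_ /eqP].
have e0 := eucl_ge0 m.
have e1 : 0 < eucl m + 1 by rewrite ltr_wpDl.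
apply: (@linear_small_eq0 _ (C * eucl m ^+ 2) (r / 2 / (eucl m + 1))).
  by rewrite !divr_gt0.
move=> t t0; rewrite ler_pdivlMr// => tr.
have E : eucl (- t *: m) = t * eucl m by rewrite euclZ normrN gtr0_norm.
have inr : eucl (- t *: m) < r by rewrite E; nra.
have := hs _ inr; have := s0 _ inr; rewrite E dotZr -sqr_eucl.
rewrite (ger0_norm (sqr_ge0 (eucl m))) => p1; rewrite ler_norml => /andP[_ p2].
by rewrite exprMn in p2; lra.
Qed.

Lemma derive_of_expansion (f : 'cV[R]_n -> R) (m : 'cV[R]_n) (C r : R) i : 0 < r ->
  (forall h, eucl h < r ->
     `|f (theta0 + h) - f theta0 - dot m h| <= C * eucl h ^+ 2) ->
  partial i f theta0 = m i 0.
Proof.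
move=> r0 hf; rewrite /partial /derive; apply: cvg_lim => //.
apply/cvgrPdist_le => e e0; near=> t.
have t0 : t != 0 by near: t; exact: nbhs_dnbhs_neq.
have Eb : eucl (t *: basis_vec i : 'cV[R]_n) = `|t|.
  by rewrite euclZ euclE dot_delta mxE !eqxx sqrtr1 mulr1.
have tr : `|t| < r.
  by near: t; apply: dnbhs0_lt.
have := hf (t *: basis_vec i); rewrite Eb => /(_ tr) h.
rewrite /= (addrC _ theta0) -[X in m i 0 - X]/(t^-1 * _).
rewrite distrC.
have -> : t^-1 * (f (theta0 + t *: basis_vec i) - f theta0) - m i 0 =
  t^-1 * (f (theta0 + t *: basis_vec i) - f theta0 - dot m (t *: basis_vec i)).
  by rewrite dotZr dot_delta; field.
rewrite normrM normfV mulrC ler_pdivrMr ?normr_gt0//.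
apply: (le_trans h); rewrite expr2 mulrA ler_wpM2r//.
apply: (@le_trans _ _ (`|C| * `|t|)); first by rewrite ler_wpM2r ?ler_norm.
have tC : `|t| <= e / (`|C| + 1).
  by apply: ltW; near: t; apply: dnbhs0_lt; rewrite divr_gt0// ltr_wpDl.
rewrite ler_pdivlMr ?ltr_wpDl// mulrDr mulr1 in tC.
by have := normr_ge0 t; rewrite mulrC; lra.
Unshelve. all: by end_near. Qed.

End regularity.

Section dark_pixels.
Context {R : realType} {d M Kx Ky : nat} (S : frame_model R d M Kx Ky).
Local Notation n := (M * d)%N.
Local Notation A0 := (area_time S).
Variable theta0 : 'cV[R]_n.
Hypothesis T0 : Theta S theta0.
Implicit Types (h : 'cV[R]_n) (k : pixel Kx Ky) (x : frame Kx Ky) (I : R).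

Definition box_frame N (y : {ffun pixel Kx Ky -> 'I_N}) : frame Kx Ky :=
  [ffun k => val (y k)].

Lemma box_frame_inj N : injective (@box_frame N).
Proof.
move=> y z yz; apply/ffunP => k; apply/val_inj.
by have := congr1 (fun x : frame Kx Ky => x k) yz; rewrite !ffunE.
Qed.

Lemma add_photon_inj k : injective (@add_photon Kx Ky k).
Proof.
move=> x y xy; apply/ffunP => k'.
have := congr1 (fun x : frame Kx Ky => x k') xy; rewrite !ffunE; exact: addIn.
Qed.

Lemma cvg_poisson_mass (lam : R) : 0 < lam ->
  \sum_(j < N) poisson_pmf lam j @[N --> \oo] --> (1 : R).
Proof.
move=> lam0.
have h : series (exp_coeff lam) N * expR (- lam) @[N --> \oo] --> expR lam * expR (- lam).
  by apply: cvgM; [exact: is_cvg_series_exp_coeff|exact: cvg_cst].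
rewrite -expRD subrr expR0 in h.
rewrite [X in X @ _ --> _](_ : _ = (fun N => series (exp_coeff lam) N * expR (- lam))) //.
apply/funext => N; rewrite /series/= big_mkord mulr_suml; apply: eq_bigr => j _.
by rewrite /poisson_pmf lam0.
Qed.

(** The event [x_k = 0] keeps its probability [exp (- v_k)] when the counts of
    the other pixels are truncated at a high level. *)
Lemma box_mass I k : 0 < I -> exists N,
  expR (- mean_count S I k theta0) / 2 <=
  \sum_(y : {ffun pixel Kx Ky -> 'I_N.+1} | y k == ord0)
     frame_pmf S I theta0 (box_frame y).
Proof.
move=> I0; pose v k' := mean_count S I k' theta0.
have v0 k' : 0 < v k' by exact: mean_count_gt0.
have E N : \sum_(y : {ffun pixel Kx Ky -> 'I_N.+1} | y k == ord0)
     frame_pmf S I theta0 (box_frame y) =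
   expR (- v k) * \prod_(k' | k' != k) \sum_(j < N.+1) poisson_pmf (v k') j.
  pose Q k' : pred 'I_N.+1 := if k' == k then pred1 ord0 else predT.
  transitivity (\prod_k' \sum_(j < N.+1 | Q k' j) poisson_pmf (v k') j).
    rewrite bigA_distr_big_dep; apply: eq_big => [y|y _].
      apply/idP/familyP => [yk k'|/(_ k)]; last by rewrite /Q eqxx.
      by rewrite /Q; case: eqP => [->|].
    by apply: eq_bigr => k' _; rewrite ffunE.
  rewrite (bigD1 k)//= {1}/Q eqxx big_pred1_eq; congr (_ * _).
    by rewrite /poisson_pmf v0 expr0 fact0 invr1 !mul1r.
  by apply: eq_bigr => k' ne; apply: eq_bigl => j; rewrite /Q (negbTE ne).
have lim : \prod_(k' | k' != k) \sum_(j < N) poisson_pmf (v k') j @[N --> \oo] --> (1 : R).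
  rewrite [X in _ --> X](_ : (1 : R) = \prod_(k' | k' != k) (1 : R)); last first.
    by rewrite big1_eq.
  apply: (@cvg_big R _ *%R 1) => [|k' _]; first exact: mul_continuous.
  exact: cvg_poisson_mass.
have [N _ hN] : \forall N \near \oo, 2^-1 <=
    \prod_(k' | k' != k) \sum_(j < N) poisson_pmf (v k') j.
  by apply: (cvgr_ge _ lim); lra.
exists N; rewrite E ler_wpM2l ?expR_ge0//; apply: hN; exact: leqnSn.
Qed.

(** Averaging the envelope over the frames with no photon in pixel [k] and
    over the same frames with one photon added yields a frame at which both
    values are of the order of the mean. *)
Lemma frame_below_envelope I k (G : frame Kx Ky -> R) (C : R) :
  0 < I -> (forall x, 0 <= G x) ->
  (\esum_(x in [set: frame Kx Ky]) (frame_pmf S I theta0 x * G x)%:E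
       <= (C * I)%:E)%E ->
  exists2 x : frame Kx Ky, x k = 0%N & G x + G (add_photon k x) <=
    (4 * C * expR (mean_count S I k theta0) / Num.min 1 (mean_count S I k theta0) + 1) * I.
Proof.
move=> I0 G0 hG; set v := mean_count S I k theta0.
have v0 : 0 < v by exact: mean_count_gt0.
pose mn := Num.min 1 v; have mn0 : 0 < mn by rewrite lt_min ltr01.
set B := (_ * I); apply: contrapT => no.
have big (x : frame Kx Ky) : x k = 0%N -> B < G x + G (add_photon k x).
  by move=> xk; rewrite ltNge; apply/negP => h; apply: no; exists x.
have [N mass] := box_mass k I0; rewrite -/v in mass.
pose s := [seq box_frame y | y <- enum [pred y : {ffun pixel Kx Ky -> 'I_N.+1} | y k == ord0]].
have us : uniq s by rewrite map_inj_uniq ?enum_uniq//; exact: box_frame_inj.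
have sk (x : frame Kx Ky) : x \in s -> x k = 0%N.
  by move=> /mapP[y]; rewrite mem_enum inE => /eqP yk ->; rewrite ffunE yk.
have sumE (F : frame Kx Ky -> R) : \sum_(x <- s) F x =
    \sum_(y : {ffun pixel Kx Ky -> 'I_N.+1} | y k == ord0) F (box_frame y).
  by rewrite big_map big_enum.
rewrite -(sumE (fun x => frame_pmf S I theta0 x)) in mass.
pose a (x : frame Kx Ky) : R := frame_pmf S I theta0 x * G x.
have s1 : \sum_(x <- s) a x <= C * I.
  by rewrite -lee_fin (le_trans (esum_ge_seq a us)).
have s2 : \sum_(x <- s) a (add_photon k x) <= C * I.
  have us2 : uniq (map (add_photon k) s) by rewrite map_inj_uniq//; exact: add_photon_inj.
  by have := esum_ge_seq a us2; rewrite big_map -lee_fin => /le_trans; apply.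
have p0 (x : frame Kx Ky) : 0 < frame_pmf S I theta0 x by exact: frame_pmf_gt0.
have : mn * B * \sum_(x <- s) frame_pmf S I theta0 x <= 2 * (C * I).
  apply: (@le_trans _ _ (\sum_(x <- s) (a x + a (add_photon k x)))); last first.
    by rewrite big_split/=; lra.
  rewrite mulr_sumr big_seq [leRHS]big_seq; apply: ler_sum => x /sk xk.
  rewrite /a frame_pmf_add_photon// -/v.
  have m1 : mn <= 1 by rewrite ge_min lexx.
  have m2 : mn <= v by rewrite ge_min lexx orbT.
  have := big x xk; have := G0 x; have := G0 (add_photon k x); have := p0 x.
  set p := frame_pmf _ _ _ _; set g := G x; set g' := G _ => p0x g'0 g0 bg.
  apply: (@le_trans _ _ (p * (mn * (g + g')))).
    by rewrite mulrC ler_wpM2l ?(ltW p0x)// ler_wpM2l ?(ltW mn0)// ltW.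
  have -> : p * g + v * p * g' = p * (g + v * g') by ring.
  by rewrite ler_wpM2l ?(ltW p0x)// mulrDr lerD// ?ler_wpM2r// ler_piMl.
have C0 : 0 <= C * I.
  by rewrite (le_trans _ s1)// sumr_ge0// => x _; rewrite mulr_ge0// ltW.
have B0 : 0 < B.
  rewrite /B mulr_gt0// ltr_wpDl// divr_ge0 ?(ltW mn0)// mulr_ge0 ?expR_ge0//.
  by rewrite mulr_ge0//; move: C0; rewrite pmulr_lge0.
move/le_trans => /(_ _ (lexx _)); apply/negP; rewrite -ltNge.
apply: (@lt_le_trans _ _ (mn * B * (expR (- v) / 2))); last first.
  by rewrite ler_wpM2l// mulr_ge0// ltW.
have EE : expR v * expR (- v) = 1 by rewrite -expRD subrr expR0.
have -> : mn * B * (expR (- v) / 2) =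
    2 * (C * I) * (expR v * expR (- v)) + mn * I * (expR (- v) / 2).
  by rewrite /B -/mn; field; rewrite gt_eqF.
by rewrite EE mulr1 ltrDl !mulr_gt0 ?expR_gt0.
Qed.

End dark_pixels.

Lemma log_sublinear {R : realType} (J : set R) (c X : R) : 0 <= X ->
  (forall B, exists2 I, J I & B < I) ->
  (forall I, J I -> c * I <= ln (1 + I * X)) -> c <= 0.
Proof.
move=> X0 unb h; rewrite leNgt; apply/negP => c0.
have [I JI] := unb (1 + 4 * (1 + X) / c ^+ 2).
have c2 : 0 < c ^+ 2 by rewrite exprn_gt0.
have q0 : 0 <= 4 * (1 + X) / c ^+ 2 by rewrite divr_ge0 ?(ltW c2)// mulr_ge0// addr_ge0.
move=> hI; have I1 : 1 < I by lra.
have hI2 : 4 * (1 + X) / c ^+ 2 < I by lra.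
rewrite ltr_pdivrMr// in hI2.
have p1 : 0 < 1 + I * X by rewrite ltr_wpDr// mulr_ge0//; lra.
have s0 := sqrtr_ge0 (1 + I * X).
have cI : c * I <= 2 * Num.sqrt (1 + I * X).
  by apply: (le_trans (h I JI)); have := ln_le_sqrt p1; lra.
have cI0 : 0 <= c * I by rewrite mulr_ge0 ?ltW//; lra.
have : (c * I) ^+ 2 <= 4 * (1 + I * X).
  have -> : 4 * (1 + I * X) = (2 * Num.sqrt (1 + I * X)) ^+ 2.
    by rewrite exprMn sqr_sqrtr ?ltW// expr2; ring.
  by rewrite lerXn2r ?nnegrE// mulr_ge0.
rewrite exprMn => h2.
have : (c ^+ 2 * I) * I <= (4 * (1 + X)) * I by nra.
by rewrite ler_pM2r; nra.
Qed.

Section dark_pixel_expansion.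
Context {R : realType} {d M Kx Ky : nat} (S : frame_model R d M Kx Ky).
Local Notation n := (M * d)%N.
Local Notation A0 := (area_time S).
Variables (theta0 : 'cV[R]_n) (k : pixel Kx Ky) (J : set R) (r K C2 : R).
Hypothesis J_gt0 : forall I, J I -> 0 < I.
Hypothesis J_unbounded : forall B, exists2 I, J I & B < I.
Hypothesis r0 : 0 < r.
Hypothesis K0 : 0 <= K.
Hypothesis hlog : forall I, J I -> log_expansion S theta0 I k r (K * I).
Hypothesis dark : signal S k theta0 = 0.
Hypothesis quad : forall h, eucl h < r ->
  0 <= signal S k (theta0 + h) <= C2 * eucl h ^+ 2.

Let X (h : 'cV[R]_n) : R := A0 * signal S k (theta0 + h) / bg S k.

Let X_bound (h : 'cV[R]_n) (t : R) : eucl h < r -> 0 < t -> t <= 1 ->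
  0 <= X (t *: h) <= (A0 * `|C2| * eucl h ^+ 2 / bg S k) * t ^+ 2.
Proof.
move=> hr t0 t1; have b0 := bg_gt0 S k; have a0 := area_time_gt0 S.
have E : eucl (t *: h) = t * eucl h by rewrite euclZ gtr0_norm.
have inr : eucl (t *: h) < r.
  by rewrite E (le_lt_trans _ hr)// ler_piMl// eucl_ge0.
have /andP[s0 s1] := quad inr.
rewrite /X divr_ge0 ?mulr_ge0 ?(ltW a0) ?(ltW b0)//=.
have -> : A0 * `|C2| * eucl h ^+ 2 / bg S k * t ^+ 2 =
  A0 * (`|C2| * (t * eucl h) ^+ 2) / bg S k by ring.
rewrite ler_pM2r ?invr_gt0// ler_pM2l// (le_trans s1)// E ler_wpM2r ?sqr_ge0//.
exact: ler_norm.
Qed.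

Let lnE I (h : 'cV[R]_n) : 0 < I -> eucl h < r ->
  ln (mean_count S I k (theta0 + h)) - ln (mean_count S I k theta0) = ln (1 + I * X h).
Proof.
move=> I0 hr; have b0 := bg_gt0 S k; have a0 := area_time_gt0 S.
have /andP[s0 _] := quad hr.
rewrite !mean_countE dark mulr0 add0r -ln_div ?posrE//.
  by congr ln; rewrite /X; field; rewrite gt_eqF.
by rewrite ltr_wpDl// mulr_ge0// mulr_ge0// ltW.
Qed.

(** Along a ray the logarithm has no linear term, and its quadratic term is the
    one of [I * X]. *)
Let ray_expansion I (h : 'cV[R]_n) : J I -> eucl h < r -> exists q D t0 : R,
  [/\ 0 < t0,
      forall t, 0 < t -> t <= t0 -> `|I * X (t *: h) - t ^+ 2 * q| <= D * t ^+ 3 &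
      forall t, 0 < t -> t <= 1 ->
        `|ln (1 + I * X (t *: h)) - t ^+ 2 * q| <= K * I * eucl h ^+ 3 * t ^+ 3].
Proof.
move=> JI hr; have I0 := J_gt0 JI.
have [l [q [qZ _ hq]]] := hlog JI.
pose Xc := A0 * `|C2| * eucl h ^+ 2 / bg S k.
have b0 := bg_gt0 S k; have a0 := area_time_gt0 S.
have Xc0 : 0 <= Xc.
  by rewrite divr_ge0 ?(ltW b0)// mulr_ge0 ?sqr_ge0// mulr_ge0// ltW.
have IXc0 : 0 <= I * Xc by rewrite mulr_ge0// ltW.
have e0 := eucl_ge0 h.
have KI0 : 0 <= K * I * eucl h ^+ 3 by rewrite !mulr_ge0 ?exprn_ge0// ltW.
have IX t : 0 < t -> t <= 1 -> 0 <= I * X (t *: h) <= I * Xc * t ^+ 2.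
  move=> t0 t1; have /andP[x0 x1] := X_bound hr t0 t1.
  by rewrite mulr_ge0 ?(ltW I0)//= -mulrA ler_pM2l.
have ray t : 0 < t -> t <= 1 ->
    `|ln (1 + I * X (t *: h)) - (t * dot l h + t ^+ 2 * q h)| <= K * I * eucl h ^+ 3 * t ^+ 3.
  move=> t0 t1; have E : eucl (t *: h) = t * eucl h by rewrite euclZ gtr0_norm.
  have inr : eucl (t *: h) < r by rewrite E (le_lt_trans _ hr)// ler_piMl.
  have := hq _ inr; rewrite lnE// E dotZr qZ exprMn.
  by rewrite [leRHS](_ : _ = K * I * eucl h ^+ 3 * t ^+ 3)//; ring.
have l0 : dot l h = 0.
  apply: (@linear_small_eq0 _ _ (I * Xc + `|q h| + K * I * eucl h ^+ 3) 1) => // t t0 t1.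
  have /andP[x0 x1] := IX t t0 t1.
  have := ray t t0 t1; set L := ln _ => hL.
  have L0 : 0 <= L <= I * Xc * t ^+ 2.
    rewrite /L ln_ge0 ?lerDl//= (le_trans _ x1)// le_ln1Dx//.
    by rewrite (lt_le_trans _ x0)// ltrN10.
  have -> : `|dot l h| * t = `|t * dot l h| by rewrite normrM gtr0_norm// mulrC.
  have -> : t * dot l h = L - t ^+ 2 * q h - (L - (t * dot l h + t ^+ 2 * q h)) by ring.
  rewrite (le_trans (ler_normB _ _))// !mulrDl lerD//.
    rewrite (le_trans (ler_normB _ _))// lerD//; first by rewrite ger0_norm; lra.
    by rewrite normrM ger0_norm ?sqr_ge0// mulrC.
  by rewrite (le_trans hL)// ler_wpM2l// exprS ler_piMl ?sqr_ge0.
have ray2 t : 0 < t -> t <= 1 ->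
    `|ln (1 + I * X (t *: h)) - t ^+ 2 * q h| <= K * I * eucl h ^+ 3 * t ^+ 3.
  by move=> t0 t1; have := ray t t0 t1; rewrite l0 mulr0 add0r.
exists (q h), (2 * (I * Xc) ^+ 2 + K * I * eucl h ^+ 3), (Num.min 1 (2 * (I * Xc) + 1)^-1).
split=> //; first by rewrite lt_min ltr01 invr_gt0 ltr_wpDl// mulr_ge0.
move=> t t0; rewrite le_min => /andP[t1].
have D0 : 0 < 2 * (I * Xc) + 1 by rewrite ltr_wpDl// mulr_ge0.
rewrite -[leRHS]mul1r ler_pdivlMr// => t2.
have /andP[x0 x1] := IX t t0 t1.
have tt : t ^+ 2 <= t by rewrite expr2 ler_piMl// ltW.
have y2 : `|I * X (t *: h)| <= 2^-1.
  rewrite ger0_norm// (le_trans x1)//.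
  by have : I * Xc * t ^+ 2 <= I * Xc * t by [rewrite ler_wpM2l]; lra.
have h1 := norm_ln1DB_le y2; have h2 := ray2 t t0 t1.
have -> : I * X (t *: h) - t ^+ 2 * q h =
  (ln (1 + I * X (t *: h)) - t ^+ 2 * q h) - (ln (1 + I * X (t *: h)) - I * X (t *: h)) by ring.
rewrite (le_trans (ler_normB _ _))// mulrDl addrC lerD//.
apply: (le_trans h1); rewrite -mulrA ler_wpM2l//.
apply: (@le_trans _ _ ((I * Xc * t ^+ 2) ^+ 2)).
  rewrite (ger0_norm x0) lerXn2r ?nnegrE//; exact: le_trans x1.
have t3 : t * t ^+ 3 <= t ^+ 3 by rewrite ler_piMl// exprn_ge0// ltW.
by rewrite exprMn -exprM ler_wpM2l ?sqr_ge0.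
Qed.

(** At a pixel that receives no signal at [theta0] the signal vanishes to third
    order: the quadratic coefficient of [ln (1 + I * X)] is proportional to
    [I], up to a remainder of the same order, whereas the function itself grows
    only logarithmically in [I]. *)
Lemma dark_pixel_cubic : exists C r' : R, [/\ 0 <= C, 0 < r' &
  forall h, eucl h < r' -> 0 <= signal S k (theta0 + h) <= C * eucl h ^+ 3].
Proof.
have [I1 JI1 _] := J_unbounded 0.
have I10 := J_gt0 JI1; have b0 := bg_gt0 S k; have a0 := area_time_gt0 S.
exists (bg S k / A0 * (K * expR (K * I1))), (Num.min 1 r); split.
- by rewrite mulr_ge0 ?divr_ge0 ?(ltW a0) ?(ltW b0)// mulr_ge0// expR_ge0.
- by rewrite lt_min ltr01.
move=> h; rewrite lt_min => /andP[h1 hr]; have e0 := eucl_ge0 h.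
have /andP[s0 _] := quad hr; rewrite s0/=.
have [q1 [D1 [t1 [t10 hq1 hl1]]]] := ray_expansion JI1 hr.
have prop I q : J I -> (exists D t0 : R, [/\ 0 < t0 &
    forall t, 0 < t -> t <= t0 -> `|I * X (t *: h) - t ^+ 2 * q| <= D * t ^+ 3]) ->
    q * I1 = q1 * I.
  move=> JI [D [t2 [t20 hq]]]; apply/eqP; rewrite -subr_eq0; apply/eqP.
  have I0 := J_gt0 JI.
  apply: (@linear_small_eq0 _ _ (D * I1 + D1 * I) (Num.min t1 t2)).
    by rewrite lt_min t10.
  move=> t t0; rewrite le_min => /andP[tt1 tt2].
  rewrite -(ler_pM2r t0).
  have -> : `|q * I1 - q1 * I| * t * t = `|I * (I1 * X (t *: h) - t ^+ 2 * q1) -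
      I1 * (I * X (t *: h) - t ^+ 2 * q)|.
    rewrite -mulrA -expr2 -[t ^+ 2 in LHS]ger0_norm ?sqr_ge0// -normrM.
    by congr `|_|; ring.
  rewrite (le_trans (ler_normB _ _))// !normrM (gtr0_norm I0) (gtr0_norm I10).
  have := ler_wpM2l (ltW I0) (hq1 t t0 tt1).
  have := ler_wpM2l (ltW I10) (hq t t0 tt2).
  by rewrite !exprS expr0 !mulr1; lra.
pose kap := q1 / I1.
have all I : J I -> forall t, 0 < t -> t <= 1 ->
    `|ln (1 + I * X (t *: h)) - t ^+ 2 * (kap * I)| <= K * I * eucl h ^+ 3 * t ^+ 3.
  move=> JI t t0 tle; have [q [D [t2 [t20 hq hl]]]] := ray_expansion JI hr.
  have : q * I1 = q1 * I by apply: prop => //; exists D, t2.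
  move=> e; have -> : kap * I = q by rewrite /kap mulrAC -e mulfK// gt_eqF.
  exact: hl.
have kap0 : kap = 0.
  apply: (@linear_small_eq0 _ _ (K * eucl h ^+ 3) 1) => // t t0 tle.
  rewrite -(ler_pM2r t0) -subr_le0.
  have /andP[x0 _] := X_bound hr t0 tle.
  apply: (log_sublinear x0 J_unbounded) => I JI; have I0 := J_gt0 JI.
  have := all I JI t t0 tle; rewrite ler_norml => /andP[a1 a2].
  have p1 : 0 <= ln (1 + I * X (t *: h)).
    by rewrite ln_ge0// lerDl mulr_ge0// ltW.
  have n1 := ler_norm kap.
  have [k0|k0] := leP 0 kap.
    by rewrite ger0_norm//; move: a1 a2; rewrite !exprS expr0 !mulr1; lra.
  rewrite ltr0_norm//.
  have : 0 <= t ^+ 2 * I * - kap by rewrite !mulr_ge0 ?sqr_ge0 ?ltW// oppr_gt0.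
  by move: a1 a2; rewrite !exprS expr0 !mulr1; lra.
have := all I1 JI1 1 ltr01 (lexx _).
rewrite kap0 mul0r mulr0 subr0 scale1r expr1n mulr1 => hL.
have /andP[x0 _] := X_bound hr ltr01 (lexx _); rewrite scale1r in x0.
have p1 : 0 < 1 + I1 * X h by rewrite ltr_wpDr// mulr_ge0// ltW.
set z := K * I1 * eucl h ^+ 3 in hL.
have z0 : 0 <= z by rewrite !mulr_ge0 ?exprn_ge0// ltW.
have Xz : I1 * X h <= z * expR z.
  have : 1 + I1 * X h <= expR z.
    by rewrite -[leLHS]lnK ?posrE// ler_expR (le_trans (ler_norm _)).
  have := expR_sub1_le z; rewrite (ger0_norm z0) ler_norml => /andP[_]; lra.
have zK : z <= K * I1.
  by rewrite /z ler_piMr ?mulr_ge0 ?(ltW I10)// exprn_ile1// ltW.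
have -> : signal S k (theta0 + h) = bg S k / A0 * X h.
  by rewrite /X; field; rewrite !gt_eqF.
rewrite -[leRHS]mulrA ler_wpM2l ?divr_ge0 ?(ltW b0) ?(ltW a0)//.
rewrite -(ler_pM2l I10) (le_trans Xz)//.
have -> : I1 * (K * expR (K * I1) * eucl h ^+ 3) = z * expR (K * I1) by rewrite /z; ring.
by rewrite ler_wpM2l// ler_expR.
Qed.

End dark_pixel_expansion.

Section likelihood_geometry.
Context {R : realType} {n : nat} {K : finType}.
Variables (Th : set 'cV[R]_n) (theta0 : 'cV[R]_n).
Variables (s : K -> 'cV[R]_n -> R) (b : K -> R) (m : K -> 'cV[R]_n).
Implicit Types (N I : R) (Y : K -> R) (theta h : 'cV[R]_n) (k : K).

Definition rate k I theta : R := I * s k theta + b k.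
Definition eps N I : R := (Num.sqrt (N * I))^-1.
Definition poisson_loglik Y N I theta : R :=
  \sum_k (Y k * ln (rate k I theta) - N * rate k I theta).
Definition mean_total k N I : R := N * rate k I theta0.
Definition typical_counts (kap : R) Y N I :=
  forall k, 0 <= Y k /\ `|Y k - mean_total k N I| <= kap * Num.sqrt (mean_total k N I).

Hypothesis b_gt0 : forall k, 0 < b k.
Hypothesis s_ge0 : forall k theta, Th theta -> 0 <= s k theta.
Hypothesis Th0 : Th theta0.

Lemma rate_gt0 k I theta : 0 <= I -> Th theta -> 0 < rate k I theta.
Proof. by move=> I0 Tt; rewrite ltr_wpDl// mulr_ge0// s_ge0. Qed.

(** The inequality [ln x <= 2 (sqrt x - 1)] bounds the log-likelihood ratio by
    minus [N] times the squared Hellinger distance plus a fluctuation of the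
    order of its square root; at a maximizer the distance is thus of order
    [1 / sqrt N], whatever the intensity. *)
Lemma hellinger_bound (kap : R) Y N I theta : 0 <= kap -> 0 < N -> 0 <= I ->
  typical_counts kap Y N I -> Th theta ->
  poisson_loglik Y N I theta0 <= poisson_loglik Y N I theta ->
  forall k, Num.sqrt N * `|Num.sqrt (rate k I theta) - Num.sqrt (rate k I theta0)|
    <= kap * (1 + #|K|%:R).
Proof.
move=> kap0 N0 I0 good Tt hL.
pose w k := Num.sqrt (rate k I theta); pose w0 k := Num.sqrt (rate k I theta0).
pose x k := Num.sqrt N * `|w k - w0 k|.
have x0 k : 0 <= x k by rewrite mulr_ge0// sqrtr_ge0.
have pix k : Y k * ln (rate k I theta) - N * rate k I theta -
    (Y k * ln (rate k I theta0) - N * rate k I theta0) <=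
    2 * kap * x k - x k ^+ 2.
  have v0 := rate_gt0 k I0 Th0; have v1 := rate_gt0 k I0 Tt.
  have [Y0 Yk] := good k.
  have w0p : 0 < w0 k by rewrite sqrtr_gt0.
  have w1p : 0 < w k by rewrite sqrtr_gt0.
  have h1 : ln (rate k I theta) - ln (rate k I theta0) <= 2 * (w k / w0 k - 1).
    rewrite -ln_div ?posrE//; apply: (le_trans (ln_le_sqrt _)); first by rewrite divr_gt0.
    by rewrite sqrtrM ?(ltW v1)// sqrtrV ?(ltW v0).
  have h2 := ler_wpM2l Y0 h1.
  have E1 : rate k I theta = w k ^+ 2 by rewrite sqr_sqrtr// ltW.
  have E0 : rate k I theta0 = w0 k ^+ 2 by rewrite sqr_sqrtr// ltW.
  have sl : Num.sqrt (mean_total k N I) = Num.sqrt N * w0 k.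
    by rewrite sqrtrM// ltW.
  rewrite sl in Yk.
  have xE : x k ^+ 2 = N * (w k - w0 k) ^+ 2.
    by rewrite exprMn sqr_sqrtr ?(ltW N0)// real_normK ?num_real.
  have fluct : (Y k - mean_total k N I) * (w k - w0 k) / w0 k <= kap * x k.
    apply: (le_trans (ler_norm _)); rewrite !normrM normfV (gtr0_norm w0p).
    rewrite ler_pdivrMr//.
    have -> : kap * x k * w0 k = kap * (Num.sqrt N * w0 k) * `|w k - w0 k|.
      by rewrite /x; ring.
    by rewrite ler_wpM2r.
  have E2 : Y k * (2 * (w k / w0 k - 1)) =
     2 * ((Y k - mean_total k N I) * (w k - w0 k) / w0 k) + 2 * N * (w0 k * w k - w0 k ^+ 2).
    by rewrite /mean_total E0; field; rewrite gt_eqF.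
  rewrite xE E1 E0; rewrite E1 E0 E2 mulrBr in h2.
  by rewrite !expr2 in h2 fluct *; lra.
have tot : 0 <= \sum_k (2 * kap * x k - x k ^+ 2).
  rewrite (le_trans _ (ler_sum _ (fun k _ => pix k)))// sumrB subr_ge0.
  exact: hL.
have tot2 : \sum_k (x k - kap) ^+ 2 <= #|K|%:R * kap ^+ 2.
  have -> : \sum_(k : K) (x k - kap) ^+ 2 =
      \sum_(k : K) kap ^+ 2 - \sum_(k : K) (2 * kap * x k - x k ^+ 2).
    by rewrite -sumrB; apply: eq_bigr => k _; ring.
  by rewrite sumr_const -[kap ^+ 2 *+ _]mulr_natl lerBlDr lerDl.
move=> k; rewrite -/(w k) -/(w0 k) -/(x k).
have K1 : 1 <= #|K|%:R :> R by rewrite ler1n; apply/card_gt0P; exists k.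
have h1 : (x k - kap) ^+ 2 <= (kap * #|K|%:R) ^+ 2.
  apply: (le_trans (_ : _ <= \sum_k (x k - kap) ^+ 2)).
    rewrite [leRHS](bigD1 k)//= lerDl sumr_ge0// => j _; exact: sqr_ge0.
  rewrite (le_trans tot2)// exprMn mulrC ler_wpM2l ?sqr_ge0//.
  by rewrite expr2 ler_peMl.
have : `|x k - kap| <= kap * #|K|%:R.
  by rewrite -(@ler_pXn2r _ 2) ?nnegrE ?mulr_ge0// real_normK ?num_real.
by rewrite ler_norml => /andP[_]; rewrite mulrDr mulr1; lra.
Qed.

Lemma signal_bound (kap I1 : R) : 0 <= kap -> 0 < I1 -> exists2 C : R, 0 <= C &
  forall Y N I theta, 1 <= N -> I1 <= I -> typical_counts kap Y N I -> Th theta ->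
  poisson_loglik Y N I theta0 <= poisson_loglik Y N I theta ->
  forall k, `|s k theta - s k theta0| <= C * eps N I.
Proof.
move=> kap0 I10.
pose K1 : R := kap * (1 + #|K|%:R).
have K10 : 0 <= K1 by rewrite mulr_ge0// addr_ge0.
pose c k : R := K1 * (2 * Num.sqrt (s k theta0 + b k / I1) + K1 / Num.sqrt I1).
have c0 k : 0 <= c k.
  by rewrite mulr_ge0// addr_ge0 ?divr_ge0 ?sqrtr_ge0// mulr_ge0 ?sqrtr_ge0.
exists (\sum_k c k) => [|Y N I theta N1 I1I good Tt hL k]; first exact: sumr_ge0.
have I0 : 0 < I by lra.
have N0 : 0 < N by lra.
have hh := hellinger_bound kap0 N0 (ltW I0) good Tt hL k.
apply: (@le_trans _ _ (c k * eps N I)); last first.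
  by rewrite ler_wpM2r ?invr_ge0 ?sqrtr_ge0// (bigD1 k)//= lerDl sumr_ge0.
have sN : 0 < Num.sqrt N by rewrite sqrtr_gt0.
have sI : 0 < Num.sqrt I by rewrite sqrtr_gt0.
have sI1 : 0 < Num.sqrt I1 by rewrite sqrtr_gt0.
have N1' : 1 <= Num.sqrt N by rewrite -[1]sqrtr1 ler_wsqrtr.
rewrite /eps sqrtrM ?(ltW N0)// ler_pdivlMr ?mulr_gt0//.
set w := Num.sqrt (rate k I theta) in hh.
set w0 := Num.sqrt (rate k I theta0) in hh.
have w00 : 0 <= w0 by exact: sqrtr_ge0.
have w10 : 0 <= w by exact: sqrtr_ge0.
have E : I * (s k theta - s k theta0) = (w - w0) * (w + w0).
  rewrite -subr_sqr !sqr_sqrtr ?ltW ?rate_gt0 ?(ltW I0)// /rate; ring.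
have sq1 : w0 <= Num.sqrt I * Num.sqrt (s k theta0 + b k / I1).
  rewrite -sqrtrM ?(ltW I0)// ler_wsqrtr// /rate mulrDr lerD2l.
  by rewrite mulrCA ler_peMr ?(ltW (b_gt0 k))// ler_pdivlMr// mul1r.
have dw : `|w - w0| <= K1.
  by apply: le_trans hh; rewrite ler_peMl.
have sumw : `|w + w0| <= Num.sqrt I * (2 * Num.sqrt (s k theta0 + b k / I1) + K1 / Num.sqrt I1).
  rewrite ger0_norm ?addr_ge0//.
  have : w <= w0 + K1 by move: dw; rewrite ler_norml; lra.
  have : K1 <= Num.sqrt I * (K1 / Num.sqrt I1).
    by rewrite mulrCA ler_peMr// ler_pdivlMr// mul1r ler_wsqrtr.
  by rewrite mulrDr; lra.
have key : I * (`|s k theta - s k theta0| * Num.sqrt N) <= Num.sqrt I * c k.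
  have -> : I * (`|s k theta - s k theta0| * Num.sqrt N) =
      Num.sqrt N * `|w - w0| * `|w + w0|.
    have -> : `|s k theta - s k theta0| = `|(w - w0) * (w + w0)| / I.
      by rewrite -E normrM (gtr0_norm I0) mulrAC mulfV ?mul1r ?gt_eqF.
    by rewrite normrM; field; rewrite gt_eqF.
  have -> : Num.sqrt I * c k = K1 * (Num.sqrt I * (2 * Num.sqrt (s k theta0 + b k / I1) + K1 / Num.sqrt I1)).
    by rewrite /c; ring.
  by rewrite ler_pM// mulr_ge0// ltW.
rewrite mulrA -(ler_pM2l sI) (le_trans _ key)//.
by rewrite mulrCA -expr2 sqr_sqrtr ?(ltW I0)// mulrC.
Qed.

Definition rel_change k I h : R := I * (s k (theta0 + h) - s k theta0) / rate k I theta0.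
Definition lin_change k I h : R := I * dot (m k) h / rate k I theta0.
Definition score_vec Y N I : 'cV[R]_n :=
  \sum_k ((Y k - mean_total k N I) * (I / rate k I theta0)) *: m k.

(** Second-order expansion of the contribution of one pixel, whose relative
    change of rate is [r] with linear part [rho]; every error term carries a
    factor [e] because [sqrt lam * r] stays bounded while [r] is of order [e]. *)
Lemma pixel_expansion (kap C e lam Y r rho : R) : 0 <= kap -> 0 <= C -> 0 <= e ->
  e <= 1 -> 0 <= lam -> `|Y - lam| <= kap * Num.sqrt lam -> `|r| <= 2^-1 ->
  `|r| <= C * e -> Num.sqrt lam * `|r - rho| <= C * e -> Num.sqrt lam * `|rho| <= C ->
  `|Y * ln (1 + r) - lam * r - ((Y - lam) * rho - 2^-1 * (lam * rho ^+ 2))|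
    <= (4 * kap * C ^+ 2 + kap * C + 8 * C ^+ 3 + 2 * C ^+ 2) * e.
Proof.
move=> kap0 C0 e0 e1 lam0 hY r2 hr hd hrho.
set q := Num.sqrt lam in hY hd hrho.
have q0 : 0 <= q by exact: sqrtr_ge0.
have qq : lam = q ^+ 2 by rewrite sqr_sqrtr.
have qr : q * `|r| <= 2 * C.
  have : `|r| <= `|r - rho| + `|rho| by rewrite -{1}(subrK rho r) ler_normD.
  move/(ler_wpM2l q0); rewrite mulrDr => h.
  have : C * e <= C by rewrite ler_piMr.
  by lra.
have l1 := norm_ln1DB_le r2; have l2 := norm_ln1DBD_le r2.
have -> : Y * ln (1 + r) - lam * r - ((Y - lam) * rho - 2^-1 * (lam * rho ^+ 2)) =
  (Y - lam) * (ln (1 + r) - r) + (Y - lam) * (r - rho) +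
  lam * (ln (1 + r) - r + r ^+ 2 / 2) - 2^-1 * ((q * (r - rho)) * (q * (r + rho))).
  by rewrite qq; field.
have ar0 : 0 <= `|r| by [].
have t1 : `|(Y - lam) * (ln (1 + r) - r)| <= 4 * kap * C ^+ 2 * e.
  rewrite normrM; apply: (le_trans (ler_pM _ _ hY l1)) => //.
  have -> : kap * q * (2 * `|r| ^+ 2) = 2 * kap * ((q * `|r|) * `|r|) by ring.
  have -> : 4 * kap * C ^+ 2 * e = 2 * kap * ((2 * C) * (C * e)) by ring.
  by rewrite ler_wpM2l ?mulr_ge0// ler_pM// mulr_ge0.
have t2 : `|(Y - lam) * (r - rho)| <= kap * C * e.
  rewrite normrM; apply: (le_trans (ler_wpM2r _ hY)) => //.
  by rewrite -!mulrA ler_wpM2l.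
have t3 : `|lam * (ln (1 + r) - r + r ^+ 2 / 2)| <= 8 * C ^+ 3 * e.
  rewrite normrM ger0_norm//; apply: (le_trans (ler_wpM2l lam0 l2)).
  have -> : lam * (2 * `|r| ^+ 3) = 2 * ((q * `|r|) * (q * `|r|) * `|r|).
    by rewrite qq; ring.
  have -> : 8 * C ^+ 3 * e = 2 * ((2 * C) * (2 * C) * (C * e)) by ring.
  rewrite ler_wpM2l// ler_pM// ?mulr_ge0// ler_pM// ?mulr_ge0//.
have t4 : `|2^-1 * ((q * (r - rho)) * (q * (r + rho)))| <= 2 * C ^+ 2 * e.
  rewrite !normrM !(ger0_norm q0) (ger0_norm (_ : 0 <= 2^-1 :> R))//.
  have h : q * `|r + rho| <= 3 * C.
    have := ler_wpM2l q0 (ler_normD r rho); rewrite mulrDr; lra.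
  have := ler_pM _ _ hd h; rewrite !mulr_ge0// => /(_ isT isT) h'.
  have : 0 <= C ^+ 2 * e by rewrite mulr_ge0// sqr_ge0.
  have : C * e * (3 * C) = 3 * (C ^+ 2 * e) by ring.
  by lra.
apply: (le_trans (ler_normB _ _)).
apply: (le_trans (lerD (le_trans (ler_normD _ _) (lerD (le_trans (ler_normD _ _) (lerD t1 t2)) t3)) t4)).
by rewrite !mulrDl.
Qed.

Variables (r0 C0 c1 I1 : R) (tail : R -> R -> Prop).
Hypotheses (r0_gt0 : 0 < r0) (C0_ge0 : 0 <= C0) (c1_gt0 : 0 < c1) (I1_gt0 : 0 < I1).
Hypothesis interior : forall h, eucl h < r0 -> Th (theta0 + h).
Hypothesis s_expansion : forall k h, eucl h < r0 ->
  `|s k (theta0 + h) - s k theta0 - dot (m k) h| <= C0 * eucl h ^+ 2.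
Hypothesis gradients_span : forall h, c1 * eucl h <= \sum_k `|dot (m k) h|.
Hypothesis tail_ge : forall N I, tail N I -> 1 <= N /\ I1 <= I.
Hypothesis dark_pixel : forall k, s k theta0 = 0 -> m k = 0 /\
  forall kap : R, 0 <= kap -> exists2 Cd : R, 0 <= Cd &
  forall N I h, tail N I -> eucl h <= kap * eps N I -> eucl h < r0 ->
    Num.sqrt N * I * s k (theta0 + h) <= Cd * eps N I.

Lemma displacement_le_signal (C : R) : 0 <= C ->
  exists2 eta : R, 0 < eta & forall (e : R) h, eucl h < eta ->
    (forall k, `|s k (theta0 + h) - s k theta0| <= C * e) ->
    eucl h <= (2 * #|K|%:R * C / c1) * e.
Proof.
move=> Cge0; pose q : R := #|K|%:R * C0.
have q0 : 0 <= q by rewrite mulr_ge0.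
exists (Num.min r0 (c1 / (2 * q + 1))).
  by rewrite lt_min r0_gt0 divr_gt0// ltr_pwDr// mulr_ge0.
move=> e h; rewrite lt_min => /andP[hr hc] hs.
have q1 : 0 < 2 * q + 1 by rewrite ltr_pwDr// mulr_ge0.
have h0 : 0 <= eucl h := eucl_ge0 _.
move: hc; rewrite ltr_pdivlMr// => hc.
have pk k : `|dot (m k) h| <= C * e + C0 * eucl h ^+ 2.
  have -> : dot (m k) h = (s k (theta0 + h) - s k theta0) -
     (s k (theta0 + h) - s k theta0 - dot (m k) h) by ring.
  by rewrite (le_trans (ler_normB _ _))// lerD// s_expansion.
have : c1 * eucl h <= #|K|%:R * (C * e + C0 * eucl h ^+ 2).
  apply: (le_trans (gradients_span h)); apply: (le_trans (ler_sum _ (fun k _ => pk k))).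
  by rewrite sumr_const -[leLHS]mulr_natl.
rewrite mulrDr [X in _ <= _ + X]mulrA -/q => h1.
have h2 : q * eucl h ^+ 2 <= 2^-1 * (c1 * eucl h).
  have : 0 <= eucl h * (c1 - 2 * q * eucl h) by rewrite mulr_ge0//; lra.
  rewrite expr2; nra.
have -> : 2 * #|K|%:R * C / c1 * e = (2 * (#|K|%:R * (C * e))) / c1.
  by field; rewrite gt_eqF.
by rewrite ler_pdivlMr//; lra.
Qed.

Lemma eps_gt0 N I : 0 < N -> 0 < I -> 0 < eps N I.
Proof. by move=> ? ?; rewrite invr_gt0 sqrtr_gt0 mulr_gt0. Qed.

Lemma eps_sqrtM N I : 0 < N -> 0 < I -> Num.sqrt N * Num.sqrt I * eps N I = 1.
Proof.
move=> N0 I0; rewrite -sqrtrM ?(ltW N0)// mulfV// gt_eqF// sqrtr_gt0.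
exact: mulr_gt0.
Qed.

(** On the scale [eps], a bright pixel ([s k theta0 > 0]) changes by a smooth
    amount against a rate of order [I]; a dark one has a rate of order one, and
    only the stronger bound [dark_pixel] keeps its change negligible. *)
Lemma pixel_change (C : R) k : 0 <= C -> exists2 C' : R, 0 <= C' &
  forall N I h, tail N I -> eucl h < r0 -> eucl h <= C * eps N I ->
  [/\ `|rel_change k I h| <= C' * eps N I,
      Num.sqrt (mean_total k N I) * `|rel_change k I h - lin_change k I h| <= C' * eps N I &
      Num.sqrt (mean_total k N I) * `|lin_change k I h| <= C'].
Proof.
move=> Cge0; have := s_ge0 k Th0; rewrite le_eqVlt => /predU1P[/esym sk|sk].
  have [mk /(_ _ Cge0)[Cd Cd0 dk]] := dark_pixel sk.
  have bk := b_gt0 k; have sb : 0 < Num.sqrt (b k) by rewrite sqrtr_gt0.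
  exists (Cd / b k + Cd / Num.sqrt (b k)).
    by rewrite addr_ge0// divr_ge0// ltW.
  move=> N I h t hr hC; have [N1 I1I] := tail_ge t.
  have N0 : 0 < N by lra.
  have I0 : 0 < I := lt_le_trans I1_gt0 I1I.
  have e0 := eps_gt0 N0 I0.
  have sh := s_ge0 k (interior hr).
  have {}dk := dk _ _ _ t hC hr.
  rewrite /rel_change /lin_change /mean_total /rate sk mk dot0l !(mulr0, mul0r, add0r, subr0, normr0).
  have q0 : 0 <= I * s k (theta0 + h) / b k.
    by rewrite divr_ge0 ?mulr_ge0// ltW.
  rewrite (ger0_norm q0) sqrtrM ?(ltW N0)//.
  have A1 : I * s k (theta0 + h) / b k <= Cd / b k * eps N I.
    rewrite [leRHS]mulrAC ler_pM2r ?invr_gt0//; apply: le_trans dk.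
    rewrite -mulrA ler_peMl ?mulr_ge0 ?(ltW I0)//.
    by rewrite -[1]sqrtr1 ler_wsqrtr.
  have A2 : Num.sqrt N * Num.sqrt (b k) * (I * s k (theta0 + h) / b k) <=
     Cd / Num.sqrt (b k) * eps N I.
    have -> : Num.sqrt N * Num.sqrt (b k) * (I * s k (theta0 + h) / b k) =
       Num.sqrt N * I * s k (theta0 + h) / Num.sqrt (b k).
      rewrite -{2}(@sqr_sqrtr _ (b k)) ?(ltW bk)//; field; by rewrite gt_eqF.
    by rewrite [leRHS]mulrAC ler_pM2r ?invr_gt0.
  have B1 : 0 <= Cd / b k * eps N I by apply: mulr_ge0; [apply: divr_ge0 => //|]; exact: ltW.
  have B2 : 0 <= Cd / Num.sqrt (b k) * eps N I by apply: mulr_ge0; [apply: divr_ge0 => //|]; exact: ltW.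
  rewrite mulrDl; split.
  - by rewrite (le_trans A1)// lerDl.
  - by rewrite (le_trans A2)// lerDr.
  - by apply: addr_ge0; apply: divr_ge0 => //; exact: ltW.
pose sg : R := Num.sqrt (s k theta0).
have sg0 : 0 < sg by rewrite sqrtr_gt0.
pose mm : R := \sum_i `|m k i 0|.
have mm0 : 0 <= mm by exact: sumr_ge0.
have dm h : `|dot (m k) h| <= mm * eucl h.
  by rewrite (le_trans (cauchy_schwarz _ _))// ler_wpM2r ?eucl_ge0// eucl_le_sum.
pose A : R := (mm * C + C0 * C * r0) / s k theta0.
have A0 : 0 <= A.
  by rewrite divr_ge0 ?(ltW sk)// addr_ge0 ?mulr_ge0// ltW.
pose B : R := C0 * C ^+ 2 / sg.
have B0 : 0 <= B by rewrite divr_ge0 ?(ltW sg0)// mulr_ge0// sqr_ge0.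
pose D : R := mm * C / sg.
have D0 : 0 <= D by rewrite divr_ge0 ?(ltW sg0)// mulr_ge0.
exists (A + B + D) => [|N I h t hr hC]; first by rewrite !addr_ge0.
have [N1 I1I] := tail_ge t.
have N0 : 0 < N by lra.
have I0 : 0 < I := lt_le_trans I1_gt0 I1I.
have e0 := eps_gt0 N0 I0; have es := eps_sqrtM N0 I0.
have h0 : 0 <= eucl h := eucl_ge0 _.
have v0 : 0 < rate k I theta0 by rewrite rate_gt0// ltW.
have vI : I * s k theta0 <= rate k I theta0 by rewrite lerDl ltW.
have frac (x : R) : `|I * x / rate k I theta0| <= `|x| / s k theta0.
  rewrite !normrM normfV (gtr0_norm I0) (gtr0_norm v0) ler_pdivrMr//.
  rewrite mulrAC ler_pdivlMr// [leRHS]mulrC mulrAC ler_wpM2r//.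
have sqv : Num.sqrt I * sg <= Num.sqrt (rate k I theta0).
  by rewrite -sqrtrM ?(ltW I0)// ler_wsqrtr.
have frac2 (x : R) : Num.sqrt (mean_total k N I) * `|I * x / rate k I theta0| <=
    `|x| / sg / eps N I.
  have sv : 0 < Num.sqrt (rate k I theta0) by rewrite sqrtr_gt0.
  have -> : Num.sqrt (mean_total k N I) * `|I * x / rate k I theta0| =
     Num.sqrt N * I * `|x| / Num.sqrt (rate k I theta0).
    rewrite /mean_total sqrtrM ?(ltW N0)// !normrM normfV (gtr0_norm I0) (gtr0_norm v0).
    rewrite -{2}(@sqr_sqrtr _ (rate k I theta0)) ?(ltW v0)//; field; by rewrite gt_eqF.
  have -> : `|x| / sg / eps N I = Num.sqrt N * Num.sqrt I * `|x| / sg.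
    by apply: (mulIf (lt0r_neq0 e0)); rewrite divfK ?lt0r_neq0// -[LHS]mul1r -es; ring.
  rewrite ler_pdivrMr// [leRHS]mulrAC ler_pdivlMr//.
  have -> : Num.sqrt N * I * `|x| * sg = Num.sqrt N * Num.sqrt I * `|x| * (Num.sqrt I * sg).
    by rewrite -{1}(@sqr_sqrtr _ I) ?(ltW I0)//; ring.
  by rewrite ler_wpM2l// !mulr_ge0// sqrtr_ge0.
have hse := s_expansion k hr.
have h2 : C0 * eucl h ^+ 2 <= C0 * C ^+ 2 * eps N I ^+ 2.
  by rewrite -mulrA -exprMn ler_wpM2l// ler_pXn2r ?nnegrE// mulr_ge0// ltW.
have h3 : C0 * eucl h ^+ 2 <= C0 * C * r0 * eps N I.
  have -> : C0 * C * r0 * eps N I = C0 * (r0 * (C * eps N I)) by ring.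
  by rewrite expr2 ler_wpM2l// ler_pM// ltW.
have hm : `|dot (m k) h| <= mm * C * eps N I.
  by rewrite -mulrA (le_trans (dm h))// ler_wpM2l.
have C1 : `|rel_change k I h| <= A * eps N I.
  apply: (le_trans (frac _)); rewrite /A [leRHS]mulrAC ler_pM2r ?invr_gt0//.
  have -> : s k (theta0 + h) - s k theta0 =
     (s k (theta0 + h) - s k theta0 - dot (m k) h) + dot (m k) h by ring.
  by apply: (le_trans (ler_normD _ _)); rewrite mulrDl; lra.
have C2 : Num.sqrt (mean_total k N I) * `|rel_change k I h - lin_change k I h| <= B * eps N I.
  have -> : rel_change k I h - lin_change k I h =
     I * (s k (theta0 + h) - s k theta0 - dot (m k) h) / rate k I theta0.
    by rewrite /rel_change /lin_change; field; rewrite gt_eqF.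
  apply: (le_trans (frac2 _)); rewrite ler_pdivrMr// -mulrA -expr2 /B [leRHS]mulrAC.
  by rewrite ler_pM2r ?invr_gt0// (le_trans hse).
have C3 : Num.sqrt (mean_total k N I) * `|lin_change k I h| <= D.
  apply: (le_trans (frac2 _)); rewrite ler_pdivrMr// /D [leRHS]mulrAC.
  by rewrite ler_pM2r ?invr_gt0.
split.
- by rewrite (le_trans C1)// ler_pM2r// -addrA lerDl addr_ge0.
- by rewrite (le_trans C2)// ler_pM2r// addrAC lerDr addr_ge0.
- by rewrite (le_trans C3)// lerDr addr_ge0.
Qed.

Definition info_root (B : 'M[R]_n) N I := [/\ B^T = B, B \in unitmx &
  forall h, dot (B *m h) (B *m h) = \sum_k mean_total k N I * lin_change k I h ^+ 2].

Lemma dot_score Y N I h :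
  dot (score_vec Y N I) h = \sum_k (Y k - mean_total k N I) * lin_change k I h.
Proof.
rewrite /score_vec dot_suml; apply: eq_bigr => k _.
by rewrite dotZl /lin_change; ring.
Qed.

Lemma dot_invmx_score (B : 'M[R]_n) Y N I h : info_root B N I ->
  dot (invmx B *m score_vec Y N I) (B *m h) =
  \sum_k (Y k - mean_total k N I) * lin_change k I h.
Proof.
by case=> Bs Bu _; rewrite dot_mulmx Bs mulmxA mulmxV// mul1mx dot_score.
Qed.

Lemma mean_total_ge0 k N I : 0 <= N -> 0 <= I -> 0 <= mean_total k N I.
Proof. by move=> N0 I0; rewrite mulr_ge0// ltW// rate_gt0. Qed.

Lemma lin_change_le (B : 'M[R]_n) N I h k : 0 <= N -> 0 <= I -> info_root B N I ->
  Num.sqrt (mean_total k N I) * `|lin_change k I h| <= eucl (B *m h).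
Proof.
move=> N0 I0 [_ _ BB].
rewrite -(@ler_pXn2r _ 2) ?nnegrE ?mulr_ge0 ?sqrtr_ge0 ?eucl_ge0//.
rewrite exprMn sqr_sqrtr ?mean_total_ge0// real_normK ?num_real// sqr_eucl BB.
rewrite (bigD1 k)//= lerDl sumr_ge0// => j _.
by rewrite mulr_ge0 ?sqr_ge0// mean_total_ge0.
Qed.

Lemma invmx_score_le (kap : R) Y (B : 'M[R]_n) N I : 0 <= kap -> 0 <= N -> 0 <= I ->
  typical_counts kap Y N I -> info_root B N I ->
  eucl (invmx B *m score_vec Y N I) <= kap * #|K|%:R.
Proof.
move=> kap0 N0 I0 good info; set T := invmx B *m _.
have [Bs Bu _] := info.
have TE : T = B *m (invmx B *m T) by rewrite mulmxA mulmxV// mul1mx.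
have h1 : eucl T ^+ 2 <= kap * #|K|%:R * eucl T.
  rewrite sqr_eucl {2}TE dot_invmx_score//.
  apply: (le_trans (ler_norm _)); apply: (le_trans (ler_norm_sum _ _ _)).
  apply: (@le_trans _ _ (\sum_(k : K) kap * eucl T)).
    apply: ler_sum => k _; rewrite normrM.
    apply: (le_trans (ler_wpM2r _ (good k).2)) => //.
    by rewrite -mulrA ler_wpM2l// {2}TE lin_change_le.
  by rewrite sumr_const -[leLHS]mulr_natl mulrA [_ * kap]mulrC.
have [->|T0] := eqVneq (eucl T) 0; first by rewrite mulr_ge0.
by rewrite expr2 ler_pM2r// lt_neqAle eq_sym T0 eucl_ge0 in h1.
Qed.

Lemma displacement_le_info : exists2 Cq : R, 0 <= Cq &
  forall (B : 'M[R]_n) N I h, 1 <= N -> I1 <= I -> info_root B N I ->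
  eucl h <= Cq * eps N I * eucl (B *m h).
Proof.
pose c k : R := Num.sqrt (s k theta0 + b k / I1).
have c0 k : 0 <= c k by exact: sqrtr_ge0.
exists ((\sum_k c k) / c1) => [|B N I h N1 I1I info].
  by rewrite divr_ge0 ?(ltW c1_gt0)// sumr_ge0.
have N0 : 0 < N by lra.
have I0 : 0 < I := lt_le_trans I1_gt0 I1I.
have e0 := eps_gt0 N0 I0; have es := eps_sqrtM N0 I0.
have -> : (\sum_k c k) / c1 * eps N I * eucl (B *m h) =
  ((\sum_k c k) * (eps N I * eucl (B *m h))) / c1 by field; rewrite gt_eqF.
rewrite ler_pdivlMr// mulrC (le_trans (gradients_span h))// mulr_suml.
apply: ler_sum => k _.
have v0 : 0 < rate k I theta0 by rewrite rate_gt0// ltW.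
have sv : 0 < Num.sqrt (rate k I theta0) by rewrite sqrtr_gt0.
have sI : 0 < Num.sqrt I by rewrite sqrtr_gt0.
have := lin_change_le h k (ltW N0) (ltW I0) info.
rewrite /mean_total /lin_change sqrtrM ?(ltW N0)// !normrM normfV (gtr0_norm I0) (gtr0_norm v0).
have -> : Num.sqrt N * Num.sqrt (rate k I theta0) * (I * `|dot (m k) h| / rate k I theta0) =
   Num.sqrt N * I * `|dot (m k) h| / Num.sqrt (rate k I theta0).
  by rewrite -{2}(@sqr_sqrtr _ (rate k I theta0)) ?(ltW v0)//; field; rewrite gt_eqF.
rewrite ler_pdivrMr// => hk.
have vc : Num.sqrt (rate k I theta0) <= Num.sqrt I * c k.
  rewrite -sqrtrM ?(ltW I0)// ler_wsqrtr// /rate mulrDr lerD2l.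
  by rewrite mulrCA ler_peMr ?(ltW (b_gt0 k))// ler_pdivlMr// mul1r.
have {hk} := le_trans hk (ler_wpM2l (eucl_ge0 _) vc).
rewrite -{1}(@sqr_sqrtr _ I) ?(ltW I0)// => hk.
have : Num.sqrt I * (Num.sqrt N * Num.sqrt I * `|dot (m k) h|) <=
   Num.sqrt I * (c k * eucl (B *m h)).
  apply: le_trans (le_trans hk _); rewrite le_eqVlt; apply/orP; left; apply/eqP; ring.
rewrite ler_pM2l// => /(ler_wpM2l (ltW e0)).
have -> : eps N I * (Num.sqrt N * Num.sqrt I * `|dot (m k) h|) = `|dot (m k) h|.
  by rewrite mulrA [eps N I * _]mulrC es mul1r.
by rewrite mulrCA.
Qed.

Lemma poisson_loglikB Y N I h : 0 <= I -> Th (theta0 + h) ->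
  poisson_loglik Y N I (theta0 + h) - poisson_loglik Y N I theta0 =
  \sum_k (Y k * ln (1 + rel_change k I h) - mean_total k N I * rel_change k I h).
Proof.
move=> I0 Tt; rewrite -sumrB; apply: eq_bigr => k _.
have v0 := rate_gt0 k I0 Th0; have v1 := rate_gt0 k I0 Tt.
have -> : 1 + rel_change k I h = rate k I (theta0 + h) / rate k I theta0.
  by move: v0; rewrite /rel_change /rate => v0; field; rewrite gt_eqF.
rewrite ln_div ?posrE//.
have -> : mean_total k N I * rel_change k I h =
    N * (rate k I (theta0 + h) - rate k I theta0).
  by move: v0; rewrite /rel_change /mean_total /rate => v0; field; rewrite gt_eqF.
ring.
Qed.

(** Completing the square in the local quadratic approximation: up to an error
    of order [eps], the likelihood ratio is largest where [B *m h] equals the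
    standardized score. *)
Lemma loglik_quadratic (kap C : R) : 0 <= kap -> 0 <= C ->
  exists Ce e1 : R, [/\ 0 <= Ce, 0 < e1 &
  forall Y (B : 'M[R]_n) N I h, tail N I -> typical_counts kap Y N I ->
  info_root B N I -> eps N I <= e1 -> eucl h < r0 -> eucl h <= C * eps N I ->
  `|poisson_loglik Y N I (theta0 + h) - poisson_loglik Y N I theta0 -
    2^-1 * (eucl (invmx B *m score_vec Y N I) ^+ 2 -
      eucl (B *m h - invmx B *m score_vec Y N I) ^+ 2)| <= Ce * eps N I].
Proof.
move=> kap0 Cge0.
have cp k := cid2 (pixel_change k Cge0).
pose D : R := \sum_k s2val (cp k).
have Dk k : 0 <= s2val (cp k) := s2valP (cp k).
have Dge k : s2val (cp k) <= D.
  by rewrite /D (bigD1 k)//= lerDl; apply: sumr_ge0 => j _.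
have D0 : 0 <= D by apply: sumr_ge0 => j _.
pose Cp : R := 4 * kap * D ^+ 2 + kap * D + 8 * D ^+ 3 + 2 * D ^+ 2.
have Cp0 : 0 <= Cp by rewrite !addr_ge0// ?mulr_ge0// ?exprn_ge0.
exists (#|K|%:R * Cp), (Num.min 1 (2^-1 / (D + 1))); split.
- by rewrite mulr_ge0.
- by rewrite lt_min ltr01 divr_gt0// ltr_wpDl.
move=> Y B N I h t good info; rewrite le_min => /andP[e1 eD] hr hC.
set T := invmx B *m score_vec Y N I.
have [N1 I1I] := tail_ge t.
have N0 : 0 < N by lra.
have I0 : 0 < I := lt_le_trans I1_gt0 I1I.
have e0 := eps_gt0 N0 I0.
rewrite poisson_loglikB ?(ltW I0)//; last exact: interior.
have -> : 2^-1 * (eucl T ^+ 2 - eucl (B *m h - T) ^+ 2) =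
  \sum_k ((Y k - mean_total k N I) * lin_change k I h -
    2^-1 * (mean_total k N I * lin_change k I h ^+ 2)).
  rewrite sumrB -mulr_sumr -(dot_invmx_score Y h info) -/T.
  have [_ _ <-] := info.
  rewrite !sqr_eucl !(dotBl, dotBr) (dotC (B *m h) T); by field.
rewrite -sumrB; apply: (le_trans (ler_norm_sum _ _ _)).
apply: (@le_trans _ _ (\sum_(k : K) Cp * eps N I)); last first.
  by rewrite sumr_const -[leLHS]mulr_natl mulrA.
apply: ler_sum => k _; have [p1 p2 p3] := s2valP' (cp k) N I h t hr hC.
have De : s2val (cp k) * eps N I <= D * eps N I by rewrite ler_wpM2r// ltW.
apply: pixel_expansion => //.
- exact: ltW.
- by rewrite mean_total_ge0// ltW.
- exact: (good k).2.
- apply: (le_trans p1); apply: (le_trans De).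
  have D1 : 0 < D + 1 by rewrite ltr_wpDl.
  move: eD; rewrite ler_pdivlMr// mulrDr mulr1 mulrC; lra.
- exact: le_trans De.
- exact: le_trans De.
- exact: le_trans (Dge k).
Qed.

(** Near [theta0] a maximizer is, on the scale of the information, the
    standardized score up to an error of order [sqrt eps]: both the maximizer
    and the maximizer of the quadratic approximation lie in the region where
    the approximation holds. *)
Lemma maximizer_close_to_score (kap : R) : 0 <= kap ->
  exists eta e1 Cf : R, [/\ 0 < eta, 0 < e1, 0 <= Cf &
  forall Y (B : 'M[R]_n) N I theta, tail N I -> typical_counts kap Y N I ->
  info_root B N I -> eps N I <= e1 -> Th theta ->
  (forall theta', Th theta' -> poisson_loglik Y N I theta' <= poisson_loglik Y N I theta) ->
  eucl (theta - theta0) < eta ->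
  eucl (B *m (theta - theta0) - invmx B *m score_vec Y N I) ^+ 2 <= Cf * eps N I].
Proof.
move=> kap0.
have [C1 C10 sb] := signal_bound kap0 I1_gt0.
have [eta eta0 disp] := displacement_le_signal C10.
have [Cq Cq0 qb] := displacement_le_info.
pose A : R := 2 * #|K|%:R * C1 / c1.
have A0 : 0 <= A by rewrite divr_ge0 ?(ltW c1_gt0)// !mulr_ge0.
pose A2 : R := Cq * (kap * #|K|%:R).
have A20 : 0 <= A2 by rewrite !mulr_ge0.
have [Ce [e1 [Ce0 e10 quad]]] := loglik_quadratic kap0 (addr_ge0 A0 A20).
have AA : 0 < A + A2 + 1 by rewrite ltr_wpDl// addr_ge0.
exists eta, (Num.min e1 (r0 / (A + A2 + 1))), (4 * Ce); split=> //.
- by rewrite lt_min e10 divr_gt0.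
- by rewrite mulr_ge0.
move=> Y B N I theta t good info; rewrite le_min => /andP[ee er] Tt mx close.
have [N1 I1I] := tail_ge t.
have N0 : 0 < N by lra.
have I0 : 0 < I := lt_le_trans I1_gt0 I1I.
have e0 := eps_gt0 N0 I0.
pose h := theta - theta0; have th : theta = theta0 + h by rewrite addrC subrK.
pose T := invmx B *m score_vec Y N I; pose h' := invmx B *m T.
have [Bs Bu _] := info.
have Bh' : B *m h' = T by rewrite mulmxA mulmxV// mul1mx.
have AE : (A + A2) * eps N I < r0.
  move: er; rewrite ler_pdivlMr// mulrDr mulr1 mulrC; lra.
have hA : eucl h <= (A + A2) * eps N I.
  apply: (@le_trans _ _ (A * eps N I)); last by rewrite ler_wpM2r ?(ltW e0)// lerDl.
  by apply: disp => // k; rewrite -th; apply: (sb Y) => //; exact: mx.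
have hA' : eucl h' <= (A + A2) * eps N I.
  apply: (@le_trans _ _ (A2 * eps N I)); last by rewrite ler_wpM2r ?(ltW e0)// lerDr.
  apply: (le_trans (qb B N I h' N1 I1I info)); rewrite Bh' /A2 [leRHS]mulrAC.
  by rewrite ler_wpM2l ?mulr_ge0 ?(ltW e0)// invmx_score_le// ltW.
have q1 := quad Y B N I h t good info ee (le_lt_trans hA AE) hA.
have q2 := quad Y B N I h' t good info ee (le_lt_trans hA' AE) hA'.
rewrite -/T -th in q1; rewrite -/T Bh' subrr eucl0 expr0n/= subr0 in q2.
have := mx _ (interior (le_lt_trans hA' AE)).
move: q1 q2; rewrite !ler_norml => /andP[_ q1] /andP[q2 _] q3.
rewrite -/h -/T; lra.
Qed.
End likelihood_geometry.

Section relabeling.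
Context {R : realType} {d M : nat}.
Implicit Types (theta : 'cV[R]_(M * d)) (s : 'S_M).

Lemma emitter_relabel s theta m : emitter (relabel s theta) m = emitter theta (s m).
Proof. by apply/colP => i; rewrite !mxE mxvecE !mxE. Qed.

Lemma emitter_inj theta theta' :
  (forall m, emitter theta m = emitter theta' m) -> theta = theta'.
Proof.
move=> h; apply/colP => k; case/mxvec_indexP: k => i j.
by have /colP/(_ j) := h i; rewrite !mxE.
Qed.

Lemma relabelM s t theta : relabel s (relabel t theta) = relabel (s * t)%g theta.
Proof. by apply: emitter_inj => m; rewrite !emitter_relabel permM. Qed.

Lemma relabel1 theta : relabel 1%g theta = theta.
Proof. by apply: emitter_inj => m; rewrite emitter_relabel perm1. Qed.

Lemma eucl_relabelB s theta theta' :
  eucl (relabel s theta - relabel s theta') = eucl (theta - theta').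
Proof.
have sq (x : 'cV[R]_(M * d)) : eucl x = Num.sqrt (\sum_m \sum_i emitter x m i 0 ^+ 2).
  congr Num.sqrt; rewrite pair_bigA /= (reindex _ (curry_mxvec_bij M d)) /=.
  by apply: eq_bigr => -[m i] _; rewrite mxE.
rewrite !sq; congr Num.sqrt; rewrite (reindex_inj (@perm_inj _ s^-1%g)).
apply: eq_bigr => m _; apply: eq_bigr => i _; congr (_ ^+ 2).
have E u v j : emitter (u - v) j i 0 = emitter u j i 0 - emitter v j i 0.
  by rewrite !mxE.
by rewrite !E !emitter_relabel permKV.
Qed.

End relabeling.

Section consistency.
Context {R : realType} {d M Kx Ky : nat} (S : frame_model R d M Kx Ky).
Implicit Types (theta : 'cV[R]_(M * d)) (k : pixel Kx Ky) (s : 'S_M) (I : R).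

Definition symmetry s := forall theta, Theta S theta ->
  forall k, signal S k (relabel s theta) = signal S k theta.

Lemma Theta_relabel s theta : Theta S theta -> Theta S (relabel s theta).
Proof.
move=> [h1 h2]; split=> [m|m m' mm']; first by rewrite emitter_relabel.
by rewrite !emitter_relabel; apply: h2; rewrite (inj_eq perm_inj).
Qed.

Lemma symmetryV s : symmetry s -> symmetry s^-1%g.
Proof.
move=> h theta Tt k.
by rewrite -h ?relabelM ?mulgV ?relabel1//; exact: Theta_relabel.
Qed.

Lemma loglikE I N (x : 'I_N -> frame Kx Ky) theta : loglik S I x theta =
  poisson_loglik (fun k t => area_time S * signal S k t) (bg S)
    (fun k => \sum_j (x j k)%:R) N%:R I theta.
Proof.
rewrite /loglik /loglik1 exchange_big; apply: eq_bigr => k _ /=.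
have -> : rate (fun k t => area_time S * signal S k t) (bg S) k I theta =
    mean_count S I k theta.
  by rewrite mean_countE /rate; ring.
by rewrite sumrB -mulr_suml sumr_const card_ord mulr_natl.
Qed.

Lemma loglik_relabel s I N (x : 'I_N -> frame Kx Ky) theta :
  symmetry s -> Theta S theta -> loglik S I x (relabel s theta) = loglik S I x theta.
Proof.
move=> sym Tt; apply: eq_bigr => j _; apply: eq_bigr => k _.
by rewrite /mean_count sym.
Qed.

Variable theta0 : 'cV[R]_(M * d).
Hypothesis ident : identifiable_up_to_relabeling S theta0.
Hypothesis cptT : compact (Theta S).

(** If parameters with nearly the true image stayed away from all relabelings
    of [theta0], a limit point of theirs would have exactly the true image and
    contradict identifiability. *)
Lemma near_some_relabeling I (eta : R) : 0 < I -> regular_intensity S I -> 0 < eta ->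
  exists2 e : R, 0 < e & forall theta, Theta S theta ->
    (forall k, `|signal S k theta - signal S k theta0| <= e) ->
    exists2 s, symmetry s & eucl (theta - relabel s theta0) < eta.
Proof.
move=> I0 reg eta0; apply: contrapT => noe.
have bad (j : nat) : exists theta, [/\ Theta S theta,
    (forall k, `|signal S k theta - signal S k theta0| <= j.+1%:R^-1) &
    forall s, symmetry s -> eta <= eucl (theta - relabel s theta0)].
  apply: contrapT => h; apply: noe; exists j.+1%:R^-1 => // theta Tt ht.
  apply: contrapT => h'; apply: h; exists theta; split=> // s hs.
  by rewrite leNgt; apply/negP => hl; apply: h'; exists s.
pose x j := projT1 (cid (bad j)).
have xP j := projT2 (cid (bad j)).
have [p [Tp clp]] : Theta S `&` cluster (x @ \oo) !=set0.
  by apply: cptT; exists 0%N => // j _; have [] := xP j.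
have same k : signal S k p = signal S k theta0.
  apply/eqP; rewrite -subr_eq0 -normr_le0; apply/ler_addgt0Pr => e e0; rewrite add0r.
  have /cvgrPdist_lt/(_ (e / 2)) := signal_continuous I0 reg Tp (k := k).
  rewrite divr_gt0// => /(_ isT); rewrite near_withinE => nb.
  have [j0 j0e] : exists j0 : nat, j0.+1%:R^-1 < e / 2.
    have [j0 _ h] := near_infty_natSinv_lt (PosNum (divr_gt0 e0 (ltr0Sn R 1))).
    by exists j0; apply: (h j0) => /=.
  have [|y [[j jj0 <-] hy]] := clp [set y | exists2 j, (j0 <= j)%N & x j = y] _ _ nb.
    by exists j0 => // j jj0; exists j.
  have [Ty sy _] := xP j.
  have := hy Ty; have := sy k; rewrite -/(x j) => h2 h1.
  have h3 : j.+1%:R^-1 <= j0.+1%:R^-1 :> R by rewrite lef_pV2 ?posrE// ler_nat.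
  have -> : signal S k p - signal S k theta0 = (signal S k p - signal S k (x j)) +
      (signal S k (x j) - signal S k theta0) by ring.
  rewrite (le_trans (ler_normD _ _))// [leRHS]splitr lerD ?(ltW h1)//.
  by rewrite (le_trans h2)// (le_trans h3)// ltW.
have [s [sym ps]] := ident Tp same.
have nb : nbhs p [set y | eucl (y - p) < eta] by exact: nbhs_eucl_ball.
have [|y [[j _ <-] /= hy]] := clp [set y | exists2 j, (0 <= j)%N & x j = y] _ _ nb.
  by exists 0%N => // j _; exists j.
have [_ _ /(_ s sym)] := xP j; rewrite -/(x j) -ps.
by rewrite leNgt hy.
Qed.

(** A maximizer near some relabeling of [theta0] has a relabeling near [theta0]
    that is again a maximizer, and the correct labeling is no farther away. *)
Lemma correctly_labeled_near I N (x : 'I_N -> frame Kx Ky) theta s (eta : R) :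
  Theta S theta0 -> symmetry s -> maximizer S I x theta ->
  correctly_labeled S I x theta0 theta ->
  eucl (theta - relabel s theta0) < eta -> eucl (theta - theta0) < eta.
Proof.
move=> T0 sym [Tt mx] lab; apply: le_lt_trans.
have -> : eucl (theta - relabel s theta0) =
    eucl (relabel s^-1%g theta - theta0).
  by rewrite -(eucl_relabelB s^-1%g) relabelM mulVg relabel1.
apply: lab; split=> [|t Tt']; first exact: Theta_relabel.
by rewrite loglik_relabel ?mx//; exact: symmetryV.
Qed.

End consistency.

Section finite_families.
Context {R : realType} {K : finType}.

Lemma sum_sqr_le (a : K -> R) : \sum_k a k ^+ 2 <= (\sum_k `|a k|) ^+ 2.
Proof.
rewrite [leRHS]expr2 mulr_suml; apply: ler_sum => k _.
rewrite -[leLHS]real_normK ?num_real// expr2.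
by rewrite ler_wpM2l// (bigD1 k)//= lerDl sumr_ge0.
Qed.

Lemma uniform_constants (P : K -> R -> R -> Prop) :
  (forall k C r C' r', P k C r -> C <= C' -> r' <= r -> P k C' r') ->
  (forall k, exists C r, [/\ 0 <= C, 0 < r & P k C r]) ->
  exists C r, [/\ 0 <= C, 0 < r & forall k, P k C r].
Proof.
move=> mono h; pose C k := projT1 (cid (h k)).
have hC k : exists r, [/\ 0 <= C k, 0 < r & P k (C k) r] := projT2 (cid (h k)).
pose r k := projT1 (cid (hC k)).
have hr k : [/\ 0 <= C k, 0 < r k & P k (C k) (r k)] := projT2 (cid (hC k)).
have C0 k : 0 <= C k by have [] := hr k.
have r0 k : 0 <= (r k)^-1 by have [_ ? _] := hr k; rewrite invr_ge0 ltW.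
have p0 : 0 < 1 + \sum_k (r k)^-1 by rewrite ltr_pwDl// sumr_ge0.
exists (\sum_k C k), (1 + \sum_k (r k)^-1)^-1; split.
- exact: sumr_ge0.
- by rewrite invr_gt0.
move=> k; have [_ rk Pk] := hr k; apply: (mono _ _ _ _ _ Pk).
  by rewrite (bigD1 k)//= lerDl; apply: sumr_ge0 => j _; exact: C0.
rewrite -[leRHS]invrK lef_pV2 ?posrE ?invr_gt0//.
by rewrite (bigD1 k)//= addrCA lerDl addr_ge0//; apply: sumr_ge0 => j _; exact: r0.
Qed.

End finite_families.

Lemma eucl_mulmx_le {R : realType} {n : nat} (A : 'M[R]_n) :
  exists2 C : R, 0 <= C & forall x, eucl (A *m x) <= C * eucl x.
Proof.
exists (\sum_i eucl (row i A)^T) => [|x].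
  by apply: sumr_ge0 => i _; exact: eucl_ge0.
rewrite mulr_suml (le_trans (eucl_le_sum _))//; apply: ler_sum => i _.
have -> : (A *m x) i 0 = dot (row i A)^T x.
  by rewrite -dotE trmxK -row_mul [RHS]mxE.
exact: cauchy_schwarz.
Qed.

Section information.
Context {R : realType} {d M Kx Ky : nat} (S : frame_model R d M Kx Ky).
Local Notation n := (M * d)%N.
Implicit Types (theta h : 'cV[R]_n) (k : pixel Kx Ky) (I : R).

Definition scaled_signal k theta : R := area_time S * signal S k theta.

Lemma rate_scaled_signal I k theta :
  rate scaled_signal (bg S) k I theta = mean_count S I k theta.
Proof. by rewrite mean_countE /rate /scaled_signal; ring. Qed.

Variables (J : set R) (theta0 : 'cV[R]_n).
Hypothesis J_gt0 : forall I, J I -> 0 < I.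
Hypothesis theta0_int : interior (Theta S) theta0.
Hypothesis envelope : third_order_envelope S J theta0.

Lemma interior_ball : exists2 r : R, 0 < r & forall h, eucl h < r -> Theta S (theta0 + h).
Proof.
have /nbhs_eucl[r r0 hr] := theta0_int.
by exists r => // h hh; apply: hr; rewrite addrC addKr.
Qed.

Lemma Theta_theta0 : Theta S theta0.
Proof. by have [r r0 h] := interior_ball; rewrite -[theta0]addr0; apply: h; rewrite eucl0. Qed.

Lemma scaled_signal_expansion I1 : J I1 ->
  exists m : pixel Kx Ky -> 'cV[R]_n, exists C r : R, [/\ 0 <= C, 0 < r &
  forall k h, eucl h < r -> Theta S (theta0 + h) /\
  `|scaled_signal k (theta0 + h) - scaled_signal k theta0 - dot (m k) h|
     <= C * eucl h ^+ 2].
Proof.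
move=> JI1; have I10 := J_gt0 JI1; have a0 := area_time_gt0 S.
have [rT rT0 hT] := interior_ball.
have [r [_ [r0 /(_ _ JI1)[G [_ hG]]]]] := envelope.
have ex k : exists m : 'cV[R]_n, exists C r' : R, [/\ 0 <= C, 0 < r' &
    forall h, eucl h < r' ->
    `|signal S k (theta0 + h) - signal S k theta0 - dot m h| <= C * eucl h ^+ 2].
  apply: (signal_expansion interior_ball I10 r0).
  exact: (log_expansion_of_envelope k zero_frame hG).
pose m k := projT1 (cid (ex k)); have mP k := projT2 (cid (ex k)).
have [|k|C [r' [C0 r'0 hC]]] := @uniform_constants R (pixel Kx Ky)
    (fun k C r => forall h, eucl h < r ->
    `|signal S k (theta0 + h) - signal S k theta0 - dot (m k) h| <= C * eucl h ^+ 2).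
- move=> k C r1 C' r2 hP CC rr h hr; apply: (le_trans (hP h (lt_le_trans hr rr))).
  by rewrite ler_wpM2r// exprn_ge0// eucl_ge0.
- by have [C [r1 ?]] := mP k; exists C, r1.
exists (fun k => area_time S *: m k), (area_time S * C), (Num.min r' rT); split.
- by rewrite mulr_ge0// ltW.
- by rewrite lt_min r'0.
move=> k h; rewrite lt_min => /andP[h1 h2]; split; first exact: hT.
rewrite dotZl -!mulrBr normrM (gtr0_norm a0) -mulrA ler_wpM2l ?(ltW a0)//.
exact: hC.
Qed.

Section gradients.
Variables (m : pixel Kx Ky -> 'cV[R]_n) (C r : R).
Hypothesis C0 : 0 <= C.
Hypothesis r0 : 0 < r.
Hypothesis expansion : forall k h, eucl h < r -> Theta S (theta0 + h) /\
  `|scaled_signal k (theta0 + h) - scaled_signal k theta0 - dot (m k) h|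
     <= C * eucl h ^+ 2.

Local Notation lin := (lin_change theta0 scaled_signal (bg S) m).
Local Notation lam := (mean_total theta0 scaled_signal (bg S)).

Lemma dark_gradient k : signal S k theta0 = 0 -> m k = 0.
Proof.
move=> s0; apply: (@gradient_eq0 _ _ _ (fun h => scaled_signal k (theta0 + h)) _ C r r0).
  move=> h hr; rewrite mulr_ge0 ?(ltW (area_time_gt0 S))// signal_ge0//.
  by have [] := expansion k hr.
by move=> h hr; have [_] := expansion k hr; rewrite {2}/scaled_signal s0 mulr0 subr0.
Qed.

Lemma partial_mean_count I k i : partial i (mean_count S I k) theta0 = I * m k i 0.
Proof.
have -> : I * m k i 0 = (I *: m k) i 0 by rewrite mxE.
apply: (@derive_of_expansion R d M theta0 (mean_count S I k) (I *: m k) (`|I| * C) r i r0) => h hr.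
have [_ e] := expansion k hr.
have -> : mean_count S I k (theta0 + h) - mean_count S I k theta0 - dot (I *: m k) h =
   I * (scaled_signal k (theta0 + h) - scaled_signal k theta0 - dot (m k) h).
  by rewrite dotZl !mean_countE /scaled_signal; ring.
by rewrite normrM -mulrA ler_wpM2l.
Qed.

Lemma quad_form_fisher I u :
  quad_form (fisher S I theta0) u =
  \sum_k (mean_count S I k theta0)^-1 * (I * dot (m k) u) ^+ 2.
Proof.
rewrite quad_formE /dot; under eq_bigr do rewrite mxE mulr_sumr.
transitivity (\sum_i \sum_j \sum_k (mean_count S I k theta0)^-1 *
   ((I * (m k i 0 * u i 0)) * (I * (m k j 0 * u j 0)))).
  apply: eq_bigr => i _; apply: eq_bigr => j _.
  rewrite mxE mulr_suml mulr_sumr; apply: eq_bigr => k _.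
  by rewrite !partial_mean_count; ring.
transitivity (\sum_i \sum_k \sum_j (mean_count S I k theta0)^-1 *
   ((I * (m k i 0 * u i 0)) * (I * (m k j 0 * u j 0)))).
  by apply: eq_bigr => i _; rewrite exchange_big.
rewrite exchange_big; apply: eq_bigr => k _ /=.
rewrite /dot [I * _]mulr_sumr expr2 big_distrlr /= mulr_sumr.
by apply: eq_bigr => i _; rewrite mulr_sumr.
Qed.

Hypothesis fisher_posdef : forall I, J I -> posdef (fisher S I theta0).

Lemma total_fisher_posdef (N : nat) I : (0 < N)%N -> J I ->
  posdef (total_fisher S N I theta0).
Proof.
move=> N0 /fisher_posdef[sym pos]; split.
  by rewrite /total_fisher linearZ/= sym.
move=> u u0; rewrite quad_formE /total_fisher -scalemxAl dotZr -quad_formE.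
by rewrite mulr_gt0 ?ltr0n// pos.
Qed.

Lemma info_root_sqrtmx (N : nat) I : (0 < N)%N -> J I ->
  info_root theta0 scaled_signal (bg S) m (sqrtmx (total_fisher S N I theta0)) N%:R I.
Proof.
move=> N0 JI; have [sym BB unitB] := sqrtmxP (total_fisher_posdef N0 JI).
split=> // h; rewrite dot_mulmx sym mulmxA BB dotC -quad_formE.
rewrite quad_formE /total_fisher -scalemxAl dotZr -quad_formE quad_form_fisher.
rewrite mulr_sumr; apply: eq_bigr => k _.
rewrite /mean_total /lin_change rate_scaled_signal.
have v0 := mean_count_gt0 k (J_gt0 JI) Theta_theta0.
by field; rewrite gt_eqF.
Qed.

Lemma gradients_span I1 : J I1 ->
  exists2 c : R, 0 < c & forall h, c * eucl h <= \sum_k `|dot (m k) h|.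
Proof.
move=> JI1; have [sym BB unitB] := sqrtmxP (fisher_posdef JI1).
set B := sqrtmx _ in sym BB unitB; have [A A0 hA] := eucl_mulmx_le (invmx B).
have v0 k := mean_count_gt0 k (J_gt0 JI1) Theta_theta0.
have I10 := J_gt0 JI1.
pose w k : R := (Num.sqrt (mean_count S I1 k theta0))^-1 * I1.
have w0 k : 0 <= w k by rewrite mulr_ge0 ?invr_ge0 ?sqrtr_ge0// ltW.
pose D : R := \sum_k w k; have D0 : 0 <= D by exact: sumr_ge0.
have hB h : eucl (B *m h) <= D * \sum_k `|dot (m k) h|.
  rewrite eucl_le; last by rewrite mulr_ge0// sumr_ge0.
  rewrite dot_mulmx sym mulmxA BB dotC -quad_formE quad_form_fisher.
  apply: (@le_trans _ _ (\sum_k (w k * dot (m k) h) ^+ 2)).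
    apply: ler_sum => k _; rewrite !exprMn exprVn sqr_sqrtr ?(ltW (v0 k))//.
    by rewrite mulrA.
  apply: (le_trans (sum_sqr_le _)); rewrite ler_pXn2r ?nnegrE ?sumr_ge0//; last first.
    by rewrite mulr_ge0// sumr_ge0.
  rewrite mulr_sumr; apply: ler_sum => k _; rewrite normrM (ger0_norm (w0 k)).
  by rewrite ler_wpM2r// /D (bigD1 k)//= lerDl sumr_ge0.
have AD : 0 < A * D + 1 by rewrite ltr_wpDl// mulr_ge0.
exists (A * D + 1)^-1 => [|h]; first by rewrite invr_gt0.
rewrite mulrC ler_pdivrMr// mulrDr mulr1 mulrC.
have S0 : 0 <= \sum_k `|dot (m k) h| by exact: sumr_ge0.
apply: (@le_trans _ _ (A * D * \sum_k `|dot (m k) h|)); last by rewrite lerDl.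
rewrite -[in eucl h](mulKmx unitB h) -mulrA (le_trans (hA _))//.
by rewrite ler_wpM2l.
Qed.

End gradients.

End information.

Section deterministic_summary.
Context {R : realType} {d M Kx Ky : nat} (S : frame_model R d M Kx Ky).
Local Notation n := (M * d)%N.
Implicit Types (theta h : 'cV[R]_n) (k : pixel Kx Ky) (I N : R).

Variables (J : set R) (theta0 : 'cV[R]_n).
Hypothesis n_gt0 : (0 < n)%N.
Hypothesis J_gt0 : forall I, J I -> 0 < I.
Hypothesis theta0_int : interior (Theta S) theta0.
Hypothesis envelope : third_order_envelope S J theta0.

Lemma log_expansionW I k (r r' B B' : R) : r' <= r -> B <= B' ->
  log_expansion S theta0 I k r B -> log_expansion S theta0 I k r' B'.
Proof.
move=> rr BB [l [q [h1 h2 h3]]]; exists l, q; split=> // h hr.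
rewrite (le_trans (h3 h (lt_le_trans hr rr)))// ler_wpM2r// exprn_ge0//.
exact: eucl_ge0.
Qed.

Lemma dark_log_expansion k : signal S k theta0 = 0 ->
  exists K r : R, [/\ 0 <= K, 0 < r &
    forall I, J I -> log_expansion S theta0 I k r (K * I)].
Proof.
move=> dk; have [r [C [r0 env]]] := envelope.
pose v := bg S k.
exists (n%:R ^+ 3 * `|4 * C * expR v / Num.min 1 v + 1|), r; split=> //.
move=> I JI; have [G [Gsum hG]] := env I JI; have I0 := J_gt0 JI.
have G0 x : 0 <= G x.
  have := hG x theta0; rewrite subrr eucl0 => /(_ r0 (Ordinal n_gt0) (Ordinal n_gt0) (Ordinal n_gt0)).
  by case=> _ _ _; apply: le_trans.
have [x _ hx] := frame_below_envelope (Theta_theta0 theta0_int) k I0 G0 Gsum.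
apply: log_expansionW (log_expansion_of_envelope k x hG) => //.
rewrite -[leRHS]mulrA ler_wpM2l ?exprn_ge0// (le_trans hx)// mean_countE dk mulr0 add0r -/v.
by rewrite ler_wpM2r ?ler_norm// ltW.
Qed.

Section expansion.
Variables (m : pixel Kx Ky -> 'cV[R]_n) (C r I1 : R).
Hypothesis C0 : 0 <= C.
Hypothesis r0 : 0 < r.
Hypothesis JI1 : J I1.
Hypothesis expansion : forall k h, eucl h < r -> Theta S (theta0 + h) /\
  `|scaled_signal S k (theta0 + h) - scaled_signal S k theta0 - dot (m k) h|
     <= C * eucl h ^+ 2.

Lemma dark_quadratic k h : signal S k theta0 = 0 -> eucl h < r ->
  0 <= scaled_signal S k (theta0 + h) <= C * eucl h ^+ 2.
Proof.
move=> dk hr; have [Tt] := expansion k hr.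
rewrite (dark_gradient r0 expansion dk) dot0l subr0 {2}/scaled_signal dk mulr0 subr0.
have s0 : 0 <= scaled_signal S k (theta0 + h).
  by rewrite mulr_ge0 ?(ltW (area_time_gt0 S)) ?signal_ge0.
by rewrite s0 ger0_norm.
Qed.

Definition dark_negligible (tail : R -> R -> Prop) (r' : R) :=
  forall k, signal S k theta0 = 0 -> forall kap : R, 0 <= kap ->
  exists2 Cd : R, 0 <= Cd & forall N I h, tail N I ->
    eucl h <= kap * eps N I -> eucl h < r' ->
    Num.sqrt N * I * scaled_signal S k (theta0 + h) <= Cd * eps N I.

Lemma dark_negligible_fixed :
  dark_negligible (fun N I => 1 <= N /\ I = I1) r.
Proof.
move=> k dk kap kap0; have I10 := J_gt0 JI1.
exists (C * kap ^+ 2 * Num.sqrt I1) => [|N I h [N1 ->] hk hr].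
  by rewrite mulr_ge0 ?sqrtr_ge0// mulr_ge0// sqr_ge0.
have /andP[_ q] := dark_quadratic dk hr.
have N0 : 0 < N by lra.
have e0 := eps_gt0 N0 I10; have es := eps_sqrtM N0 I10.
have -> : C * kap ^+ 2 * Num.sqrt I1 * eps N I1 =
  Num.sqrt N * I1 * (C * (kap * eps N I1) ^+ 2).
  rewrite -[LHS]mulr1 -es -[X in _ = _ * X * _](@sqr_sqrtr _ I1) ?(ltW I10)//.
  by ring.
rewrite ler_wpM2l ?mulr_ge0 ?sqrtr_ge0 ?(ltW I10)// (le_trans q)// ler_wpM2l//.
rewrite ler_pXn2r ?nnegrE ?eucl_ge0//; apply: mulr_ge0 => //; exact: ltW.
Qed.

Lemma dark_negligible_unbounded : (forall B, exists2 I, J I & B < I) ->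
  exists2 r' : R, 0 < r' &
  dark_negligible (fun N I => 1 <= N /\ (J I /\ I1 <= I)) r'.
Proof.
move=> Jinf; have a0 := area_time_gt0 S.
have [|k|C3 [r3 [C30 r30 h3]]] := @uniform_constants R (pixel Kx Ky)
  (fun k C r => signal S k theta0 = 0 -> forall h, eucl h < r ->
     scaled_signal S k (theta0 + h) <= C * eucl h ^+ 3).
- move=> k A B A' B' hP AA BB dk h hB; apply: (le_trans (hP dk h (lt_le_trans hB BB))).
  by rewrite ler_wpM2r// exprn_ge0// eucl_ge0.
- have [dk|dk] := eqVneq (signal S k theta0) 0; last first.
    by exists 0, 1; split=> // /eqP; rewrite (negbTE dk).
  have [K [rK [K0 rK0 hK]]] := dark_log_expansion dk.
  have rr : 0 < Num.min rK r by rewrite lt_min rK0.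
  have [||A [r'' [A0 r''0 hA]]] := @dark_pixel_cubic _ _ _ _ _ S theta0 k J
    (Num.min rK r) K (C / area_time S) J_gt0 Jinf rr K0 _ dk.
  + by move=> I JI; apply: log_expansionW (hK I JI); rewrite // ge_min lexx.
  + move=> h; rewrite lt_min => /andP[_ hr]; have /andP[q0 q1] := dark_quadratic dk hr.
    apply/andP; split; first by move: q0; rewrite /scaled_signal pmulr_rge0.
    by rewrite mulrAC ler_pdivlMr// mulrC.
  exists (area_time S * A), r''; split=> // [|_ h hr]; first by rewrite mulr_ge0// ltW.
  by have /andP[_ ?] := hA h hr; rewrite -mulrA ler_pM2l.
exists r3 => // k dk kap kap0.
exists (C3 * kap ^+ 3) => [|N I h [N1 [JI _]] hk hr].
  by rewrite mulr_ge0// exprn_ge0.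
have q := h3 k dk h hr.
have N0 : 0 < N by lra.
have I0 := J_gt0 JI.
have e0 := eps_gt0 N0 I0; have es := eps_sqrtM N0 I0.
have sN : 1 <= Num.sqrt N by rewrite -[1]sqrtr1 ler_wsqrtr.
apply: (@le_trans _ _ (Num.sqrt N * I * (C3 * (kap * eps N I) ^+ 3))).
  rewrite ler_wpM2l ?mulr_ge0 ?sqrtr_ge0 ?(ltW I0)// (le_trans q)// ler_wpM2l//.
  rewrite ler_pXn2r ?nnegrE ?eucl_ge0//; apply: mulr_ge0 => //; exact: ltW.
apply: (@le_trans _ _ (Num.sqrt N * (Num.sqrt N * I * (C3 * (kap * eps N I) ^+ 3)))).
  rewrite ler_peMl//; apply: mulr_ge0; first by rewrite mulr_ge0 ?sqrtr_ge0 ?(ltW I0).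
  by rewrite mulr_ge0// exprn_ge0// mulr_ge0// ltW.
have -> : Num.sqrt N * (Num.sqrt N * I * (C3 * (kap * eps N I) ^+ 3)) =
   C3 * kap ^+ 3 * eps N I * (Num.sqrt N * Num.sqrt I * eps N I) ^+ 2.
  by rewrite -{1}(@sqr_sqrtr _ I) ?(ltW I0)//; ring.
by rewrite es expr1n mulr1.
Qed.

Hypothesis regular : forall I, J I -> regular_intensity S I.
Hypothesis fisher_posdef : forall I, J I -> posdef (fisher S I theta0).
Hypothesis ident : identifiable_up_to_relabeling S theta0.
Hypothesis cptT : compact (Theta S).
Variable tail : R -> R -> Prop.
Hypothesis tail_ge : forall N I, tail N I -> 1 <= N /\ I1 <= I.
Hypothesis dark : exists2 r' : R, 0 < r' & dark_negligible tail r'.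

Definition total_counts (N : nat) (x : 'I_N -> frame Kx Ky) k : R := \sum_j (x j k)%:R.

(** On typical data the normalized estimator is the standardized score up to
    an error that vanishes with [eps]. *)
Lemma GML_close_to_score (kap : R) : 0 <= kap ->
  exists e1 Cf : R, [/\ 0 < e1, 0 <= Cf &
  forall (N : nat) I (x : 'I_N -> frame Kx Ky) theta, (0 < N)%N -> J I -> tail N%:R I ->
  typical_counts theta0 (scaled_signal S) (bg S) kap (total_counts x) N%:R I ->
  eps N%:R I <= e1 -> maximizer S I x theta -> correctly_labeled S I x theta0 theta ->
  eucl (normalized S N I theta0 theta - invmx (sqrtmx (total_fisher S N I theta0)) *m
    score_vec theta0 (scaled_signal S) (bg S) m (total_counts x) N%:R I) ^+ 2
  <= Cf * eps N%:R I].
Proof.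
move=> kap0; have [r' r'0 dk] := dark.
have T0 := Theta_theta0 theta0_int.
have I10 := J_gt0 JI1; have a0 := area_time_gt0 S.
have s_ge0 k theta : Theta S theta -> 0 <= scaled_signal S k theta.
  by move=> Tt; rewrite mulr_ge0 ?(ltW a0) ?signal_ge0.
have [c1 c10 span] := gradients_span J_gt0 theta0_int r0 expansion fisher_posdef JI1.
have [rT rT0 hT] := interior_ball theta0_int.
have rr0 : 0 < Num.min rT (Num.min r r') by rewrite !lt_min rT0 r0.
have [|||eta [e1 [Cf [eta0 e10 Cf0 main]]]] := @maximizer_close_to_score R n (pixel Kx Ky)
  (Theta S) theta0 (scaled_signal S) (bg S) m (bg_gt0 S) s_ge0 T0
  (Num.min rT (Num.min r r')) C c1 I1 tail rr0 C0 c10 I10 _ _ span tail_ge _ kap kap0.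
- by move=> h; rewrite lt_min => /andP[hr _]; exact: hT.
- by move=> k h; rewrite !lt_min => /and3P[_ hr _]; have [] := expansion k hr.
- move=> k sk0; have sk : signal S k theta0 = 0.
    by move/eqP: sk0; rewrite mulf_eq0 gt_eqF//= => /eqP.
  split=> [|kp kp0]; first exact: (dark_gradient r0 expansion).
  have [Cd Cd0 hCd] := dk k sk kp kp0; exists Cd => // N I h t hk.
  by rewrite !lt_min => /and3P[_ _ hr]; exact: hCd.
have [e e0 near_relabel] := near_some_relabeling ident cptT I10 (regular JI1) eta0.
have [C1 C10 sb] := signal_bound (bg_gt0 S) s_ge0 T0 kap0 I10.
have C11 : 0 < C1 + 1 by rewrite ltr_wpDl.
exists (Num.min e1 (e * area_time S / (C1 + 1))), Cf; split=> //.
  by rewrite lt_min e10 divr_gt0// mulr_gt0.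
move=> N I x theta N0 JI t good; rewrite le_min => /andP[ee ee2] mx lab.
have [N1 I1I] := tail_ge t; have I0 := J_gt0 JI; have [Tt mx'] := mx.
have ep0 : 0 < eps N%:R I by apply: eps_gt0; rewrite ?ltr0n.
have mxp theta' : Theta S theta' ->
    poisson_loglik (scaled_signal S) (bg S) (total_counts x) N%:R I theta' <=
    poisson_loglik (scaled_signal S) (bg S) (total_counts x) N%:R I theta.
  by move=> Tt'; have := mx' _ Tt'; rewrite !loglikE.
have close : eucl (theta - theta0) < eta.
  have [|s sym hs] := near_relabel theta Tt; last first.
    exact: (correctly_labeled_near T0 sym mx lab hs).
  move=> k; have := sb _ _ _ _ N1 I1I good Tt (mxp _ T0) k.
  rewrite /scaled_signal -mulrBr normrM (gtr0_norm a0) mulrC -ler_pdivlMr// => /le_trans.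
  apply; rewrite ler_pdivrMr//; move: ee2; rewrite ler_pdivlMr// mulrDr mulr1 mulrC.
  by lra.
exact: main t good (info_root_sqrtmx J_gt0 theta0_int r0 expansion fisher_posdef N0 JI) ee Tt mxp close.
Qed.

End expansion.
End deterministic_summary.

Lemma prob_bigcup_le {R : realType} {d : measure_display} {T : measurableType d}
    (P : probability T R) (I : finType) (A : I -> set T) (p : I -> R) :
  (forall i, measurable (A i)) -> (forall i, (P (A i) <= (p i)%:E)%E) ->
  measurable [set w | exists i, A i w] /\
  (P [set w | exists i, A i w] <= (\sum_i p i)%:E)%E.
Proof.
move=> mA hp.
have -> : [set w | exists i, A i w] = \big[setU/set0]_(i <- index_enum I) A i.
  rewrite -bigcup_seq; apply/seteqP; split=> w /=.
    by move=> [i Aw]; exists i => //=; exact: mem_index_enum.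
  by move=> [i _ Aw]; exists i.
elim: (index_enum I) => [|i s [ms IH]]; first by rewrite !big_nil measure0.
rewrite !big_cons; split; first exact: measurableU.
by apply: (le_trans (measureU2 P (mA i) ms)); rewrite EFinD; apply: leeD => //; exact: hp.
Qed.

Lemma random_vector_mulmx {R : realType} {d : measure_display} {T : measurableType d}
    {n : nat} (A : 'M[R]_n) (X : T -> 'cV[R]_n) :
  random_vector X -> random_vector (fun w => A *m X w).
Proof.
move=> mX i; rewrite (_ : (fun w => _) = (fun w => \sum_j A i j * X w j 0)).
  by apply: measurable_sum => j; exact: measurable_funM.
by apply/funext => w; rewrite mxE.
Qed.

Section poisson_data.
Context {R : realType} {d M Kx Ky : nat} (S : frame_model R d M Kx Ky).
Local Notation n := (M * d)%N.
Context {disp : measure_display} {T : measurableType disp} {P : probability T R}.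
Variables (theta0 : 'cV[R]_n) (I : R) (N : nat).
Variable V : 'I_N -> pixel Kx Ky -> {RV P >-> nat}.
Hypothesis T0 : Theta S theta0.
Hypothesis I0 : 0 < I.
Hypothesis N0 : (0 < N)%N.
Hypothesis frames : poisson_frames S I theta0 V.
Implicit Types (k : pixel Kx Ky).

Let Vs (jk : 'I_N * pixel Kx Ky) := V jk.1 jk.2.
Let v k := mean_count S I k theta0.
Let v_gt0 k : 0 < v k. Proof. exact: mean_count_gt0. Qed.
Let N_gt0 : 0 < N%:R :> R. Proof. by rewrite ltr0n. Qed.
Let N_ge1 : 1 <= N%:R :> R. Proof. by rewrite ler1n. Qed.
Local Notation Y w := (total_counts (R := R) (frames_at V w)).
Local Notation lam k := (mean_total theta0 (scaled_signal S) (bg S) k N%:R I).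

Lemma mean_totalE k : lam k = N%:R * v k.
Proof. by rewrite /mean_total rate_scaled_signal. Qed.

Lemma sum_pixels (f : pixel Kx Ky -> R) :
  \sum_(jk : 'I_N * pixel Kx Ky) f jk.2 = \sum_k N%:R * f k.
Proof.
rewrite -(pair_bigA _ (fun (_ : 'I_N) k => f k))/= exchange_big/=.
by apply: eq_bigr => k _; rewrite sumr_const card_ord mulr_natl.
Qed.

Lemma sum_counts (c : pixel Kx Ky -> R) w :
  \sum_jk c jk.2 * (Vs jk w)%:R = \sum_k c k * Y w k.
Proof.
rewrite -(pair_bigA _ (fun j k => c k * (V j k w)%:R))/= exchange_big/=.
apply: eq_bigr => k _; rewrite -mulr_sumr; congr (_ * _).
by apply: eq_bigr => j _; rewrite ffunE.
Qed.

Lemma sum_centered_counts (c : pixel Kx Ky -> R) w :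
  \sum_jk c jk.2 * ((Vs jk w)%:R - v jk.2) = \sum_k c k * (Y w k - lam k).
Proof.
under eq_bigr do rewrite mulrBr; rewrite sumrB sum_counts.
rewrite (sum_pixels (fun k => c k * v k)) -sumrB; apply: eq_bigr => k _.
by rewrite mean_totalE; ring.
Qed.

Lemma measurable_total_counts k : measurable_fun [set: T] (fun w => Y w k).
Proof.
apply: measurable_sum => j.
have -> : (fun w => (frames_at V w j k)%:R : R) = (fun m : nat => m%:R : R) \o V j k.
  by apply/funext => w; rewrite /= ffunE.
exact: measurableT_comp.
Qed.

(** The weights [+- (sqrt lam)^-1] on a single pixel give the exponential
    moment of the standardized count, bounded because the mean is at least the
    noise mean. *)
Lemma atypical_prob (kap : R) :
  let A := [set w | ~ typical_counts theta0 (scaled_signal S) (bg S) kap (Y w) N%:R I] in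
  measurable A /\
  (P A <= (\sum_k 2 * expR (expR (Num.sqrt (bg S k))^-1 - kap))%:E)%E.
Proof.
have lam0 k : 0 < lam k by rewrite mean_totalE mulr_gt0.
pose q k := Num.sqrt (lam k); have q0 k : 0 < q k by rewrite sqrtr_gt0.
pose E (kb : pixel Kx Ky * bool) :=
  [set w | kap < ((-1) ^+ kb.2 / q kb.1) * (Y w kb.1 - lam kb.1)].
have mE kb : measurable (E kb).
  rewrite (_ : E kb = (fun w => ((-1) ^+ kb.2 / q kb.1) * (Y w kb.1 - lam kb.1)) @^-1` `]kap, +oo[%classic).
    rewrite -[X in measurable X]setTI.
    apply: (_ : measurable_fun _ _) => //; apply: measurable_funM => //.
    by apply: measurable_funB => //; exact: measurable_total_counts.
  by apply/seteqP; split=> w; rewrite /E /= in_itv/= andbT.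
have pE kb : (P (E kb) <= (expR (expR (Num.sqrt (bg S kb.1))^-1 - kap))%:E)%E.
  case: kb => k e; pose a := (-1) ^+ e / q k.
  pose c k' : R := if k' == k then a else 0.
  have cs (f : pixel Kx Ky -> R) : \sum_k' c k' * f k' = a * f k.
    rewrite (bigD1 k)//= big1 ?addr0 /c ?eqxx// => k' /negbTE ->.
    by rewrite mul0r.
  have := @poisson_chernoff R _ _ P _ Vs (fun jk => v jk.2)
    (fun jk => v_gt0 jk.2) (fun jk => frames.1 jk.1 jk.2) frames.2 (fun jk => c jk.2) kap.
  have -> : [set w | (kap < \sum_jk c jk.2 * ((Vs jk w)%:R - v jk.2))%R] = E (k, e).
    by apply/seteqP; split=> w; rewrite /E /= sum_centered_counts cs.
  move/le_trans; apply; rewrite lee_fin ler_expR lerD2r.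
  rewrite (sum_pixels (fun k => v k * (expR (c k) - 1 - c k))).
  rewrite (bigD1 k)//= big1 ?addr0 => [|k' /negbTE kk]; last first.
    by rewrite /c kk expR0 subrr sub0r oppr0 !mulr0.
  rewrite /c eqxx mulrA -mean_totalE.
  have na : `|a| = (q k)^-1.
    by rewrite /a normrM normrX normrN1 expr1n mul1r gtr0_norm// invr_gt0.
  apply: (@le_trans _ _ (lam k * (a ^+ 2 * expR `|a|))).
    by rewrite ler_wpM2l ?(ltW (lam0 k))// (le_trans (ler_norm _))// norm_expR1DB_le.
  rewrite -real_normK ?num_real// na exprVn sqr_sqrtr ?(ltW (lam0 k))//.
  rewrite mulrA mulfV ?mul1r ?gt_eqF// ler_expR lef_pV2 ?posrE// ?sqrtr_gt0 ?bg_gt0//.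
  rewrite ler_wsqrtr// mean_totalE.
  apply: (@le_trans _ _ (v k)); first exact: mean_count_ge_bg.
  by rewrite ler_peMl ?(ltW (v_gt0 k)).
have [mU pU] := prob_bigcup_le mE pE.
move=> A; have -> : A = [set w | exists kb, E kb w].
  apply/seteqP; split=> w; rewrite /A /E /=.
    move=> bad; apply: contrapT => h; apply: bad => k; split.
      by apply: sumr_ge0 => j _.
    have small (e : bool) : (-1) ^+ e / q k * (Y w k - lam k) <= kap.
      by rewrite leNgt; apply/negP => hh; apply: h; exists (k, e).
    have := small false; have := small true; rewrite expr0 expr1.
    rewrite -!mulrA !(mulrC (q k)^-1) !mulrA !ler_pdivrMr// mulN1r mul1r => h1 h2.
    by rewrite -/(q k) ler_norml h2 andbT lerNl.
  move=> [[k e] /= hk] good; have [_] := good k; rewrite leNgt => /negP; apply.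
  rewrite -/(q k) -ltr_pdivlMr// (lt_le_trans hk)//.
  rewrite (le_trans (ler_norm _))// !normrM normrX normrN1 expr1n mul1r normfV.
  by rewrite (gtr0_norm (q0 k)) mulrC.
split=> //; apply: (le_trans pU); rewrite lee_fin.
rewrite -(pair_bigA _ (fun k (_ : bool) => expR (expR (Num.sqrt (bg S k))^-1 - kap)))/=.
by apply: ler_sum => k _; rewrite sumr_const card_bool mulr_natl.
Qed.

Variables (m : pixel Kx Ky -> 'cV[R]_n) (B : 'M[R]_n).
Hypothesis infoB : info_root theta0 (scaled_signal S) (bg S) m B N%:R I.
Hypothesis dark : forall k, signal S k theta0 = 0 -> m k = 0.

Definition std_score w : 'cV[R]_n := invmx B *m
  score_vec theta0 (scaled_signal S) (bg S) m (Y w) N%:R I.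
Local Notation lin := (lin_change theta0 (scaled_signal S) (bg S) m).

Lemma dot_std_score u w :
  dot u (std_score w) = \sum_k (Y w k - lam k) * lin k I (invmx B *m u).
Proof.
have [Bs Bu _] := infoB.
rewrite -(dot_invmx_score _ _ infoB) mulmxA mulmxV// mul1mx dotC //.
Qed.

Lemma random_vector_std_score : random_vector std_score.
Proof.
apply: random_vector_mulmx => i.
rewrite (_ : (fun w => _) = (fun w =>
  \sum_k (Y w k - lam k) * (I / rate (scaled_signal S) (bg S) k I theta0) * m k i 0)).
  apply: measurable_sum => k; apply: measurable_funM => //.
  apply: measurable_funM => //; apply: measurable_funB => //.
  exact: measurable_total_counts.
by apply/funext => w; rewrite summxE; apply: eq_bigr => k _; rewrite mxE.
Qed.

Definition bright_bound : R := \sum_k (Num.sqrt (scaled_signal S k theta0))^-1.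

Lemma lin_change_small u k :
  `|lin k I (invmx B *m u)| <= bright_bound * eps N%:R I * eucl u.
Proof.
have [Bs Bu _] := infoB; have a0 := area_time_gt0 S.
have e0 := eps_gt0 N_gt0 I0; have es := eps_sqrtM N_gt0 I0.
have b0 : 0 <= bright_bound by apply: sumr_ge0 => j _; rewrite invr_ge0 sqrtr_ge0.
have := signal_ge0 k T0; rewrite le_eqVlt => /predU1P[/esym sk|sk].
  rewrite /lin_change dark// dot0l mulr0 mul0r normr0.
  by rewrite !mulr_ge0 ?eucl_ge0// ltW.
have ss : 0 < scaled_signal S k theta0 by rewrite mulr_gt0.
have sg : 0 < Num.sqrt (scaled_signal S k theta0) by rewrite sqrtr_gt0.
have s_ge0 k' theta : Theta S theta -> 0 <= scaled_signal S k' theta.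
  by move=> Tt; rewrite mulr_ge0 ?(ltW a0) ?signal_ge0.
have := lin_change_le (bg_gt0 S) s_ge0 T0 (invmx B *m u) k (ltW N_gt0) (ltW I0) infoB.
rewrite mulmxA mulmxV// mul1mx => h.
apply: (@le_trans _ _ ((Num.sqrt (scaled_signal S k theta0))^-1 * eps N%:R I * eucl u)); last first.
  rewrite ler_wpM2r ?eucl_ge0// ler_wpM2r ?(ltW e0)// /bright_bound (bigD1 k)//= lerDl.
  by apply: sumr_ge0 => j _; rewrite invr_ge0 sqrtr_ge0.
set x := `|lin k I _| in h *.
have x0 : 0 <= x := normr_ge0 _.
have lo : Num.sqrt N%:R * Num.sqrt I * Num.sqrt (scaled_signal S k theta0) <= Num.sqrt (lam k).
  rewrite -!sqrtrM ?mulr_ge0 ?(ltW I0)// ler_wsqrtr// mean_totalE -mulrA ler_wpM2l//.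
  by rewrite /v -rate_scaled_signal lerDl ltW// bg_gt0.
have {}h := le_trans (ler_wpM2r x0 lo) h.
rewrite -mulrA mulrC ler_pdivlMr//.
have -> : x * Num.sqrt (scaled_signal S k theta0) =
  eps N%:R I * (Num.sqrt N%:R * Num.sqrt I * Num.sqrt (scaled_signal S k theta0) * x).
  transitivity (Num.sqrt N%:R * Num.sqrt I * eps N%:R I *
    (x * Num.sqrt (scaled_signal S k theta0))); first by rewrite es mul1r.
  by ring.
by rewrite ler_wpM2l// ltW.
Qed.

Definition cos_err u : R :=
  \sum_k lam k * (cos (lin k I (invmx B *m u)) - 1) + dot u u / 2.
Definition sin_err u : R :=
  \sum_k lam k * (sin (lin k I (invmx B *m u)) - lin k I (invmx B *m u)).

Lemma std_score_cos al u : \int[P]_w cos (al + dot u (std_score w)) =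
  expR (- (dot u u / 2) + cos_err u) * cos (al + sin_err u).
Proof.
pose c k := lin k I (invmx B *m u).
transitivity (\int[P]_w cos ((al - \sum_k lam k * c k) + \sum_jk c jk.2 * (Vs jk w)%:R)).
  apply: eq_Rintegral => w _; congr cos; rewrite dot_std_score sum_counts -addrA; congr (_ + _).
  by rewrite addrC -sumrB; apply: eq_bigr => k _; rewrite /c; ring.
rewrite (@poisson_family_cos R _ _ P _ Vs (fun jk => v jk.2)
    (fun jk => v_gt0 jk.2) (fun jk => frames.1 jk.1 jk.2) frames.2).
congr (expR _ * cos _).
  rewrite (sum_pixels (fun k => v k * (cos (c k) - 1))) /cos_err addrCA addNr addr0.
  by apply: eq_bigr => k _; rewrite mean_totalE mulrA.
rewrite (sum_pixels (fun k => v k * sin (c k))) -addrA; congr (_ + _).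
rewrite addrC -sumrB; apply: eq_bigr => k _; rewrite mean_totalE /c; ring.
Qed.

Lemma sum_sqr_lin u : \sum_k lam k * lin k I (invmx B *m u) ^+ 2 = dot u u.
Proof. by have [_ Bu <-] := infoB; rewrite mulmxA mulmxV// mul1mx. Qed.

Lemma sin_err_small u :
  `|sin_err u| <= bright_bound * eps N%:R I * eucl u * dot u u.
Proof.
rewrite -sum_sqr_lin mulr_sumr (le_trans (ler_norm_sum _ _ _))//.
apply: ler_sum => k _; rewrite normrM ger0_norm; last first.
  by rewrite mean_totalE mulr_ge0// ltW.
rewrite mulrCA ler_wpM2l ?mean_totalE ?mulr_ge0 ?(ltW (v_gt0 k))//.
rewrite (le_trans (norm_sinB_le _))// exprS -(@real_normK _ (lin k I _)) ?num_real//.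
by rewrite ler_wpM2r ?sqr_ge0// lin_change_small.
Qed.

Lemma cos_err_small u :
  `|cos_err u| <= (bright_bound * eps N%:R I * eucl u) ^+ 2 * dot u u.
Proof.
rewrite /cos_err -sum_sqr_lin mulr_suml -big_split/=.
rewrite mulr_sumr (le_trans (ler_norm_sum _ _ _))//.
apply: ler_sum => k _.
have -> : lam k * (cos (lin k I (invmx B *m u)) - 1) +
    lam k * lin k I (invmx B *m u) ^+ 2 / 2 =
  lam k * (cos (lin k I (invmx B *m u)) - 1 + lin k I (invmx B *m u) ^+ 2 / 2) by ring.
rewrite normrM ger0_norm; last by rewrite mean_totalE mulr_ge0// ltW.
rewrite mulrCA ler_wpM2l ?mean_totalE ?mulr_ge0 ?(ltW (v_gt0 k))//.
rewrite (le_trans (norm_cosB_le _))// -[4%N]/(2 + 2)%N exprD.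
rewrite -(@real_normK _ (lin k I _)) ?num_real// ler_wpM2r ?sqr_ge0//.
by rewrite ler_pXn2r ?nnegrE// ?(le_trans _ (lin_change_small u k))// lin_change_small.
Qed.

End poisson_data.

Section convergence.
Context {R : realType} {d M Kx Ky : nat} (S : frame_model R d M Kx Ky).
Local Notation n := (M * d)%N.
Variables (J : set R) (theta0 : 'cV[R]_n).
Variables (disp : measure_display) (T : nat * R -> measurableType disp)
  (P : forall a : nat * R, probability (T a) R)
  (V : forall a : nat * R, 'I_a.1 -> pixel Kx Ky -> {RV (P a) >-> nat})
  (GML : forall a : nat * R, T a -> 'cV[R]_n).
Variables (m : pixel Kx Ky -> 'cV[R]_n) (tail : R -> R -> Prop).
Arguments V : clear implicits.
Arguments GML : clear implicits.
Local Notation root N I := (sqrtmx (total_fisher S N I theta0)).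

Hypothesis T0 : Theta S theta0.
Hypothesis J_gt0 : forall I, J I -> 0 < I.
Hypothesis frames : forall a : nat * R, J a.2 -> poisson_frames S a.2 theta0 (V a).
Hypothesis GMLP : forall a : nat * R, J a.2 -> GML_estimator S a.2 theta0 (V a) (GML a).
Hypothesis dark : forall k, signal S k theta0 = 0 -> m k = 0.
Hypothesis infoP : forall (N : nat) I, (0 < N)%N -> J I ->
  info_root theta0 (scaled_signal S) (bg S) m (root N I) N%:R I.
Hypothesis close : forall kap : R, 0 <= kap ->
  exists e1 Cf : R, [/\ 0 < e1, 0 <= Cf &
  forall (N : nat) I (x : 'I_N -> frame Kx Ky) theta, (0 < N)%N -> J I -> tail N%:R I ->
  typical_counts theta0 (scaled_signal S) (bg S) kap (total_counts x) N%:R I ->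
  eps N%:R I <= e1 -> maximizer S I x theta -> correctly_labeled S I x theta0 theta ->
  eucl (normalized S N I theta0 theta - invmx (root N I) *m
    score_vec theta0 (scaled_signal S) (bg S) m (total_counts x) N%:R I) ^+ 2
  <= Cf * eps N%:R I].

Let X a w := normalized S a.1 a.2 theta0 (GML a w).
Let U a := std_score S theta0 a.2 (V a) m (root a.1 a.2).
Arguments X : clear implicits.
Arguments U : clear implicits.
Definition atypical_bound (kap : R) : R :=
  \sum_k 2 * expR (expR (Num.sqrt (bg S k))^-1 - kap).

Lemma atypical_bound_small (e : R) : 0 < e ->
  exists2 kap : R, 0 <= kap & atypical_bound kap <= e.
Proof.
move=> e0; pose D : R := \sum_k 2 * expR (expR (Num.sqrt (bg S k))^-1).
have D0 : 0 <= D by apply: sumr_ge0 => k _; rewrite mulr_ge0 ?expR_ge0.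
exists (D / e) => [|]; first by rewrite divr_ge0// ltW.
have -> : atypical_bound (D / e) = D * expR (- (D / e)).
  rewrite /atypical_bound; set t := D / e; rewrite /D mulr_suml.
  by apply: eq_bigr => k _; rewrite expRD mulrA.
rewrite expRN ler_pdivrMr ?expR_gt0//.
apply: (@le_trans _ _ (e * (1 + D / e))).
  by rewrite mulrDr mulrCA mulfV ?gt_eqF// !mulr1 lerDr ltW.
by rewrite ler_wpM2l ?(ltW e0)// expR_ge1Dx.
Qed.

Lemma good_event (kap : R) : 0 <= kap -> exists e1 Cf : R, [/\ 0 < e1, 0 <= Cf &
  forall a : nat * R, J a.2 -> (0 < a.1)%N -> tail a.1%:R a.2 -> eps a.1%:R a.2 <= e1 ->
  exists A : set (T a), [/\ measurable A, fine (P a A) <= atypical_bound kap &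
  forall w, ~ A w -> eucl (X a w - U a w) ^+ 2 <= Cf * eps a.1%:R a.2 /\
    eucl (U a w) <= kap * #|{: pixel Kx Ky}|%:R]].
Proof.
move=> kap0; have [e1 [Cf [e10 Cf0 cl]]] := close kap0.
exists e1, Cf; split=> // a Ja N0 ta ea.
have [mA pA] := atypical_prob T0 (J_gt0 Ja) N0 (frames Ja) kap.
set A := [set w | _] in mA pA.
have [_ [Z [mZ PZ sub]]] := GMLP Ja.
exists (A `|` Z); split; first exact: measurableU.
  have mAZ : measurable (A `|` Z) by exact: measurableU.
  rewrite -lee_fin fineK ?fin_num_measure//.
  by rewrite (le_trans (measureU2 (P a) mA mZ))// [X in (_ + X)%E]PZ adde0.
move=> w nAZ; have good : typical_counts theta0 (scaled_signal S) (bg S) kap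
    (total_counts (frames_at (V a) w)) a.1%:R a.2.
  by apply: contrapT => bad; apply: nAZ; left.
have [mx lab] : maximizer S a.2 (frames_at (V a) w) (GML a w) /\
    correctly_labeled S a.2 (frames_at (V a) w) theta0 (GML a w).
  by apply: contrapT => bad; apply: nAZ; right; apply: sub.
split; first exact: cl.
apply: (invmx_score_le (bg_gt0 S) _ T0 kap0 _ _ good (infoP N0 Ja)) => //.
  by move=> k theta Tt; rewrite mulr_ge0 ?(ltW (area_time_gt0 S)) ?signal_ge0.
exact/ltW/J_gt0.
Qed.

Variable G : set_system (nat * R).
Context {FG : Filter G}.
Hypothesis nearG : \forall a \near G, [/\ J a.2, (0 < a.1)%N & tail a.1%:R a.2].
Hypothesis eps0 : eps a.1%:R a.2 @[a --> G] --> (0 : R).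

Lemma near_random_vector : \forall a \near G, random_vector (X a) /\ random_vector (U a).
Proof.
apply: filterS nearG => a [Ja N0 _]; split; last exact: random_vector_std_score.
apply: random_vector_mulmx => i; have [mX _] := GMLP Ja.
rewrite (_ : (fun w => _) = (fun w => GML a w i 0 - theta0 i 0)).
  exact: measurable_funB.
by apply/funext => w; rewrite !mxE.
Qed.

Lemma near_good_event (kap e : R) : 0 <= kap -> 0 < e -> \forall a \near G,
  exists A : set (T a), [/\ measurable A, fine (P a A) <= atypical_bound kap &
  forall w, ~ A w -> eucl (X a w - U a w) <= e /\
    eucl (U a w) <= kap * #|{: pixel Kx Ky}|%:R].
Proof.
move=> kap0 e0; have [e1 [Cf [e10 Cf0 good]]] := good_event kap0.
have C1 : 0 < Cf + 1 by rewrite ltr_wpDl.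
have small (r : R) : 0 < r -> \forall a \near G, eps a.1%:R a.2 <= r.
  by move=> r0; apply: (cvgr_le _ eps0).
near=> a; have [Ja N0 ta] : [/\ J a.2, (0 < a.1)%N & tail a.1%:R a.2] by near: a.
have ea : eps a.1%:R a.2 <= e1 by near: a; exact: small.
have ee : eps a.1%:R a.2 <= e ^+ 2 / (Cf + 1).
  by near: a; apply: small; rewrite divr_gt0// exprn_gt0.
have [A [mA pA hA]] := good a Ja N0 ta ea.
exists A; split=> // w /hA[h1 h2]; split=> //.
rewrite -(@ler_pXn2r _ 2) ?nnegrE ?eucl_ge0 ?(ltW e0)// (le_trans h1)//.
have ep0 := ltW (@eps_gt0 R a.1%:R a.2 _ (J_gt0 Ja)).
move: ee; rewrite ler_pdivlMr// mulrDr mulr1 mulrC; have := ep0.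
by rewrite ltr0n => /(_ N0); lra.
Unshelve. all: by end_near.
Qed.

Lemma cvg_std_score_cos al u : \int[P a]_w cos (al + dot u (U a w)) @[a --> G] -->
  cos al * expR (- (dot u u / 2)).
Proof.
pose e a := bright_bound S theta0 * eps a.1%:R a.2 * eucl u.
have ce : e a @[a --> G] --> (0 : R).
  rewrite -(mul0r (eucl u)) -(mulr0 (bright_bound S theta0)).
  by apply: cvgMl; apply: cvgMr.
pose B a := root a.1 a.2.
have c1 : cos_err S theta0 a.2 a.1 m (B a) u @[a --> G] --> (0 : R).
  have bnd : (e a * e a * dot u u) @[a --> G] --> (0 : R).
    suff : (e a * e a * dot u u) @[a --> G] --> 0 * 0 * dot u u by rewrite !mul0r.
    by apply: cvgM; [exact: cvgM|exact: cvg_cst].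
  apply/norm_cvg0P; apply: (squeeze_cvgr _ (cvg_cst 0) bnd).
  apply: filterS nearG => a [Ja N0 _]; rewrite normr_ge0/= -expr2.
  by apply: cos_err_small => //; [exact: J_gt0|exact: infoP].
have c2 : sin_err S theta0 a.2 a.1 m (B a) u @[a --> G] --> (0 : R).
  have bnd : (e a * dot u u) @[a --> G] --> (0 : R).
    by rewrite -(mul0r (dot u u)); apply: cvgMl.
  apply/norm_cvg0P; apply: (squeeze_cvgr _ (cvg_cst 0) bnd).
  apply: filterS nearG => a [Ja N0 _]; rewrite normr_ge0/=.
  by apply: sin_err_small => //; [exact: J_gt0|exact: infoP].
apply: (@cvg_trans _ ((expR (- (dot u u / 2) + cos_err S theta0 a.2 a.1 m (B a) u) *
   cos (al + sin_err S theta0 a.2 a.1 m (B a) u)) @[a --> G])).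
  apply: near_eq_cvg; apply: filterS nearG => a [Ja N0 _].
  by rewrite (std_score_cos T0 (J_gt0 Ja) (frames Ja) (infoP N0 Ja)).
rewrite (mulrC (cos al)); apply: cvgM.
  apply: (continuous_cvg _ (f := fun a => - (dot u u / 2) +
    cos_err S theta0 a.2 a.1 m (B a) u) (h := expR)); first exact: continuous_expR.
  by rewrite -[X in _ --> X]addr0; apply: cvgD => //; exact: cvg_cst.
apply: (continuous_cvg _ (f := fun a => al + sin_err S theta0 a.2 a.1 m (B a) u)
  (h := cos)); first exact: continuous_cos.
by rewrite -[X in _ --> X]addr0; apply: cvgD => //; exact: cvg_cst.
Qed.

Lemma normalized_GML_cvg : cvg_to_normal G P X 0 1%:M.
Proof.
move=> d' T' P' Z ZN f cf bf; apply: cvg_law_of_cvg_cos => //.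
- by case: ZN.
- by apply: filterS near_random_vector => a [].
- move=> eta eta0; have [kap kap0 hkap] := atypical_bound_small eta0.
  pose q : R := kap * #|{: pixel Kx Ky}|%:R.
  have q0 : 0 <= q by rewrite mulr_ge0.
  exists (q + 1) => [|]; first by rewrite ltr_wpDl.
  near=> a.
  have [mX _] : random_vector (X a) /\ random_vector (U a).
    by near: a; exact: near_random_vector.
  have [A [mA pA hA]] : exists A : set (T a), [/\ measurable A,
      fine (P a A) <= atypical_bound kap &
      forall w, ~ A w -> eucl (X a w - U a w) <= 1 /\ eucl (U a w) <= q].
    by near: a; exact: near_good_event.
  apply: (@le_trans _ _ (P a A)).
    apply: le_measure; rewrite ?inE//; first exact: measurable_outside_cube.
    move=> w [i hi]; apply: contrapT => /hA[h1 h2].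
    have := euclD (X a w - U a w) (U a w); rewrite subrK.
    have := eucl_entry (X a w) i; lra.
  by rewrite -[P a A]fineK ?fin_num_measure// lee_fin (le_trans pA).
move=> al u; rewrite (normal_law_cos al u ZN).
apply/cvgrPdist_le => e e0.
have e8 : 0 < e / 8 by rewrite divr_gt0.
have [kap kap0 hkap] := atypical_bound_small e8.
have u1 : 0 < eucl u + 1 by rewrite ltr_wpDl ?eucl_ge0.
near=> a.
have [mX mU] : random_vector (X a) /\ random_vector (U a).
  by near: a; exact: near_random_vector.
have [A [mA pA hA]] : exists A : set (T a), [/\ measurable A,
    fine (P a A) <= atypical_bound kap &
    forall w, ~ A w -> eucl (X a w - U a w) <= e / 4 / (eucl u + 1) /\
     eucl (U a w) <= kap * #|{: pixel Kx Ky}|%:R].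
  by near: a; apply: near_good_event => //; rewrite !divr_gt0.
have h1 : `|cos al * expR (- (dot u u / 2)) - \int[P a]_w cos (al + dot u (U a w))| <= e / 4.
  near: a; move/cvgrPdist_le : (@cvg_std_score_cos al u); apply; rewrite divr_gt0//.
have h2 := @Rintegral_close R _ _ (P a) _ _ (e / 4) 2 A
  (bounded_rv_cos_dot al u mX) (bounded_rv_cos_dot al u mU) mA.
have {}h2 : `|\int[P a]_w cos (al + dot u (X a w)) - \int[P a]_w cos (al + dot u (U a w))|
    <= e / 4 + 2 * fine (P a A).
  apply: h2; last by rewrite divr_ge0// ltW.
    move=> w /hA[hw _]; rewrite (le_trans (cos_lip _ _))//.
    rewrite opprD addrACA subrr add0r -dotBr (le_trans (cauchy_schwarz _ _))//.
    move: hw; rewrite ler_pdivlMr// mulrDr mulr1 mulrC.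
    have := eucl_ge0 (X a w - U a w); lra.
  move=> w; rewrite (le_trans (ler_normB _ _))//.
  have := cos_max (al + dot u (X a w)); have := cos_max (al + dot u (U a w)); lra.
rewrite -(subrK (\int[P a]_w cos (al + dot u (U a w))) (cos al * _)) -addrA.
rewrite (le_trans (ler_normD _ _))// [X in _ + X]distrC; lra.
Unshelve. all: by end_near.
Qed.

End convergence.

Section normal_translation.
Context {R : realType}.
Local Notation mu := (@lebesgue_measure R).
Variable c : R.
Let shift (x : measurableTypeR R) : measurableTypeR R := c + x.

Let measurable_shift : measurable_fun [set: measurableTypeR R] shift.
Proof. exact: measurable_funD. Qed.
Let shift_mixin := isMeasurableFun.Build _ _ _ _ _ measurable_shift.
Let shift_mfun : {mfun measurableTypeR R >-> measurableTypeR R} := HB.pack shift shift_mixin.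

Lemma lebesgue_measure_shift (A : set (measurableTypeR R)) : measurable A ->
  mu A = pushforward mu shift A.
Proof.
apply: (@lebesgue_measure_unique R (pushforward mu shift_mfun)) => _ [[a b] _ <-] /=.
rewrite /pushforward/= (_ : shift @^-1` _ = `]a - c, b - c]%classic).
  rewrite !lebesgue_measure_itv/= !lte_fin ltrD2r; case: ifPn => // _.
  by rewrite -!EFinD; congr (_%:E); ring.
by apply/seteqP; split=> x /=; rewrite /shift !in_itv/= ltrBlDl lerBrDl.
Qed.

Lemma normal_prob_shift (s : R) (A : set (measurableTypeR R)) : s != 0 -> measurable A ->
  normal_prob 0 s (shift @^-1` A) = normal_prob c s A.
Proof.
move=> s0 mA; rewrite /normal_prob.
transitivity (\int[mu]_(x in shift @^-1` A) (((fun x => (normal_pdf c s x)%:E) \o shift) x))%E.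
  apply: eq_integral => x _; rewrite /= !normal_pdfE//.
  by rewrite /normal_fun /shift (addrC c) addrK subr0.
rewrite -ge0_integral_pushforward//; last 2 first.
- apply/measurable_EFinP; apply: measurable_funTS; exact: measurable_normal_pdf.
- by move=> x _; rewrite lee_fin normal_pdf_ge0.
by apply: eq_measure_integral => B mB _; rewrite [RHS]lebesgue_measure_shift.
Qed.

End normal_translation.

Section gaussian_affine.
Context {R : realType} {disp : measure_display} {T : measurableType disp}
  (P : probability T R) {n : nat}.

Lemma normal1_shift (c var : R) (A : set R) : 0 <= var -> measurable A ->
  Defs.normal1 0 var [set x | A (c + x)] = Defs.normal1 c var A.
Proof.
move=> v0 mA; rewrite /Defs.normal1; case: eqVneq => [_|vn].
  rewrite !diracE; suff -> : (0 \in [set x | A (c + x)]) = (c \in A) by [].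
  by apply/idP/idP; rewrite !inE /= addr0.
by apply: normal_prob_shift => //; rewrite gt_eqF// sqrtr_gt0 lt_neqAle eq_sym vn.
Qed.

Lemma normal_law_affine (z : T -> 'cV[R]_n) (mean : 'cV[R]_n) (B A : 'M[R]_n) :
  normal_law P z 0 1%:M -> A = B *m B^T ->
  normal_law P (fun w => mean + B *m z w) mean A.
Proof.
move=> [mz hz] AE; split=> [|u D mD].
  move=> i; rewrite (_ : (fun w => _) = (fun w => mean i 0 + (B *m z w) i 0)).
    by apply: measurable_funD => //; exact: random_vector_mulmx.
  by apply/funext => w; rewrite mxE.
pose c := dot u mean.
have -> : [set w | D ((u^T *m (mean + B *m z w)) 0 0)] =
    [set w | [set x | D (c + x)] (((B^T *m u)^T *m z w) 0 0)].
  by apply/seteqP; split=> w /=; rewrite !dotE dotDr dot_mulmx.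
rewrite hz; last first.
  have mc : measurable_fun [set: R] (fun x : R => c + x) by exact: measurable_funD.
  by rewrite -[X in measurable X]setTI; exact: mc.
have mean0 : ((B^T *m u)^T *m (0 : 'cV[R]_n)) 0 0 = 0 by rewrite dotE dot0r.
have varE : quad_form 1%:M (B^T *m u) = quad_form A u.
  by rewrite AE quad_form1 quad_formE -mulmxA [RHS]dot_mulmx.
rewrite mean0 varE [(u^T *m mean) 0 0]dotE.
by apply: normal1_shift mD; rewrite -varE quad_form1 dot_ge0.
Qed.

End gaussian_affine.

Section ugia.
Context {R : realType} {d M Kx Ky : nat} (S : frame_model R d M Kx Ky).
Context {disp : measure_display} {T : measurableType disp} (P : probability T R).
Variables (theta0 : 'cV[R]_(M * d)) (N : nat) (I : R) (z : T -> 'cV[R]_(M * d)).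
Hypothesis zN : normal_law P z 0 1%:M.
Hypothesis posF : posdef (total_fisher S N I theta0).

Lemma UGIAF_normal : normal_law P (UGIAF S N I theta0 z) theta0
  (invmx (total_fisher S N I theta0)).
Proof.
have [sym BB unitB] := sqrtmxP posF.
apply: normal_law_affine => //; rewrite trmx_inv sym.
set A := total_fisher _ _ _ _ in sym BB unitB *; set B := sqrtmx A in sym BB unitB *.
have unitA : A \in unitmx by rewrite -BB unitmx_mul unitB.
apply: (can_inj (mulKmx unitA)); rewrite mulmxV// -[X in _ = X *m _]BB.
by rewrite -mulmxA (mulmxA B (invmx B)) mulmxV// mul1mx mulmxV.
Qed.

Lemma normalized_UGIAF : (fun w => normalized S N I theta0 (UGIAF S N I theta0 z w)) = z.
Proof.
have [_ _ unitB] := sqrtmxP posF; apply/funext => w.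
by rewrite /normalized /UGIAF addrC addKr mulmxA mulmxV// mul1mx.
Qed.

End ugia.

Definition diverges {R : realType} (G : set_system (nat * R)) :=
  forall K : R, \forall a \near G, K <= a.1%:R * a.2.

Lemma cvg_eps {R : realType} (G : set_system (nat * R)) {FG : Filter G} :
  diverges G -> eps a.1%:R a.2 @[a --> G] --> (0 : R).
Proof.
move=> h; apply/cvgrPdist_le => e e0; apply: filterS (h (e ^- 2)) => a ha.
rewrite sub0r normrN ger0_norm ?invr_ge0 ?sqrtr_ge0// /eps.
rewrite -[e]invrK lef_pV2 ?posrE ?invr_gt0//; last first.
  by rewrite sqrtr_gt0 (lt_le_trans _ ha)// invr_gt0 exprn_gt0.
by rewrite -[e^-1]ger0_norm ?invr_ge0 ?(ltW e0)// -sqrtr_sqr ler_wsqrtr// exprVn.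
Qed.

Section regimes.
Context {R : realType}.
Variables (J : set R) (G : set_system (nat * R)).
Hypothesis J_gt0 : forall I, J I -> 0 < I.

Lemma near_within_pinfty (B : R) : within J (pinfty_nbhs R) [set I | J I /\ B <= I].
Proof. by exists B; split; rewrite ?num_real// => I /ltW ? ?; split. Qed.

(** When the set of intensities is bounded, a limit in which the intensity grows
    is taken along the trivial filter. *)
Lemma regime_cases : asymptotic_regime J G -> Filter G /\
  [\/ exists2 I, J I & diverges G /\ \forall a \near G, (0 < a.1)%N /\ a.2 = I,
      diverges G /\ (forall B, exists2 I, J I & B < I) /\
        forall B, \forall a \near G, (0 < a.1)%N /\ (J a.2 /\ B <= a.2) |
      G set0].
Proof.
have scale (K I : R) (N : nat) : (0 < N)%N -> Num.max 0 K <= I -> K <= N%:R * I.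
  rewrite ge_max => N0 /andP[I0 KI]; apply: (le_trans KI).
  by rewrite ler_peMl// ler1n.
have [Jinf|] := pselect (forall B, exists2 I, J I & B < I); last first.
  move=> /existsNP[B hB].
  have empty : within J (pinfty_nbhs R) set0.
    exists B; split; first exact: num_real.
    by move=> I BI JI; apply: hB; exists I.
  case=> [[I JI ->]|[N N0 ->]|->]; (split; first exact: _).
  - apply: Or31; exists I => //; split=> [K|].
      by apply: filterS (nbhs_infty_ger (K / I)) => N /=; rewrite ler_pdivrMr ?J_gt0.
    by apply: filterS (nbhs_infty_gt 0) => N /= N0; split.
  - by apply: Or33; exact: filterS empty.
  - by apply: Or33; exists (setT, set0) => /=; [split=> //; exact: filterT|move=> [? ?] []].
case=> [[I JI ->]|[N N0 ->]|->]; (split; first exact: _).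
- apply: Or31; exists I => //; split=> [K|].
    by apply: filterS (nbhs_infty_ger (K / I)) => N /=; rewrite ler_pdivrMr ?J_gt0.
  by apply: filterS (nbhs_infty_gt 0) => N /= N0; split.
- apply: Or32; split=> [K|].
    apply: filterS (near_within_pinfty (Num.max 0 K)) => I [_ hI]; exact: scale.
  by split=> // B; apply: filterS (near_within_pinfty B) => I hI.
- apply: Or32; split=> [K|].
    exists ([set N | (0 < N)%N], [set I | J I /\ Num.max 0 K <= I]) => /=.
      by split; [exact: nbhs_infty_gt|exact: near_within_pinfty].
    by move=> [N I] /= [N0 [_ hI]]; exact: scale.
  split=> // B; exists ([set N | (0 < N)%N], [set I | J I /\ B <= I]) => /=.
    by split; [exact: nbhs_infty_gt|exact: near_within_pinfty].
  by move=> [N I] [].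
Qed.

End regimes.

Theorem corollary1 (R : realType) (d M Kx Ky : nat)
  (hd : d = 2%N \/ d = 3%N) (hM : (1 <= M)%N)
  (S : frame_model R d M Kx Ky)
  (J : set R) (hJ : forall I, J I -> 0 < I)
  (theta0 : 'cV[R]_(M * d)) (htheta0 : Theta S theta0)
  (hident : identifiable_up_to_relabeling S theta0)
  (hC1 : compact (Theta S) /\ (interior (Theta S)) theta0)
  (hC2 : forall I, J I -> regular_intensity S I)
  (hC3 : forall I, J I -> posdef (fisher S I theta0))
  (hC4 : third_order_envelope S J theta0)
  (disp : measure_display) (T : nat * R -> measurableType disp)
  (P : forall a : nat * R, probability (T a) R)
  (V : forall a : nat * R, 'I_a.1 -> pixel Kx Ky -> {RV (P a) >-> nat})
  (hV : forall a : nat * R, J a.2 -> poisson_frames S a.2 theta0 (V a))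
  (GML : forall a : nat * R, T a -> 'cV[R]_(M * d))
  (hGML : forall a : nat * R, J a.2 ->
     GML_estimator S a.2 theta0 (V a) (GML a))
  (disp' : measure_display) (T' : measurableType disp') (P' : probability T' R)
  (z : T' -> 'cV[R]_(M * d)) (hz : normal_law P' z 0 1%:M) :
  (forall G : set_system (nat * R), asymptotic_regime J G ->
     cvg_to_normal G P
       (fun a w => normalized S a.1 a.2 theta0 (GML a w)) 0 1%:M) /\
  (forall (N : nat) (I : R), (0 < N)%N -> J I ->
     normal_law P' (UGIAF S N I theta0 z)
       theta0 (invmx (total_fisher S N I theta0)) /\
     normal_law P' (fun w => normalized S N I theta0 (UGIAF S N I theta0 z w))
       0 1%:M).
Proof.
have n0 : (0 < M * d)%N by rewrite muln_gt0 hM; case: hd => ->.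
have [cptT int0] := hC1.
have posF N I : (0 < N)%N -> J I -> posdef (total_fisher S N I theta0).
  by move=> N0 JI; exact: (total_fisher_posdef hC3).
split=> [G /(regime_cases hJ)[FG regime]|N I N0 JI]; last first.
  split; first exact: UGIAF_normal hz (posF _ _ N0 JI).
  by rewrite (normalized_UGIAF z (posF _ _ N0 JI)).
(* The conclusion along G from the expansions at a reference intensity I1. *)
have main (I1 : R) (tail : R -> R -> Prop) : J I1 ->
    (forall N I, tail N I -> 1 <= N /\ I1 <= I) ->
    (exists2 r' : R, 0 < r' & dark_negligible S theta0 tail r') ->
    diverges G ->
    (\forall a \near G, [/\ J a.2, (0 < a.1)%N & tail a.1%:R a.2]) ->
    cvg_to_normal G P (fun a w => normalized S a.1 a.2 theta0 (GML a w)) 0 1%:M.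
  move=> JI1 tail_ge dark div near_tail.
  have [m [C [r [C0 r0 expansion]]]] := scaled_signal_expansion hJ int0 hC4 JI1.
  apply: (@normalized_GML_cvg _ _ _ _ _ S J theta0 disp T P V GML m tail) => //.
  - exact: dark_gradient r0 expansion.
  - by move=> N I N0 JI; exact: (info_root_sqrtmx hJ int0 r0 expansion hC3).
  - exact: (GML_close_to_score hJ int0 C0 r0 JI1 expansion hC2 hC3 hident cptT tail_ge dark).
  - exact: cvg_eps.
case: regime => [[I1 JI1 [div near1]]|[div [Jinf near1]]|G0].
- have [m [C [r [C0 r0 expansion]]]] := scaled_signal_expansion hJ int0 hC4 JI1.
  apply: (main I1 (fun N I => 1 <= N /\ I = I1)) => //.
  + by move=> N I [? ->].
  + exists r => //; exact: (dark_negligible_fixed hJ C0 r0 JI1 expansion).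
  + by apply: filterS near1 => a [N0 ->]; split=> //; split=> //; rewrite ler1n.
- have [I1 JI1 _] := Jinf 0.
  have [m [C [r [C0 r0 expansion]]]] := scaled_signal_expansion hJ int0 hC4 JI1.
  apply: (main I1 (fun N I => 1 <= N /\ (J I /\ I1 <= I))) => //.
  + by move=> N I [? []].
  + exact: (dark_negligible_unbounded n0 hJ int0 hC4 I1 r0 expansion Jinf).
  + by apply: filterS (near1 I1) => a [N0 [Ja Ia]]; split=> //; split; rewrite ?ler1n.
- by move=> d2 T2 P2 Z ZN f cf bf A _; exact: filterS (@sub0set _ _) G0.
Qed.
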